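(* Let $\eta=e^{\pi i/3}$, let $N$ be an even positive integer, $c=4\operatorname{Im}\eta/N$, $r>0$, and let $\Gamma_c := \langle\Lambda_{\eta,c},\ (0,c/6)\,\mu(\eta)\rangle\subset\mathbb{H}\rtimes S^1$, assumed to be a Heisenberg Bieberbach group. Let $M=\Gamma_c\backslash\mathbb{H}$, equipped with the CR structure induced from $\mathbb{H}$ and the contact form $r\theta_{\mathbb{H}}$, and let $\Delta_b$ and $T$ be its sub-Laplacian and Reeb vector field. For $n\in\mathbb{Z}\setminus\{0\}$ and $k\in\mathbb{Z}_{\ge0}$, the multiplicity $m_{n,k}$ of $$\sigma_{n,k}=\left(\frac{(4k+2)\pi|n|}{cr},\frac{2\pi n}{cr}\right)$$ in the joint spectrum of $\Delta_b$ and $i^{-1}T$ on $M$ is given by $$\begin{aligned} m_{n,k}=\frac16\Bigg(&|n|N+2(-1)^{n+k}+2\cos\frac{\pi(|n|-k+1)}{3}+\frac{2}{\sqrt3}\cos\left(\frac{2\pi(|n|-k)}{3}+\frac{\pi}{6}\right)\\ &+\frac{4}{\sqrt3}\cos\left(\frac{2\pi(|n|-k+|n|N)}{3}+\frac{\pi}{6}\right)\Bigg).\end{aligned}$$ Moreover, for any $\kappa>0$, the multiplicity of $(\kappa,0)$ in the joint spectrum is equal to $\#E_\kappa/6$, where $E_\kappa=\{\zeta\in L_\eta' : \pi^2|\zeta|^2/r=\kappa\}$.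
   Context: The Heisenberg group is $\mathbb{H} = \mathbb{C}\times\mathbb{R}$ with multiplication $(z,t)\cdot(z',t') = (z+z', t+t'+2\operatorname{Im}(z\bar z'))$. For $\lambda\in\mathbb{C}^*$ let $\mu(\lambda)(z,t)=(\lambda z,|\lambda|^2t)$. $\mathbb{H}\rtimes\mathbb{C}^*$ has multiplication $(g,\lambda)\cdot(h,\nu)=(g\cdot\mu(\lambda)(h),\lambda\nu)$ and acts on $\mathbb{H}$ by $(g,\lambda)h=g\cdot\mu(\lambda)(h)$; $(g,\lambda)$ is also written $g\,\mu(\lambda)$, $\mathbb{H}$ is identified with the elements $(g,1)$, and $\mathbb{H}\rtimes S^1$ is the subgroup with $|\lambda|=1$. A Heisenberg Bieberbach group is a discrete torsion-free subgroup $\Gamma\subset\mathbb{H}\rtimes S^1$ with $\Gamma\backslash\mathbb{H}$ compact. For $4\operatorname{Im}\tau/c\in\mathbb{Z}_{>0}$, $\Lambda_{\tau,c}=\langle(1,0),(\tau,0),(0,c)\rangle\subset\mathbb{H}$; here $\tau=\eta$, and $N=4\operatorname{Im}\eta/c=\#(Z(\Lambda_{\eta,c})/[\Lambda_{\eta,c},\Lambda_{\eta,c}])$. $L_\eta=\mathbb{Z}+\mathbb{Z}\eta$, and $L_\eta'=\{\zeta\in\mathbb{C} : \operatorname{Re}(\zeta\bar z)\in\mathbb{Z}\text{ for all }z\in L_\eta\}$ is its dual lattice. The CR structure on $\mathbb{H}$ is spanned by $Z=\partial_z+i\bar z\,\partial_t$, and $\theta_{\mathbb{H}}=dt+i(z\,d\bar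 z-\bar z\,dz)$; both are invariant under $\mathbb{H}\rtimes S^1$ and so descend to the quotient. Functions on $M$ are identified with $\Gamma_c$-invariant functions on $\mathbb{H}$. With respect to $r\theta_{\mathbb{H}}$, the sub-Laplacian is $\Delta_b=-\frac{1}{2r}(Z\bar Z+\bar ZZ)$ and the Reeb vector field is $T=\frac1r\partial_t$. The multiplicity of $(a,b)\in\mathbb{R}^2$ in the joint spectrum is the complex dimension of $\{f\in C^\infty(M;\mathbb{C}) : \Delta_bf=af,\ i^{-1}Tf=bf\}$ (zero if $(a,b)$ is not a joint eigenvalue). *)

(* Defs.v *)
From Stdlib Require Import Reals ZArith List.
From Coquelicot Require Import Coquelicot.

Open Scope R_scope.

(** * The Heisenberg group and its semidirect product with C^* *)

Definition Heis : Type := (C * R)%type.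

Definition Hmul (g h : Heis) : Heis :=
  (Cplus (fst g) (fst h),
   snd g + snd h + 2 * Im (Cmult (fst g) (Cconj (fst h)))).

Definition Hone : Heis := (RtoC 0, 0).

(* This is the inverse for Hmul because Im (z * conj z) = 0. *)
Definition Hinv (g : Heis) : Heis := (Copp (fst g), - snd g).

Definition mu (l : C) (g : Heis) : Heis :=
  (Cmult l (fst g), Cmod l ^ 2 * snd g).

(* Pairs (g, l); the group itself consists of those pairs with l <> 0. *)
Definition HC : Type := (Heis * C)%type.

Definition HCmul (x y : HC) : HC :=
  (Hmul (fst x) (mu (snd x) (fst y)), Cmult (snd x) (snd y)).

Definition HCone : HC := (Hone, RtoC 1).

Definition HCinv (x : HC) : HC :=
  (mu (Cinv (snd x)) (Hinv (fst x)), Cinv (snd x)).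

Fixpoint HCpow (x : HC) (n : nat) : HC :=
  match n with
  | O => HCone
  | S n' => HCmul x (HCpow x n')
  end.

Definition HCact (x : HC) (h : Heis) : Heis := Hmul (fst x) (mu (snd x) h).

(* The subgroup generated by S, meaningful when all elements of S have a
   nonzero second component. *)
Inductive generated (S : HC -> Prop) : HC -> Prop :=
| generated_in : forall x, S x -> generated S x
| generated_one : generated S HCone
| generated_mul : forall x y,
    generated S x -> generated S y -> generated S (HCmul x y)
| generated_inv : forall x, generated S x -> generated S (HCinv x).

(** * Heisenberg Bieberbach groups *)

(* A subgroup of the semidirect product of the Heisenberg group with S^1. *)
Definition unitary_subgroup (G : HC -> Prop) : Prop :=
  (forall x, G x -> Cmod (snd x) = 1) /\
  G HCone /\
  (forall x y, G x -> G y -> G (HCmul x y)) /\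
  (forall x, G x -> G (HCinv x)).

Definition Heis_UniformSpace : UniformSpace :=
  prod_UniformSpace C_UniformSpace R_UniformSpace.

Definition HC_UniformSpace : UniformSpace :=
  prod_UniformSpace Heis_UniformSpace C_UniformSpace.

Definition discrete (G : HC -> Prop) : Prop :=
  forall x, G x -> @locally HC_UniformSpace x (fun y => G y -> y = x).

Definition torsion_free (G : HC -> Prop) : Prop :=
  forall x (n : nat), G x -> (0 < n)%nat -> HCpow x n = HCone -> x = HCone.

Definition invariant_set (G : HC -> Prop) (U : Heis -> Prop) : Prop :=
  forall x h, G x -> (U (HCact x h) <-> U h).

(* Open subsets of G\Heis for the quotient topology are the same thing as
   G-invariant open subsets of Heis, so this is the open-cover definition of
   compactness of G\Heis. *)
Definition quotient_compact (G : HC -> Prop) : Prop :=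
  forall F : (Heis -> Prop) -> Prop,
    (forall U, F U -> @open Heis_UniformSpace U /\ invariant_set G U) ->
    (forall h, exists U, F U /\ U h) ->
    exists l : list (Heis -> Prop),
      (forall U, In U l -> F U) /\ (forall h, exists U, In U l /\ U h).

Definition heisenberg_bieberbach (G : HC -> Prop) : Prop :=
  unitary_subgroup G /\ discrete G /\ torsion_free G /\ quotient_compact G.

(** * The lattices and the group of the theorem *)

(* exp(i pi / 3) *)
Definition eta : C := (cos (PI / 3), sin (PI / 3)).

Definition Lambda (tau : C) (c : R) : HC -> Prop :=
  generated (fun x =>
    x = ((RtoC 1, 0), RtoC 1) \/
    x = ((tau, 0), RtoC 1) \/
    x = ((RtoC 0, c), RtoC 1)).

Definition Gamma (c : R) : HC -> Prop :=
  generated (fun x => Lambda eta c x \/ x = ((RtoC 0, c / 6), eta)).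

Definition L_eta (z : C) : Prop :=
  exists a b : Z, z = Cplus (RtoC (IZR a)) (Cmult (RtoC (IZR b)) eta).

Definition dual_lattice (L : C -> Prop) (zeta : C) : Prop :=
  forall z, L z -> exists m : Z, Re (Cmult zeta (Cconj z)) = IZR m.

Definition E_set (r kappa : R) (zeta : C) : Prop :=
  dual_lattice L_eta zeta /\ PI ^ 2 * Cmod zeta ^ 2 / r = kappa.

Definition has_card (A : C -> Prop) (n : nat) : Prop :=
  exists l : list C, NoDup l /\ (forall z, In z l <-> A z) /\ length l = n.

(** * Smooth functions and differential operators *)

Definition CDerive (g : R -> C) (s : R) : C :=
  (Derive (fun u => Re (g u)) s, Derive (fun u => Im (g u)) s).

Definition ex_CDerive (g : R -> C) (s : R) : Prop :=
  ex_derive (fun u => Re (g u)) s /\ ex_derive (fun u => Im (g u)) s.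

(* A point of Heis is ((x, y), t) with z = x + i y; the three slices of f
   through p along the real coordinates x, y, t. *)
Definition slice_x (f : Heis -> C) (p : Heis) : R -> C :=
  fun s => f ((s, Im (fst p)), snd p).
Definition slice_y (f : Heis -> C) (p : Heis) : R -> C :=
  fun s => f ((Re (fst p), s), snd p).
Definition slice_t (f : Heis -> C) (p : Heis) : R -> C :=
  fun s => f (fst p, s).

Definition d_x (f : Heis -> C) (p : Heis) : C :=
  CDerive (slice_x f p) (Re (fst p)).
Definition d_y (f : Heis -> C) (p : Heis) : C :=
  CDerive (slice_y f p) (Im (fst p)).
Definition d_t (f : Heis -> C) (p : Heis) : C :=
  CDerive (slice_t f p) (snd p).

Fixpoint class_C (m : nat) (f : Heis -> C) : Prop :=
  match m with
  | O => forall p : Heis, @continuous Heis_UniformSpace C_UniformSpace f p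
  | S m' =>
      (forall p : Heis,
         ex_CDerive (slice_x f p) (Re (fst p)) /\
         ex_CDerive (slice_y f p) (Im (fst p)) /\
         ex_CDerive (slice_t f p) (snd p)) /\
      class_C m' (d_x f) /\ class_C m' (d_y f) /\ class_C m' (d_t f)
  end.

Definition smooth (f : Heis -> C) : Prop := forall m : nat, class_C m f.

(* Wirtinger derivatives (d_x -+ i d_y) / 2 *)
Definition d_z (f : Heis -> C) (p : Heis) : C :=
  Cdiv (Cminus (d_x f p) (Cmult Ci (d_y f p))) (RtoC 2).
Definition d_zbar (f : Heis -> C) (p : Heis) : C :=
  Cdiv (Cplus (d_x f p) (Cmult Ci (d_y f p))) (RtoC 2).

Definition Zop (f : Heis -> C) (p : Heis) : C :=
  Cplus (d_z f p) (Cmult (Cmult Ci (Cconj (fst p))) (d_t f p)).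

(* The complex conjugate of the vector field Zop. *)
Definition Zbarop (f : Heis -> C) (p : Heis) : C :=
  Cminus (d_zbar f p) (Cmult (Cmult Ci (fst p)) (d_t f p)).

(* Sub-Laplacian and Reeb field of r * theta_H, theta_H = dt + i(z dzbar - zbar dz). *)
Definition sublaplacian (r : R) (f : Heis -> C) (p : Heis) : C :=
  Cmult (RtoC (- (1 / (2 * r))))
        (Cplus (Zop (Zbarop f) p) (Zbarop (Zop f) p)).

Definition reeb (r : R) (f : Heis -> C) (p : Heis) : C :=
  Cmult (RtoC (1 / r)) (d_t f p).

(** * Multiplicities in the joint spectrum *)

Definition invariant_fun (G : HC -> Prop) (f : Heis -> C) : Prop :=
  forall x h, G x -> f (HCact x h) = f h.

(* Smooth functions on G\Heis are the G-invariant smooth functions on Heis. *)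
Definition joint_eigenspace (G : HC -> Prop) (r a b : R) (f : Heis -> C) : Prop :=
  smooth f /\ invariant_fun G f /\
  (forall p, sublaplacian r f p = Cmult (RtoC a) (f p)) /\
  (forall p, Cmult (Cinv Ci) (reeb r f p) = Cmult (RtoC b) (f p)).

Definition lincomb (d : nat) (a : nat -> C) (B : nat -> Heis -> C) (p : Heis) : C :=
  sum_n_m (fun i => Cmult (a i) (B i p)) 1 d.

(* The complex subspace V has a basis B 1, ..., B d. *)
Definition has_dim (V : (Heis -> C) -> Prop) (d : nat) : Prop :=
  exists B : nat -> Heis -> C,
    (forall i, (1 <= i <= d)%nat -> V (B i)) /\
    (forall a : nat -> C,
       (forall p, lincomb d a B p = RtoC 0) ->
       forall i, (1 <= i <= d)%nat -> a i = RtoC 0) /\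
    (forall f, V f -> exists a : nat -> C, forall p, f p = lincomb d a B p).

Definition multiplicity (G : HC -> Prop) (r a b : R) (m : nat) : Prop :=
  has_dim (joint_eigenspace G r a b) m.

(* Main.v *)
Require Import Defs.
From Stdlib Require Import Reals ZArith List Lia Lra Psatz FunctionalExtensionality Permutation.
From Coquelicot Require Import Coquelicot.
Open Scope R_scope.

(** An eigenfunction of T has the form f(z,t) = exp(i a t) f(z,0) with a = 2 pi n / c.
    Invariance under the lattice then says that f is quasi-periodic under the translations 1
    and eta, and invariance under the remaining generator says that the rotation z -> eta z
    multiplies f by exp(-i pi n / 3) ([invariant_iff_qp], [joint_iff_level]).

    Nonzero frequency. Complex conjugation exchanges n and -n ([joint_conj]), so let n > 0.
    On functions of frequency a the field Z and its conjugate Zbar satisfy [Z, Zbar] = 2a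
    ([freq_commutator]), so they are ladder operators and the eigenvalue with index k is the
    k-th Landau level. Two analytic facts about quasi-periodic f control the levels. First,
    Z f = 0 implies f = 0, because the Fourier coefficients of such an f along horizontal
    lines would have to grow ([Zop_kernel_zero]); hence level 0 is the space of ground
    states Zbar f = 0, and Z^k maps it isomorphically onto level k ([level_spans],
    [raise_independent]). Second, a ground state is determined by M = nN Fourier
    coefficients ([coef_determines]), so at most M ground states are independent.

    M ground states are written down as a Gaussian times products of three theta functions
    F0, F1, F2. These are projections of theta series to rotation weights 0, 1, 2, and a
    numerical estimate of the series at the origin shows that they vanish there to order
    exactly 0, 1, 2 ([F0_ord], [F1_ord], [F2_ord]). In their products the order of vanishing
    equals the rotation weight q, and it takes each of the values 0, ..., M-2 and M once;
    distinct orders make the products independent ([wave_independent]), so they form a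
    basis. Since Z^k shifts the weight by -k ([raise_rot]), the multiplicity is the number
    of these q with q + n - k divisible by 6 ([level_rot_dim]). This number and the
    trigonometric formula both grow by 1 when M grows by 6 and have period 6 in n - k, which
    leaves 18 cases to compare ([count_formula]).

    Zero frequency. Now f is a function on the torus C / L_eta and the sub-Laplacian is a
    multiple of the flat Laplacian. A double Fourier expansion shows that the eigenspace is
    spanned by the characters of the dual lattice vectors in E_kappa ([eigenfun_expansion]).
    The rotation permutes these vectors in orbits of six, because none of them is zero, and
    the sums of characters over orbits are a basis of the rotation-invariant eigenfunctions
    ([invariant_eigen_dim]). *)

(** * Complex exponentials *)

Lemma C_ext (a b : C) : Re a = Re b -> Im a = Im b -> a = b.
Proof. destruct a, b; simpl; intros; congruence. Qed.

Ltac re_im := apply C_ext; unfold Re, Im; simpl; try ring.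

Definition Cexp (z : C) : C :=
  (exp (Re z) * cos (Im z), exp (Re z) * sin (Im z)).

Lemma Cexp_add a b : Cexp (a + b)%C = (Cexp a * Cexp b)%C.
Proof.
  unfold Cexp; apply C_ext; unfold Re, Im; simpl; rewrite exp_plus, ?cos_plus, ?sin_plus; ring.
Qed.

Lemma Cexp_0 : Cexp 0 = 1.
Proof. unfold Cexp; apply C_ext; unfold Re, Im; simpl; rewrite exp_0, ?cos_0, ?sin_0; ring. Qed.

Lemma Cmod_Cexp z : Cmod (Cexp z) = exp (Re z).
Proof.
  unfold Cexp, Cmod; simpl.
  replace (_ + _) with (exp (Re z) ^ 2 * ((sin (Im z))² + (cos (Im z))²))
    by (unfold Rsqr; ring).
  rewrite sin2_cos2, Rmult_1_r. apply sqrt_pow2. left; apply exp_pos.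
Qed.

Lemma Cexp_neq_0 z : Cexp z <> 0.
Proof.
  intros H. apply (f_equal Cmod) in H. rewrite Cmod_Cexp, Cmod_0 in H.
  pose proof (exp_pos (Re z)); lra.
Qed.

Lemma cos_2PI_IZR k : cos (2 * PI * IZR k) = 1.
Proof.
  assert (H : forall n : nat, cos (2 * PI * INR n) = 1).
  { intros n. replace (2 * PI * INR n) with (0 + 2 * INR n * PI) by ring.
    rewrite cos_period; apply cos_0. }
  destruct (Z_le_gt_dec 0 k) as [Hk|Hk].
  - rewrite <- (Z2Nat.id k Hk), <- INR_IZR_INZ; apply H.
  - replace (2 * PI * IZR k) with (- (2 * PI * IZR (- k))) by (rewrite opp_IZR; ring).
    rewrite cos_neg, <- (Z2Nat.id (- k)), <- INR_IZR_INZ by lia. apply H.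
Qed.

Lemma sin_2PI_IZR k : sin (2 * PI * IZR k) = 0.
Proof.
  assert (H : forall n : nat, sin (2 * PI * INR n) = 0).
  { intros n. replace (2 * PI * INR n) with (0 + 2 * INR n * PI) by ring.
    rewrite sin_period; apply sin_0. }
  destruct (Z_le_gt_dec 0 k) as [Hk|Hk].
  - rewrite <- (Z2Nat.id k Hk), <- INR_IZR_INZ; apply H.
  - replace (2 * PI * IZR k) with (- (2 * PI * IZR (- k))) by (rewrite opp_IZR; ring).
    rewrite sin_neg, <- (Z2Nat.id (- k)), <- INR_IZR_INZ, H by lia. ring.
Qed.

(** * Complex-valued functions of a real variable *)

Definition is_Cd (g : R -> C) (s : R) (l : C) : Prop :=
  is_derive (fun u => Re (g u)) s (Re l) /\ is_derive (fun u => Im (g u)) s (Im l).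

Lemma is_Cd_CDerive g s l : is_Cd g s l -> CDerive g s = l.
Proof.
  intros [H1 H2]; unfold CDerive; apply C_ext; simpl; apply is_derive_unique; assumption.
Qed.

Lemma is_Cd_ex g s l : is_Cd g s l -> ex_CDerive g s.
Proof. intros [H1 H2]; split; eexists; eauto. Qed.

Lemma ex_Cd g s : ex_CDerive g s -> is_Cd g s (CDerive g s).
Proof. intros [H1 H2]; split; simpl; apply Derive_correct; assumption. Qed.

Lemma is_Cd_unique g s l l' : is_Cd g s l -> is_Cd g s l' -> l = l'.
Proof. intros H H'; rewrite <- (is_Cd_CDerive _ _ _ H); apply is_Cd_CDerive; auto. Qed.

Lemma is_Cd_ext f g s l : (forall u, f u = g u) -> is_Cd f s l -> is_Cd g s l.
Proof. intros E H; replace g with f; auto. apply functional_extensionality; auto. Qed.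

Lemma is_Cd_val g s l l' : is_Cd g s l -> l = l' -> is_Cd g s l'.
Proof. intros H <-; auto. Qed.

Lemma is_Cd_const c s : is_Cd (fun _ => c) s 0.
Proof. split; simpl; auto_derive; auto. Qed.

Lemma is_derive_val (f : R -> R) (x l l' : R) : is_derive f x l -> l = l' -> is_derive f x l'.
Proof. intros H <-; auto. Qed.

Lemma is_derive_Rmult (f g : R -> R) (x df dg : R) : is_derive f x df -> is_derive g x dg ->
  is_derive (fun u => f u * g u) x (df * g x + f x * dg).
Proof. intros; apply (is_derive_mult f g); auto. intros; apply Rmult_comm. Qed.

Lemma is_derive_Rcomp (h k : R -> R) (x l m : R) : is_derive h x l -> is_derive k (h x) m ->
  is_derive (fun u => k (h u)) x (l * m).
Proof. intros; apply (is_derive_comp k h); auto. Qed.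

Lemma is_Cd_plus f g s a b : is_Cd f s a -> is_Cd g s b ->
  is_Cd (fun u => (f u + g u)%C) s (a + b)%C.
Proof.
  intros [H1 H2] [H3 H4]; split; simpl.
  - exact (is_derive_plus _ _ _ _ _ H1 H3).
  - exact (is_derive_plus _ _ _ _ _ H2 H4).
Qed.

Lemma is_Cd_mult f g s a b : is_Cd f s a -> is_Cd g s b ->
  is_Cd (fun u => (f u * g u)%C) s (a * g s + f s * b)%C.
Proof.
  intros [H1 H2] [H3 H4]; split; simpl.
  - eapply is_derive_val.
    + exact (is_derive_minus _ _ _ _ _ (is_derive_Rmult _ _ _ _ _ H1 H3)
        (is_derive_Rmult _ _ _ _ _ H2 H4)).
    + unfold Re, Im, minus, plus, opp; simpl; ring.
  - eapply is_derive_val.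
    + exact (is_derive_plus _ _ _ _ _ (is_derive_Rmult _ _ _ _ _ H1 H4)
        (is_derive_Rmult _ _ _ _ _ H2 H3)).
    + unfold Re, Im, minus, plus, opp; simpl; ring.
Qed.

Lemma is_Cd_scal c f s a : is_Cd f s a -> is_Cd (fun u => (c * f u)%C) s (c * a)%C.
Proof.
  intros H. eapply is_Cd_val. apply is_Cd_mult; [apply is_Cd_const|exact H]. cbv beta. ring.
Qed.

Lemma is_Cd_conj f s a : is_Cd f s a -> is_Cd (fun u => Cconj (f u)) s (Cconj a).
Proof.
  intros [H1 H2]; split; simpl; auto. exact (is_derive_opp _ _ _ H2).
Qed.

Lemma is_Cd_RtoC f s a : is_derive f s a -> is_Cd (fun u => RtoC (f u)) s (RtoC a).
Proof. intros H; split; simpl; auto. exact (is_derive_const _ _). Qed.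

Lemma is_Cd_Cexp f s a : is_Cd f s a ->
  is_Cd (fun u => Cexp (f u)) s (Cexp (f s) * a)%C.
Proof.
  intros [H1 H2]; unfold Re, Im in *.
  split; unfold Cexp, Re, Im; simpl.
  - eapply is_derive_val.
    + apply is_derive_Rmult; [apply is_derive_Rcomp;
        [exact H1|apply is_derive_exp] |apply is_derive_Rcomp; [exact H2|apply is_derive_cos]].
    + cbv beta; ring.
  - eapply is_derive_val.
    + apply is_derive_Rmult; [apply is_derive_Rcomp;
        [exact H1|apply is_derive_exp] |apply is_derive_Rcomp; [exact H2|apply is_derive_sin]].
    + cbv beta; ring.
Qed.

Lemma is_Cd_shift f s a b : is_Cd f (s + b) a -> is_Cd (fun u => f (u + b)) s a.
Proof.
  assert (D : forall (h : R -> R) l, is_derive h (s + b) l -> is_derive (fun u => h (u + b)) s l).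
  { intros h l H. eapply is_derive_val.
    - apply (is_derive_comp h (fun u => u + b)); [exact H|].
      instantiate (1 := 1). auto_derive; auto.
    - unfold scal; simpl; unfold mult; simpl; ring. }
  intros [H1 H2]; split; [apply (D _ _ H1)|apply (D _ _ H2)].
Qed.

Lemma is_Cd_eq0_const f : (forall s, is_Cd f s 0) -> forall s, f s = f 0.
Proof.
  intros H s.
  assert (D : forall (h : R -> R), (forall s, is_derive h s 0) -> h s = h 0).
  { intros h Hh. destruct (MVT_gen h 0 s (fun _ => 0)) as [x [_ Hx]].
    - intros; apply Hh.
    - intros. apply continuity_pt_filterlim, (ex_derive_continuous h). eexists; apply Hh.
    - lra. }
  apply C_ext; [apply (D (fun u => Re (f u)))|apply (D (fun u => Im (f u)))]; intros; apply H.
Qed.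

(** * Entire functions *)

Definition is_CC (h : C -> C) (z l : C) : Prop :=
  @is_derive C_AbsRing (AbsRing_NormedModule C_AbsRing) h z l.

Lemma is_CC_eps h z l : is_CC h z l <->
  (forall eps, 0 < eps -> exists del, 0 < del /\
    forall w, Cmod w < del ->
      Cmod (h (z + w)%C - h z - l * w)%C <= eps * Cmod w).
Proof.
  split.
  - intros [_ H] eps He.
    assert (Hf : is_filter_lim (locally (T := AbsRing_NormedModule C_AbsRing) z) z).
    { intros P [d Hd]; exists d; exact Hd. }
    destruct (H z Hf (mkposreal eps He)) as [[d Hd] Hb].
    exists d; split; auto. intros w Hw.
    specialize (Hb (z + w)%C).
    assert (E : (z + w - z)%C = w) by ring.
    change (Cmod (z + w - z)%C < d ->
      Cmod (h (z + w)%C - h z - (z + w - z) * l)%C <=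
        eps * Cmod (z + w - z)%C) in Hb.
    rewrite E in Hb. rewrite (Cmult_comm l w). auto.
  - intros H; split.
    + apply is_linear_scal_l.
    + intros x Hx. apply (is_filter_lim_locally_unique (V := AbsRing_NormedModule C_AbsRing)) in Hx.
        subst x.
      intros eps. destruct (H eps (cond_pos eps)) as [d [Hd Hb]].
      exists (mkposreal d Hd). intros y Hy.
      change (Cmod (y - z)%C < d) in Hy.
      specialize (Hb _ Hy).
      assert (E : forall y : C, (z + (y - z))%C = y) by (intros; ring).
      rewrite E in Hb.
      change (Cmod (h y - h z - (y - z) * l)%C <= eps * Cmod (y - z)%C).
      rewrite (Cmult_comm (y - z)%C l). exact Hb.
Qed.

(** Complex differentiability controls every real directional derivative; the partial
    derivatives in x and y are the directions 1 and i. *)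
Lemma is_CC_line h z l d (s0 : R) : is_CC h (z + s0 * d)%C l ->
  is_Cd (fun s => h (z + s * d)%C) s0 (l * d)%C.
Proof.
  intros H. rewrite is_CC_eps in H.
  assert (K : forall eps, 0 < eps -> exists del, 0 < del /\ forall s, s <> 0 -> Rabs s < del ->
    Cmod ((h (z + RtoC (s0 + s) * d)%C - h (z + s0 * d)%C) / s - l * d)%C < eps).
  { intros eps He.
    assert (Hd : 0 < Cmod d + 1) by (pose proof (Cmod_ge_0 d); lra).
    destruct (H (eps / (Cmod d + 1))) as [del [Hdel Hb]].
    { apply Rdiv_lt_0_compat; auto. }
    exists (del / (Cmod d + 1)). split. { apply Rdiv_lt_0_compat; auto. }
    intros s Hs0 Hs.
    assert (Hsc : RtoC s <> 0) by (intros E; apply Hs0, RtoC_inj; exact E).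
    assert (Hsp : 0 < Rabs s) by (apply Rabs_pos_lt; auto).
    assert (Hlt : Cmod (s * d)%C < del).
    { rewrite Cmod_mult, Cmod_R.
      apply Rle_lt_trans with (Rabs s * (Cmod d + 1)); [nra|].
      apply Rmult_lt_reg_r with (/ (Cmod d + 1)); [apply Rinv_0_lt_compat; auto|].
      rewrite Rmult_assoc, Rinv_r by lra. unfold Rdiv in Hs; lra. }
    specialize (Hb _ Hlt).
    rewrite <- Cplus_assoc in Hb.
    replace (s0 * d + s * d)%C with (RtoC (s0 + s) * d)%C in Hb
      by (rewrite RtoC_plus; ring).
    replace (_ - _)%C with ((h (z + RtoC (s0 + s) * d)%C - h (z + s0 * d)%C - l * (s * d)) / s)%C
      by (field; auto).
    rewrite Cmod_div, Cmod_R by auto.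
    apply Rmult_lt_reg_r with (Rabs s); auto.
    unfold Rdiv; rewrite Rmult_assoc, Rinv_l, Rmult_1_r by lra.
    eapply Rle_lt_trans; [exact Hb|].
    rewrite Cmod_mult, Cmod_R.
    replace (eps / (Cmod d + 1) * (Rabs s * Cmod d)) with
      (eps * Rabs s * (Cmod d / (Cmod d + 1))) by (field; lra).
    rewrite <- (Rmult_1_r (eps * Rabs s)) at 2.
    apply Rmult_lt_compat_l; [nra|].
    apply Rmult_lt_reg_r with (Cmod d + 1); auto.
    unfold Rdiv; rewrite Rmult_assoc, Rinv_l; lra. }
  split; apply is_derive_Reals; intros eps He; destruct (K eps He) as [del [Hd Hb]];
    exists (mkposreal del Hd); intros s Hs Hs'; specialize (Hb s Hs Hs').
  - eapply Rle_lt_trans; [|exact Hb]. eapply Rle_trans; [|apply re_le_Cmod].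
    right; f_equal. unfold Cdiv, Re; simpl. field. exact Hs.
  - eapply Rle_lt_trans; [|exact Hb]. eapply Rle_trans;
      [|eapply Rle_trans; [apply Rmax_r|apply Rmax_Cmod]].
    right; f_equal. unfold Cdiv, Im; simpl. field. exact Hs.
Qed.

Lemma is_CC_x h x y l : is_CC h (x, y) l -> is_Cd (fun s => h (s, y)) x l.
Proof.
  intros H. apply is_Cd_val with (l * 1)%C; [|ring].
  apply is_Cd_ext with (fun s => h ((0, y) + s * 1)%C).
  { intros u; f_equal; re_im. }
  apply is_CC_line. replace (_ + _)%C with ((x, y) : C); auto. re_im.
Qed.

Lemma is_CC_y h x y l : is_CC h (x, y) l -> is_Cd (fun s => h (x, s)) y (Ci * l)%C.
Proof.
  intros H. apply is_Cd_val with (l * Ci)%C; [|ring].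
  apply is_Cd_ext with (fun s => h ((x, 0) + s * Ci)%C).
  { intros u; f_equal; re_im. }
  apply is_CC_line. replace (_ + _)%C with ((x, y) : C); auto. re_im.
Qed.

Lemma is_CC_val h z l l' : is_CC h z l -> l = l' -> is_CC h z l'.
Proof. intros H <-; auto. Qed.

Lemma is_CC_const c z : is_CC (fun _ => c) z 0.
Proof. exact (@is_derive_const C_AbsRing (AbsRing_NormedModule C_AbsRing) c z). Qed.

Lemma is_CC_id z : is_CC (fun z => z) z 1.
Proof. exact (@is_derive_id C_AbsRing z). Qed.

Lemma is_CC_plus f g z a b : is_CC f z a -> is_CC g z b ->
  is_CC (fun u => (f u + g u)%C) z (a + b)%C.
Proof. exact (@is_derive_plus C_AbsRing (AbsRing_NormedModule C_AbsRing) f g z a b). Qed.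

Lemma is_CC_mult f g z a b : is_CC f z a -> is_CC g z b ->
  is_CC (fun u => (f u * g u)%C) z (a * g z + f z * b)%C.
Proof.
  intros H1 H2.
  exact (@is_derive_mult C_AbsRing f g z a b H1 H2 Cmult_comm).
Qed.

Lemma is_CC_comp f g z a b : is_CC f (g z) a -> is_CC g z b ->
  is_CC (fun u => f (g u)) z (b * a)%C.
Proof. exact (@is_derive_comp C_AbsRing (AbsRing_NormedModule C_AbsRing) f g z a b). Qed.

Lemma second_order_bound (g g' g'' : R -> R) K :
  (forall s, is_derive g s (g' s)) -> (forall s, is_derive g' s (g'' s)) ->
  (forall s, 0 <= s <= 1 -> Rabs (g'' s) <= K) -> Rabs (g 1 - g 0 - g' 0) <= K.
Proof.
  intros H1 H2 HK.
  assert (Cont : forall f f' : R -> R, (forall s, is_derive f s (f' s)) -> forall x,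
    continuity_pt f x).
  { intros f f' H x. apply continuity_pt_filterlim, (ex_derive_continuous f). eexists; apply H. }
  destruct (MVT_gen g 0 1 g') as [x [Hx E]]; [intros; apply H1|intros; eapply Cont; eauto|].
  rewrite Rmin_left, Rmax_right in Hx by lra.
  destruct (MVT_gen g' 0 x g'') as [y [Hy E']]; [intros; apply H2|intros; eapply Cont; eauto|].
  rewrite Rmin_left, Rmax_right in Hy by lra.
  replace (g 1 - g 0 - g' 0) with (g'' y * x) by lra.
  rewrite Rabs_mult, (Rabs_pos_eq x) by lra.
  assert (Hyy : 0 <= y <= 1) by lra.
  specialize (HK y Hyy). pose proof (Rabs_pos (g'' y)). nra.
Qed.

Lemma Cmod_le_sum z : Cmod z <= Rabs (Re z) + Rabs (Im z).
Proof.
  destruct z as [a b]; simpl.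
  replace (a, b) with (a + Ci * b)%C by re_im.
  eapply Rle_trans; [apply Cmod_triangle|].
  rewrite Cmod_mult, Cmod_Ci, !Cmod_R; simpl; lra.
Qed.

Lemma im_le_Cmod z : Rabs (Im z) <= Cmod z.
Proof. eapply Rle_trans; [apply Rmax_r|apply Rmax_Cmod]. Qed.

Lemma exp_le_mono x y : x <= y -> exp x <= exp y.
Proof. intros [H| ->]; [left; apply exp_increasing; auto|lra]. Qed.

Lemma Cexp_line u (s : R) : is_Cd (fun s => Cexp (s * u)%C) s (u * Cexp (s * u)%C)%C.
Proof.
  eapply is_Cd_val.
  - apply is_Cd_Cexp, is_Cd_mult; [apply is_Cd_RtoC, (@is_derive_id R_AbsRing)|apply is_Cd_const].
  - unfold one; simpl. ring.
Qed.

(** On the segment from 0 to u the second derivative of exp has modulus at most exp |u|; the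
    factor 2 comes from estimating the real and imaginary parts separately. *)
Lemma Cexp_taylor u :
  Cmod (Cexp u - 1 - u)%C <= 2 * (Cmod u ^ 2 * exp (Cmod u)).
Proof.
  set (phi := fun s => Cexp (s * u)%C).
  assert (D2 : forall s, is_Cd (fun s => (u * phi s)%C) s (u * u * phi s)%C).
  { intros s. eapply is_Cd_val; [apply is_Cd_scal, Cexp_line|unfold phi; ring]. }
  assert (B : forall s, 0 <= s <= 1 -> Cmod (u * u * phi s)%C <= Cmod u ^ 2 * exp (Cmod u)).
  { intros s Hs. unfold phi. rewrite !Cmod_mult, Cmod_Cexp.
    replace (Cmod u * Cmod u) with (Cmod u ^ 2) by ring.
    apply Rmult_le_compat_l; [apply pow2_ge_0|].
    apply exp_le_mono. rewrite re_scal_l.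
    pose proof (re_le_Cmod u). pose proof (Rabs_le_between (Re u) (Cmod u)).
    pose proof (Cmod_ge_0 u). nra. }
  assert (E : (Cexp u - 1 - u)%C =
     (phi 1 - phi 0 - u * phi 0)%C).
  { unfold phi. replace (1 * u)%C with u by ring.
    replace (0 * u)%C with (RtoC 0) by ring. rewrite Cexp_0; ring. }
  rewrite E. eapply Rle_trans; [apply Cmod_le_sum|].
  replace (2 * (Cmod u ^ 2 * exp (Cmod u))) with
    (Cmod u ^ 2 * exp (Cmod u) + Cmod u ^ 2 * exp (Cmod u)) by ring.
  apply Rplus_le_compat.
  - apply (second_order_bound (fun s => Re (phi s)) (fun s => Re (u * phi s)%C)
      (fun s => Re (u * u * phi s)%C)).
    + intros s; apply Cexp_line. + intros s; apply D2.
    + intros s Hs; eapply Rle_trans; [apply re_le_Cmod|auto].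
  - apply (second_order_bound (fun s => Im (phi s)) (fun s => Im (u * phi s)%C)
      (fun s => Im (u * u * phi s)%C)).
    + intros s; apply Cexp_line. + intros s; apply D2.
    + intros s Hs; eapply Rle_trans; [apply im_le_Cmod|auto].
Qed.

Lemma is_CC_quadratic h z l K : 0 <= K ->
  (forall w, Cmod w <= 1 ->
    Cmod (h (z + w)%C - h z - l * w)%C <= K * Cmod w ^ 2) -> is_CC h z l.
Proof.
  intros HK H. apply is_CC_eps. intros eps He.
  assert (H1 : 0 < eps / (K + 1)) by (apply Rdiv_lt_0_compat; lra).
  exists (Rmin 1 (eps / (K + 1))). split. { apply Rmin_glb_lt; auto; lra. }
  intros w Hw.
  assert (Hw1 : Cmod w < 1) by (eapply Rlt_le_trans; [exact Hw|apply Rmin_l]).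
  assert (Hw2 : Cmod w < eps / (K + 1)) by (eapply Rlt_le_trans; [exact Hw|apply Rmin_r]).
  eapply Rle_trans; [apply H; lra|].
  assert (K * Cmod w <= eps).
  { apply Rle_trans with ((K + 1) * (eps / (K + 1))).
    - apply Rmult_le_compat; try lra. apply Cmod_ge_0.
    - right; field; lra. }
  pose proof (Cmod_ge_0 w). nra.
Qed.

Lemma is_CC_Cexp z : is_CC Cexp z (Cexp z).
Proof.
  apply is_CC_quadratic with (Cmod (Cexp z) * (2 * exp 1)).
  { pose proof (Cmod_ge_0 (Cexp z)); pose proof (exp_pos 1); nra. }
  intros w Hw. rewrite Cexp_add.
  replace (_ - _)%C with (Cexp z * (Cexp w - 1 - w))%C by ring.
  rewrite Cmod_mult, !Rmult_assoc. apply Rmult_le_compat_l; [apply Cmod_ge_0|].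
  eapply Rle_trans; [apply Cexp_taylor|].
  apply Rmult_le_compat_l; [lra|]. rewrite Rmult_comm.
  apply Rmult_le_compat_r; [apply pow2_ge_0|]. apply exp_le_mono; auto.
Qed.

(** Entire functions, as a coinductive predicate: h belongs to some class of functions
    closed under complex differentiation. Higher derivatives then exist without any use of
    Cauchy theory. *)
Definition hol (h : C -> C) : Prop :=
  exists S : (C -> C) -> Prop, S h /\
    forall g, S g -> exists g', S g' /\ forall z, is_CC g z (g' z).

Lemma hol_ex h : hol h -> exists h', hol h' /\ forall z, is_CC h z (h' z).
Proof.
  intros [S [Sh HS]]. destruct (HS h Sh) as [h' [Sh' D]].
  exists h'; split; auto. exists S; auto.
Qed.

(** Closed under differentiation by the rules of calculus, so it is itself a class of the
    kind required by [hol]. *)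
Inductive entire_expr : (C -> C) -> Prop :=
| Hc_base h : hol h -> entire_expr h
| Hc_const c : entire_expr (fun _ => c)
| Hc_id : entire_expr (fun z => z)
| Hc_plus f g : entire_expr f -> entire_expr g -> entire_expr (fun z => (f z + g z)%C)
| Hc_mult f g : entire_expr f -> entire_expr g -> entire_expr (fun z => (f z * g z)%C)
| Hc_comp f g : entire_expr f -> entire_expr g -> entire_expr (fun z => f (g z))
| Hc_exp : entire_expr Cexp.

Lemma entire_expr_step h : entire_expr h -> exists h', entire_expr h' /\ forall z, is_CC h z (h' z).
Proof.
  induction 1 as [h H|c| |f g _ [f' [Hf Df]] _ [g' [Hg Dg]]|f g Hf0 [f' [Hf Df]] Hg0 [g' [Hg Dg]]
    |f g Hf0 [f' [Hf Df]] Hg0 [g' [Hg Dg]]| ].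
  - destruct (hol_ex h H) as [h' [H' D]]. exists h'; split; auto. apply Hc_base; auto.
  - exists (fun _ => RtoC 0); split; [apply Hc_const|intros; apply is_CC_const].
  - exists (fun _ => RtoC 1); split; [apply Hc_const|intros; apply is_CC_id].
  - exists (fun z => (f' z + g' z)%C); split; [apply Hc_plus; auto|intros; apply is_CC_plus; auto].
  - exists (fun z => (f' z * g z + f z * g' z)%C); split.
    + apply Hc_plus; apply Hc_mult; auto.
    + intros; apply is_CC_mult; auto.
  - exists (fun z => (g' z * f' (g z))%C); split.
    + apply Hc_mult; auto. apply (Hc_comp f' g); auto.
    + intros; apply is_CC_comp; auto.
  - exists Cexp; split; [apply Hc_exp|apply is_CC_Cexp].
Qed.

Lemma entire_expr_hol h : entire_expr h -> hol h.
Proof. intros H. exists entire_expr; split; auto. apply entire_expr_step. Qed.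

Lemma hol_const c : hol (fun _ => c).
Proof. apply entire_expr_hol, Hc_const. Qed.
Lemma hol_plus f g : hol f -> hol g -> hol (fun z => (f z + g z)%C).
Proof. intros; apply entire_expr_hol, Hc_plus; apply Hc_base; auto. Qed.
Lemma hol_mult f g : hol f -> hol g -> hol (fun z => (f z * g z)%C).
Proof. intros; apply entire_expr_hol, Hc_mult; apply Hc_base; auto. Qed.
Lemma hol_scaled f a : hol f -> hol (fun z => f (a * z)%C).
Proof.
  intros; apply entire_expr_hol, (Hc_comp f); [apply Hc_base; auto|].
  apply Hc_mult; [apply Hc_const|apply Hc_id].
Qed.

(** A total derivative operator: for entire h the complex derivative is the real one in the
    direction 1. *)
Definition Cder (h : C -> C) (z : C) : C := CDerive (fun s => h (s, Im z)) (Re z).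

Lemma is_CC_Cder h z l : is_CC h z l -> Cder h z = l.
Proof.
  intros H. apply is_Cd_CDerive, is_CC_x. destruct z; exact H.
Qed.

Lemma hol_Cder h : hol h -> hol (Cder h) /\ forall z, is_CC h z (Cder h z).
Proof.
  intros H; destruct (hol_ex h H) as [h' [H' D]].
  assert (E : Cder h = h') by (apply functional_extensionality; intros; apply is_CC_Cder; auto).
  rewrite E; auto.
Qed.

(** * Smooth functions on the Heisenberg group *)

Definition contH (f : Heis -> C) : Prop :=
  forall p, @continuous Heis_UniformSpace C_UniformSpace f p.

Lemma contH_comp f : contH f <->
  (forall p, @continuous Heis_UniformSpace R_UniformSpace (fun q => Re (f q)) p) /\
  (forall p, @continuous Heis_UniformSpace R_UniformSpace (fun q => Im (f q)) p).
Proof.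
  split.
  - intros H; split; intros p.
    + apply (@continuous_comp Heis_UniformSpace C_UniformSpace R_UniformSpace f fst); auto.
      apply continuous_fst.
    + apply (@continuous_comp Heis_UniformSpace C_UniformSpace R_UniformSpace f snd); auto.
      apply continuous_snd.
  - intros [H1 H2] p P [e He].
    destruct (H1 p (ball (Re (f p)) e)) as [d1 D1]. { exists e; auto. }
    destruct (H2 p (ball (Im (f p)) e)) as [d2 D2]. { exists e; auto. }
    assert (Hm : 0 < Rmin d1 d2) by (apply Rmin_glb_lt; apply cond_pos).
    exists (mkposreal _ Hm). intros q Hq. apply He. split.
    + apply D1. eapply ball_le; [|exact Hq]. apply Rmin_l.
    + apply D2. eapply ball_le; [|exact Hq]. apply Rmin_r.
Qed.

Lemma contH_plus f g : contH f -> contH g -> contH (fun p => (f p + g p)%C).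
Proof.
  rewrite !contH_comp. intros [A B] [A' B']; split; intros p; simpl.
  - apply (@continuous_plus Heis_UniformSpace R_AbsRing R_NormedModule); auto.
  - apply (@continuous_plus Heis_UniformSpace R_AbsRing R_NormedModule); auto.
Qed.

Lemma contH_mult f g : contH f -> contH g -> contH (fun p => (f p * g p)%C).
Proof.
  rewrite !contH_comp. intros [A B] [A' B'].
  pose (M := fun f g p => @continuous_mult Heis_UniformSpace R_AbsRing f g p).
  split; intros p; simpl.
  - apply (@continuous_minus Heis_UniformSpace R_AbsRing R_NormedModule); apply M; auto.
  - apply (@continuous_plus Heis_UniformSpace R_AbsRing R_NormedModule); apply M; auto.
Qed.

Lemma contH_conj f : contH f -> contH (fun p => Cconj (f p)).
Proof.
  rewrite !contH_comp. intros [A B]; split; intros p; simpl; auto.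
  apply (@continuous_opp Heis_UniformSpace R_AbsRing R_NormedModule); auto.
Qed.

Lemma contH_const c : contH (fun _ => c).
Proof. intros p; apply continuous_const. Qed.

Lemma contH_fst : contH (fun p => fst p).
Proof. intros p; apply continuous_fst. Qed.

Lemma contH_real (h : Heis -> R) :
  (forall p, @continuous Heis_UniformSpace R_UniformSpace h p) -> contH (fun p => RtoC (h p)).
Proof. intros H; apply contH_comp; split; intros p; simpl; auto. apply continuous_const. Qed.

Lemma continuous_R_comp (h : Heis -> R) (k : R -> R) :
  (forall p, @continuous Heis_UniformSpace R_UniformSpace h p) -> (forall x, continuity_pt k x) ->
  (forall p, @continuous Heis_UniformSpace R_UniformSpace (fun p => k (h p)) p).
Proof.
  intros H K p. apply (@continuous_comp Heis_UniformSpace R_UniformSpace R_UniformSpace h k); auto.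
  apply continuity_pt_filterlim; auto.
Qed.

Lemma contH_Cexp f : contH f -> contH (fun p => Cexp (f p)).
Proof.
  rewrite !contH_comp. intros [A B].
  pose (M := fun f g p => @continuous_mult Heis_UniformSpace R_AbsRing f g p).
  split; intros p; unfold Cexp; simpl; apply M; apply continuous_R_comp; auto; intros x;
    apply derivable_continuous_pt;
    first [apply derivable_pt_exp|apply derivable_pt_cos|apply derivable_pt_sin].
Qed.

Lemma is_CC_cont h z l : is_CC h z l -> @continuous C_UniformSpace C_UniformSpace h z.
Proof.
  intros H.
  assert (K : @continuous (AbsRing_UniformSpace C_AbsRing) (AbsRing_UniformSpace C_AbsRing) h z).
  { apply (@ex_derive_continuous C_AbsRing (AbsRing_NormedModule C_AbsRing)). exists l; exact H. }
  intros P HP. apply locally_C. apply K. apply locally_C. exact HP.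
Qed.

Lemma contH_hol h : hol h -> contH (fun p => h (fst p)).
Proof.
  intros H p. apply hol_Cder in H. destruct H as [_ H].
  apply (@continuous_comp Heis_UniformSpace C_UniformSpace C_UniformSpace fst h).
  - apply contH_fst. - eapply is_CC_cont; apply H.
Qed.

Definition has_dx f (p : Heis) l := is_Cd (slice_x f p) (Re (fst p)) l.
Definition has_dy f (p : Heis) l := is_Cd (slice_y f p) (Im (fst p)) l.
Definition has_dt f (p : Heis) l := is_Cd (slice_t f p) (snd p) l.

Lemma slice_x0 f (p : Heis) : slice_x f p (Re (fst p)) = f p.
Proof. destruct p as [[x y] t]; reflexivity. Qed.
Lemma slice_y0 f (p : Heis) : slice_y f p (Im (fst p)) = f p.
Proof. destruct p as [[x y] t]; reflexivity. Qed.
Lemma slice_t0 f (p : Heis) : slice_t f p (snd p) = f p.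
Proof. destruct p as [[x y] t]; reflexivity. Qed.

Lemma has_dx_eq f p l : has_dx f p l -> d_x f p = l.
Proof. apply is_Cd_CDerive. Qed.
Lemma has_dy_eq f p l : has_dy f p l -> d_y f p = l.
Proof. apply is_Cd_CDerive. Qed.
Lemma has_dt_eq f p l : has_dt f p l -> d_t f p = l.
Proof. apply is_Cd_CDerive. Qed.

Definition grad f (p : Heis) lx ly lt := has_dx f p lx /\ has_dy f p ly /\ has_dt f p lt.

Lemma grad_val f p a b c a' b' c' : grad f p a b c -> a = a' -> b = b' -> c = c' ->
  grad f p a' b' c'.
Proof. intros; subst; auto. Qed.

Lemma grad_const c p : grad (fun _ => c) p 0 (RtoC 0) (RtoC 0).
Proof. split; [|split]; apply is_Cd_const. Qed.

Lemma grad_plus f g p a b c a' b' c' : grad f p a b c -> grad g p a' b' c' ->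
  grad (fun p => (f p + g p)%C) p (a + a')%C (b + b')%C (c + c')%C.
Proof.
  intros [H1 [H2 H3]] [K1 [K2 K3]].
  split; [exact (is_Cd_plus _ _ _ _ _ H1 K1)|split].
  exact (is_Cd_plus _ _ _ _ _ H2 K2). exact (is_Cd_plus _ _ _ _ _ H3 K3).
Qed.

Lemma grad_mult f g p a b c a' b' c' : grad f p a b c -> grad g p a' b' c' ->
  grad (fun p => (f p * g p)%C) p (a * g p + f p * a')%C
    (b * g p + f p * b')%C (c * g p + f p * c')%C.
Proof.
  intros [H1 [H2 H3]] [K1 [K2 K3]].
  split; [|split].
  - rewrite <- (slice_x0 f p), <- (slice_x0 g p). exact (is_Cd_mult _ _ _ _ _ H1 K1).
  - rewrite <- (slice_y0 f p), <- (slice_y0 g p). exact (is_Cd_mult _ _ _ _ _ H2 K2).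
  - rewrite <- (slice_t0 f p), <- (slice_t0 g p). exact (is_Cd_mult _ _ _ _ _ H3 K3).
Qed.

Lemma grad_conj f p a b c : grad f p a b c ->
  grad (fun p => Cconj (f p)) p (Cconj a) (Cconj b) (Cconj c).
Proof. intros [H1 [H2 H3]]; split; [|split]; apply is_Cd_conj; auto. Qed.

Lemma grad_Cexp f p a b c : grad f p a b c ->
  grad (fun p => Cexp (f p)) p (Cexp (f p) * a)%C (Cexp (f p) * b)%C (Cexp (f p) * c)%C.
Proof.
  intros [H1 [H2 H3]]. split; [|split].
  - rewrite <- (slice_x0 f p). exact (is_Cd_Cexp _ _ _ H1).
  - rewrite <- (slice_y0 f p). exact (is_Cd_Cexp _ _ _ H2).
  - rewrite <- (slice_t0 f p). exact (is_Cd_Cexp _ _ _ H3).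
Qed.

Lemma grad_t p : grad (fun p => RtoC (snd p)) p 0 (RtoC 0) (RtoC 1).
Proof.
  split; [exact (is_Cd_const (RtoC (snd p)) _)|split; [exact (is_Cd_const (RtoC (snd p)) _)|]].
  exact (is_Cd_RtoC (fun u => u) _ 1 (@is_derive_id R_AbsRing _)).
Qed.

Lemma grad_hol h p l : is_CC h (fst p) l ->
  grad (fun p => h (fst p)) p l (Ci * l)%C (RtoC 0).
Proof.
  intros H; destruct p as [[x y] t]; simpl in *. split; [|split].
  - exact (is_CC_x _ _ _ _ H).
  - exact (is_CC_y _ _ _ _ H).
  - exact (is_Cd_const (h (x, y)) _).
Qed.

(** The analogue of [entire_expr] on the group: every member is continuous and has its
    partial derivatives in the class, which forces smoothness. *)
Inductive smooth_expr : (Heis -> C) -> Prop :=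
| Sc_base f : smooth f -> smooth_expr f
| Sc_const c : smooth_expr (fun _ => c)
| Sc_t : smooth_expr (fun p => RtoC (snd p))
| Sc_hol h : hol h -> smooth_expr (fun p => h (fst p))
| Sc_plus f g : smooth_expr f -> smooth_expr g -> smooth_expr (fun p => (f p + g p)%C)
| Sc_mult f g : smooth_expr f -> smooth_expr g -> smooth_expr (fun p => (f p * g p)%C)
| Sc_conj f : smooth_expr f -> smooth_expr (fun p => Cconj (f p))
| Sc_exp f : smooth_expr f -> smooth_expr (fun p => Cexp (f p)).

Lemma smooth_grad f : smooth f ->
  contH f /\ smooth (d_x f) /\ smooth (d_y f) /\ smooth (d_t f) /\
  forall p, grad f p (d_x f p) (d_y f p) (d_t f p).
Proof.
  intros H. split; [exact (H 0%nat)|].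
  split; [intros m; apply (H (S m))|].
  split; [intros m; apply (H (S m))|].
  split; [intros m; apply (H (S m))|].
  intros p. destruct (H 1%nat) as [K _]. destruct (K p) as [K1 [K2 K3]].
  split; [|split]; apply ex_Cd; auto.
Qed.

Lemma smooth_expr_step f : smooth_expr f -> contH f /\ exists fx fy ft,
  smooth_expr fx /\ smooth_expr fy /\ smooth_expr ft /\
  forall p, grad f p (fx p) (fy p) (ft p).
Proof.
  induction 1 as [f H|c| |h H|f g Hf [Cf (fx & fy & ft & Hfx & Hfy & Hft & Gf)]
     Hg [Cg (gx & gy & gt & Hgx & Hgy & Hgt & Gg)]
    |f g Hf [Cf (fx & fy & ft & Hfx & Hfy & Hft & Gf)]
     Hg [Cg (gx & gy & gt & Hgx & Hgy & Hgt & Gg)]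
    |f Hf [Cf (fx & fy & ft & Hfx & Hfy & Hft & Gf)]
    |f Hf [Cf (fx & fy & ft & Hfx & Hfy & Hft & Gf)]].
  - destruct (smooth_grad f H) as [A [B [D [E G]]]]. split; auto.
    exists (d_x f), (d_y f), (d_t f).
    split; [apply Sc_base; exact B|split; [apply Sc_base; exact D|split;
      [apply Sc_base; exact E|exact G]]].
  - split; [apply contH_const|]. exists (fun _ => RtoC 0), (fun _ => RtoC 0), (fun _ => RtoC 0).
    split; [apply Sc_const|split; [apply Sc_const|split; [apply Sc_const|]]].
    intros; apply grad_const.
  - split. { apply contH_real. intros p; apply continuous_snd. }
    exists (fun _ => RtoC 0), (fun _ => RtoC 0), (fun _ => RtoC 1).
    split; [apply Sc_const|split; [apply Sc_const|split; [apply Sc_const|]]].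
    intros; apply grad_t.
  - split; [apply contH_hol; auto|]. destruct (hol_Cder h H) as [H' D].
    exists (fun p => Cder h (fst p)), (fun p => (Ci * Cder h (fst p))%C), (fun _ => RtoC 0).
    split; [apply Sc_hol; auto|split; [apply Sc_mult; [apply Sc_const|apply Sc_hol; auto]|split;
      [apply Sc_const|]]].
    intros; apply grad_hol; auto.
  - split; [apply contH_plus; auto|].
    exists (fun p => (fx p + gx p)%C), (fun p => (fy p + gy p)%C), (fun p => (ft p + gt p)%C).
    split; [apply Sc_plus; auto|split; [apply Sc_plus; auto|split; [apply Sc_plus; auto|]]].
    intros; apply grad_plus; auto.
  - split; [apply contH_mult; auto|].
    exists (fun p => (fx p * g p + f p * gx p)%C),
      (fun p => (fy p * g p + f p * gy p)%C),
      (fun p => (ft p * g p + f p * gt p)%C).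
    split; [apply Sc_plus; apply Sc_mult; auto|
      split; [apply Sc_plus; apply Sc_mult; auto|split; [apply Sc_plus; apply Sc_mult; auto|]]].
    intros; apply grad_mult; auto.
  - split; [apply contH_conj; auto|].
    exists (fun p => Cconj (fx p)), (fun p => Cconj (fy p)), (fun p => Cconj (ft p)).
    split; [apply Sc_conj; auto|split; [apply Sc_conj; auto|split; [apply Sc_conj; auto|]]].
    intros; apply grad_conj; auto.
  - split; [apply contH_Cexp; auto|].
    exists (fun p => (Cexp (f p) * fx p)%C), (fun p => (Cexp (f p) * fy p)%C),
     (fun p => (Cexp (f p) * ft p)%C).
    split; [apply Sc_mult; [apply Sc_exp|]; auto|
      split; [apply Sc_mult; [apply Sc_exp|]; auto|split; [apply Sc_mult; [apply Sc_exp|]; auto|]]].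
    intros; apply grad_Cexp; auto.
Qed.

Lemma smooth_expr_smooth f : smooth_expr f -> smooth f.
Proof.
  intros H m; revert f H. induction m as [|m IH]; intros f H.
  - apply smooth_expr_step in H. apply H.
  - destruct (smooth_expr_step f H) as [_ (fx & fy & ft & Hfx & Hfy & Hft & G)].
    simpl. split.
    + intros p. destruct (G p) as [G1 [G2 G3]]. split; [|split]; eapply is_Cd_ex; eauto.
    + replace (d_x f) with fx; [replace (d_y f) with fy; [replace (d_t f) with ft; [auto|]|]|];
        apply functional_extensionality; intros p; destruct (G p) as [G1 [G2 G3]]; symmetry.
      * apply has_dt_eq; auto. * apply has_dy_eq; auto. * apply has_dx_eq; auto.
Qed.

Lemma smooth_const c : smooth (fun _ => c).
Proof. apply smooth_expr_smooth, Sc_const. Qed.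
Lemma smooth_plus f g : smooth f -> smooth g -> smooth (fun p => (f p + g p)%C).
Proof. intros; apply smooth_expr_smooth, Sc_plus; apply Sc_base; auto. Qed.
Lemma smooth_mult f g : smooth f -> smooth g -> smooth (fun p => (f p * g p)%C).
Proof. intros; apply smooth_expr_smooth, Sc_mult; apply Sc_base; auto. Qed.
Lemma smooth_scal c f : smooth f -> smooth (fun p => (c * f p)%C).
Proof. intros; apply smooth_mult; auto. apply smooth_const. Qed.
Lemma smooth_conj f : smooth f -> smooth (fun p => Cconj (f p)).
Proof. intros; apply smooth_expr_smooth, Sc_conj; apply Sc_base; auto. Qed.
Lemma smooth_Cexp f : smooth f -> smooth (fun p => Cexp (f p)).
Proof. intros; apply smooth_expr_smooth, Sc_exp; apply Sc_base; auto. Qed.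
Lemma smooth_t : smooth (fun p => RtoC (snd p)).
Proof. apply smooth_expr_smooth, Sc_t. Qed.
Lemma smooth_hol h : hol h -> smooth (fun p => h (fst p)).
Proof. intros; apply smooth_expr_smooth, Sc_hol; auto. Qed.
Lemma hol_id : hol (fun z => z).
Proof. apply entire_expr_hol, Hc_id. Qed.
Lemma smooth_z : smooth (fun p => fst p).
Proof. exact (smooth_hol _ hol_id). Qed.

Lemma grad_smooth f : smooth f -> forall p, grad f p (d_x f p) (d_y f p) (d_t f p).
Proof. intros H; apply smooth_grad; auto. Qed.

Lemma grad_eq f p a b c : grad f p a b c -> d_x f p = a /\ d_y f p = b /\ d_t f p = c.
Proof. intros [H1 [H2 H3]]; split; [|split]; apply is_Cd_CDerive; auto. Qed.

Lemma Zop_grad f p a b c : grad f p a b c ->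
  Zop f p = ((a - Ci * b) / 2 + Ci * Cconj (fst p) * c)%C.
Proof. intros H; apply grad_eq in H; destruct H as [H1 [H2 H3]]; unfold Zop, d_z; congruence. Qed.

Lemma Zbarop_grad f p a b c : grad f p a b c ->
  Zbarop f p = ((a + Ci * b) / 2 - Ci * fst p * c)%C.
Proof. intros H; apply grad_eq in H; destruct H as [H1 [H2 H3]]; unfold Zbarop, d_zbar;
  congruence. Qed.

Lemma smooth_Zop f : smooth f -> smooth (Zop f).
Proof.
  intros H. destruct (smooth_grad f H) as (_ & A & B & D & _).
  unfold Zop, d_z, Cdiv, Cminus.
  apply smooth_plus.
  - apply smooth_mult; [|apply smooth_const]. apply smooth_plus; auto.
    apply smooth_expr_smooth.
    assert (E : (fun p => (- (Ci * d_y f p))%C) = fun p => (- Ci * d_y f p)%C).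
    { apply functional_extensionality; intros; ring. }
    rewrite E. apply Sc_base, smooth_scal; auto.
  - apply smooth_mult; auto. apply smooth_scal, smooth_conj, smooth_z.
Qed.

Lemma smooth_Zbarop f : smooth f -> smooth (Zbarop f).
Proof.
  intros H. destruct (smooth_grad f H) as (_ & A & B & D & _).
  unfold Zbarop, d_zbar, Cdiv, Cminus.
  apply smooth_plus.
  - apply smooth_mult; [|apply smooth_const]. apply smooth_plus; auto.
    apply smooth_scal; auto.
  - assert (E : (fun p : Heis => (- (Ci * fst p * d_t f p))%C) =
       fun p => (- Ci * (fst p * d_t f p))%C).
    { apply functional_extensionality; intros; ring. }
    rewrite E. apply smooth_scal, smooth_mult; auto. apply smooth_z.
Qed.

Lemma Zop_plus f g p : smooth f -> smooth g ->
  Zop (fun p => (f p + g p)%C) p = (Zop f p + Zop g p)%C.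
Proof.
  intros Hf Hg. rewrite (Zop_grad _ _ _ _ _ (grad_plus _ _ _ _ _ _ _ _ _ (grad_smooth f Hf p)
    (grad_smooth g Hg p))).
  unfold Zop, d_z, Cdiv. ring.
Qed.
Lemma Zbarop_plus f g p : smooth f -> smooth g ->
  Zbarop (fun p => (f p + g p)%C) p = (Zbarop f p + Zbarop g p)%C.
Proof.
  intros Hf Hg. rewrite (Zbarop_grad _ _ _ _ _
    (grad_plus _ _ _ _ _ _ _ _ _ (grad_smooth f Hf p) (grad_smooth g Hg p))).
  unfold Zbarop, d_zbar, Cdiv. ring.
Qed.
Lemma Zop_scal c f p : smooth f -> Zop (fun p => (c * f p)%C) p = (c * Zop f p)%C.
Proof.
  intros Hf. rewrite (Zop_grad _ _ _ _ _ (grad_mult _ _ _ _ _ _ _ _ _ (grad_const c p)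
    (grad_smooth f Hf p))).
  unfold Zop, d_z, Cdiv. ring.
Qed.
Lemma Zbarop_scal c f p : smooth f -> Zbarop (fun p => (c * f p)%C) p = (c * Zbarop f p)%C.
Proof.
  intros Hf. rewrite (Zbarop_grad _ _ _ _ _ (grad_mult _ _ _ _ _ _ _ _ _ (grad_const c p)
    (grad_smooth f Hf p))).
  unfold Zbarop, d_zbar, Cdiv. ring.
Qed.

Lemma Zop_conj f p : smooth f -> Zop (fun p => Cconj (f p)) p = Cconj (Zbarop f p).
Proof.
  intros Hf. rewrite (Zop_grad _ _ _ _ _ (grad_conj _ _ _ _ _ (grad_smooth f Hf p))).
  unfold Zbarop, d_zbar, Cdiv. destruct (d_x f p), (d_y f p), (d_t f p), p as [[x y] t]; simpl.
  re_im; field.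
Qed.
Lemma Zbarop_conj f p : smooth f -> Zbarop (fun p => Cconj (f p)) p = Cconj (Zop f p).
Proof.
  intros Hf. rewrite (Zbarop_grad _ _ _ _ _ (grad_conj _ _ _ _ _ (grad_smooth f Hf p))).
  unfold Zop, d_z, Cdiv. destruct (d_x f p), (d_y f p), (d_t f p), p as [[x y] t]; simpl.
  re_im; field.
Qed.

Lemma contH_2d f : contH f -> forall t x y,
  continuity_2d_pt (fun x y => Re (f ((x, y), t))) x y /\
  continuity_2d_pt (fun x y => Im (f ((x, y), t))) x y.
Proof.
  intros H t x y. apply contH_comp in H. destruct H as [H1 H2].
  assert (K : forall h : Heis -> R, (forall p, @continuous Heis_UniformSpace R_UniformSpace h p) ->
    continuity_2d_pt (fun x y => h ((x, y), t)) x y).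
  { intros h Hh eps. destruct (Hh ((x, y), t) (ball (h ((x, y), t)) eps)) as [d Hd].
    { exists eps; auto. }
    exists d. intros u v Hu Hv. apply (Hd ((u, v), t)). split; [split; auto|apply ball_center]. }
  split; [apply (K (fun p => Re (f p)))|apply (K (fun p => Im (f p)))]; auto.
Qed.

(** Schwarz's theorem for the real and imaginary parts. *)
Lemma d_xy_comm f p : smooth f -> d_x (d_y f) p = d_y (d_x f) p.
Proof.
  intros H. destruct p as [[x y] t].
  destruct (smooth_grad f H) as (_ & Hx & Hy & _ & G).
  destruct (smooth_grad _ Hx) as (_ & Hxx & Hxy & _ & Gx).
  destruct (smooth_grad _ Hy) as (_ & Hyx & Hyy & _ & Gy).
  assert (D : forall x y, ex_derive (fun z => Re (f ((z, y), t))) x /\ ex_derive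
    (fun z => Im (f ((z, y), t))) x).
  { intros a b. destruct (G ((a, b), t)) as [G1 [_ _]]. apply is_Cd_ex in G1. exact G1. }
  assert (D' : forall x y, ex_derive (fun z => Re (f ((x, z), t))) y /\ ex_derive
    (fun z => Im (f ((x, z), t))) y).
  { intros a b. destruct (G ((a, b), t)) as [_ [G1 _]]. apply is_Cd_ex in G1. exact G1. }
  assert (DX : forall x y, ex_derive (fun z => Re (d_y f ((z, y), t))) x /\ ex_derive
    (fun z => Im (d_y f ((z, y), t))) x).
  { intros a b. destruct (Gy ((a, b), t)) as [G1 [_ _]]. apply is_Cd_ex in G1. exact G1. }
  assert (DY : forall x y, ex_derive (fun z => Re (d_x f ((x, z), t))) y /\ ex_derive
    (fun z => Im (d_x f ((x, z), t))) y).
  { intros a b. destruct (Gx ((a, b), t)) as [_ [G1 _]]. apply is_Cd_ex in G1. exact G1. }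
  destruct (contH_2d _ (Hyx 0%nat) t x y) as [C1 C2].
  destruct (contH_2d _ (Hxy 0%nat) t x y) as [C3 C4].
  assert (Exy : forall u v, d_x (d_y f) ((u, v), t) =
    (Derive (fun z => Derive (fun s => Re (f ((z, s), t))) v) u,
     Derive (fun z => Derive (fun s => Im (f ((z, s), t))) v) u)) by reflexivity.
  assert (Eyx : forall u v, d_y (d_x f) ((u, v), t) =
    (Derive (fun z => Derive (fun s => Re (f ((s, z), t))) u) v,
     Derive (fun z => Derive (fun s => Im (f ((s, z), t))) u) v)) by reflexivity.
  rewrite Exy, Eyx.
  apply (continuity_2d_pt_ext _ (fun u v => Derive (fun z => Derive (fun s => Re (f ((z, s), t))) v)
    u)) in C1;
    [|intros u v; rewrite Exy; reflexivity].
  apply (continuity_2d_pt_ext _ (fun u v => Derive (fun z => Derive (fun s => Im (f ((z, s), t))) v)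
    u)) in C2;
    [|intros u v; rewrite Exy; reflexivity].
  apply (continuity_2d_pt_ext _ (fun u v => Derive (fun z => Derive (fun s => Re (f ((s, z), t))) u)
    v)) in C3;
    [|intros u v; rewrite Eyx; reflexivity].
  apply (continuity_2d_pt_ext _ (fun u v => Derive (fun z => Derive (fun s => Im (f ((s, z), t))) u)
    v)) in C4;
    [|intros u v; rewrite Eyx; reflexivity].
  assert (L1 := Schwarz (fun x y => Re (f ((x, y), t))) x y).
  assert (L2 := Schwarz (fun x y => Im (f ((x, y), t))) x y).
  apply C_ext; [refine (L1 _ C1 C3)|refine (L2 _ C2 C4)];
    exists (mkposreal 1 Rlt_0_1); intros u v _ _.
  - split; [apply (D u v)|split; [apply (D' u v)|split; [apply (DX u v)|apply (DY u v)]]].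
  - split; [apply (D u v)|split; [apply (D' u v)|split; [apply (DX u v)|apply (DY u v)]]].
Qed.

(** * Invariance under a generated group *)

Lemma Hmul_assoc a b c : Hmul a (Hmul b c) = Hmul (Hmul a b) c.
Proof.
  unfold Hmul; destruct a as [[a1 a2] a3], b as [[b1 b2] b3], c as [[c1 c2] c3]; simpl.
  apply injective_projections; simpl; [re_im|ring].
Qed.

Lemma mu_Hmul l a b : mu l (Hmul a b) = Hmul (mu l a) (mu l b).
Proof.
  unfold mu, Hmul; apply injective_projections; cbn [fst snd]; [ring|].
  rewrite Cmod2_alt. destruct l, a as [[a1 a2] a3], b as [[b1 b2] b3]; unfold Re, Im; simpl. ring.
Qed.

Lemma mu_mu l m a : mu l (mu m a) = mu (l * m)%C a.
Proof.
  unfold mu; apply injective_projections; cbn [fst snd]; [ring|].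
  rewrite Cmod_mult; ring.
Qed.

Lemma HCact_mul x y h : HCact (HCmul x y) h = HCact x (HCact y h).
Proof.
  unfold HCact, HCmul; simpl. rewrite mu_Hmul, mu_mu, Hmul_assoc; reflexivity.
Qed.

Lemma HCact_one h : HCact HCone h = h.
Proof.
  unfold HCact, HCone, Hone, Hmul, mu; destruct h as [[h1 h2] h3]; simpl.
  apply injective_projections; simpl; [re_im|rewrite Cmod_1; ring].
Qed.

Lemma HCmul_inv_r (x : HC) : snd x <> 0 -> HCmul x (HCinv x) = HCone.
Proof.
  destruct x as [g l]; simpl; intros H. unfold HCmul, HCinv, HCone; simpl.
  rewrite mu_mu, Cinv_r by auto.
  f_equal. unfold Hmul, mu, Hinv, Hone; destruct g as [[g1 g2] g3]; simpl.
  apply injective_projections; simpl; [re_im|rewrite Cmod_1; ring].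
Qed.

Lemma generated_snd (S : HC -> Prop) : (forall x, S x -> snd x <> 0) ->
  forall x : HC, generated S x -> snd x <> 0.
Proof.
  intros HS x; induction 1 as [x H| |x y _ IHx _ IHy|x _ IH]; simpl; auto.
  - apply C1_nz.
  - apply Cmult_neq_0; auto.
  - intros E. apply C1_nz. rewrite <- (Cinv_r (snd x)), E by auto. ring.
Qed.

(** For an inverse, apply the invariance under x to the point x^-1 h; the generators act
    invertibly because their second components are nonzero. *)
Lemma generated_invariant (S : HC -> Prop) f : (forall x, S x -> snd x <> 0) ->
  (forall x h, S x -> f (HCact x h) = f h) ->
  invariant_fun (generated S) f.
Proof.
  intros HS Hf x h H; revert h; induction H as [x H| |x y _ IHx _ IHy|x H IH]; intros h.
  - auto.
  - rewrite HCact_one; auto.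
  - rewrite HCact_mul, IHx; auto.
  - rewrite <- (IH (HCact (HCinv x) h)), <- HCact_mul, HCmul_inv_r, HCact_one; auto.
    eapply generated_snd; eauto.
Qed.

Definition s3 : R := sqrt 3.
Lemma s3_sq : s3 * s3 = 3.
Proof. apply sqrt_sqrt; lra. Qed.
Lemma s3_pos : 0 < s3.
Proof. apply sqrt_lt_R0; lra. Qed.

Lemma eta_eq : eta = (1 / 2, s3 / 2).
Proof. unfold eta. rewrite cos_PI3, sin_PI3. reflexivity. Qed.

Lemma Cmod_eta : Cmod eta = 1.
Proof.
  rewrite eta_eq. unfold Cmod; simpl. replace (_ + _) with 1; [apply sqrt_1|].
  field_simplify. replace (s3 ^ 2) with 3 by (rewrite <- s3_sq; ring). field.
Qed.

Lemma eta_nz : eta <> 0.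
Proof. rewrite eta_eq. intros H. apply (f_equal Re) in H. simpl in H. lra. Qed.

Lemma act_translation (a z : C) (s t : R) :
  HCact ((a, s), RtoC 1) (z, t) = ((z + a)%C, t + s + 2 * Im (a * Cconj z)%C).
Proof.
  unfold HCact, Hmul, mu; cbn [fst snd]. apply injective_projections; cbn [fst snd]; [ring|].
  rewrite Cmod_1. destruct a, z; simpl; ring.
Qed.

Lemma act_rotation (z : C) (s t : R) :
  HCact ((RtoC 0, s), eta) (z, t) = ((eta * z)%C, t + s).
Proof.
  unfold HCact, Hmul, mu; cbn [fst snd]. apply injective_projections; cbn [fst snd]; [ring|].
  rewrite Cmod_eta. destruct z; simpl; ring.
Qed.

Lemma invariant_Gamma_iff c f : invariant_fun (Gamma c) f <->
  (forall z t, f ((z + 1)%C, t - 2 * Im z) = f (z, t)) /\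
  (forall z t, f ((z + eta)%C, t + 2 * Im (eta * Cconj z)%C) = f (z, t)) /\
  (forall z t, f (z, t + c) = f (z, t)) /\
  (forall z t, f ((eta * z)%C, t + c / 6) = f (z, t)).
Proof.
  split.
  - intros H.
    assert (L : forall x h, Lambda eta c x -> f (HCact x h) = f h).
    { intros x h Hx; apply H. apply generated_in; auto. }
    assert (G : forall g h, g = ((RtoC 1, 0), RtoC 1) \/ g = ((eta, 0), RtoC 1) \/
       g = ((RtoC 0, c), RtoC 1) -> f (HCact g h) = f h).
    { intros; apply L, generated_in; auto. }
    split; [|split; [|split]]; intros z t.
    + rewrite <- (G ((RtoC 1, 0), RtoC 1) (z, t)), act_translation by auto. f_equal. f_equal.
      destruct z; simpl; ring.
    + rewrite <- (G ((eta, 0), RtoC 1) (z, t)), act_translation by auto. f_equal. f_equal. ring.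
    + rewrite <- (G ((RtoC 0, c), RtoC 1) (z, t)), act_translation by auto. f_equal. f_equal.
      ring. destruct z; simpl; ring.
    + rewrite <- (H ((RtoC 0, c / 6), eta) (z, t)), act_rotation; auto.
      apply generated_in; auto.
  - intros (H1 & H2 & H3 & H4).
    assert (L0 : forall x, x = ((RtoC 1, 0), RtoC 1) \/ x = ((eta, 0), RtoC 1) \/
       x = ((RtoC 0, c), RtoC 1) -> snd x <> 0).
    { intros x [-> |[-> | ->]]; simpl; apply C1_nz. }
    apply generated_invariant.
    + intros x [Hx| ->]; [|apply eta_nz].
      eapply generated_snd; [|exact Hx]; auto.
    + intros x [z t] [Hx| ->].
      * revert Hx. intros Hx. refine (generated_invariant _ f _ _ x (z, t) Hx); auto.
        clear z t Hx x. intros x [z t] [-> |[-> | ->]]; rewrite act_translation.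
        -- rewrite <- (H1 z t). f_equal. f_equal. destruct z; simpl; ring.
        -- rewrite <- (H2 z t). f_equal. f_equal. ring.
        -- rewrite <- (H3 z t). f_equal. f_equal. ring. destruct z; simpl; ring.
      * rewrite act_rotation. auto.
Qed.

(** * Fourier uniqueness on a period *)

Definition Rcont (f : R -> R) : Prop := forall x, continuous f x.

Lemma Rcont_ex_RInt f a b : Rcont f -> ex_RInt f a b.
Proof. intros H; apply (@ex_RInt_continuous R_CompleteNormedModule); intros; apply H. Qed.
Lemma Rcont_mult f g : Rcont f -> Rcont g -> Rcont (fun x => f x * g x).
Proof. intros Hf Hg x; apply (@continuous_mult R_UniformSpace R_AbsRing f g x); auto. Qed.
Lemma Rcont_plus f g : Rcont f -> Rcont g -> Rcont (fun x => f x + g x).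
Proof. intros Hf Hg x; apply (@continuous_plus R_UniformSpace R_AbsRing R_NormedModule f g x);
  auto. Qed.
Lemma Rcont_minus f g : Rcont f -> Rcont g -> Rcont (fun x => f x - g x).
Proof. intros Hf Hg x; apply (@continuous_minus R_UniformSpace R_AbsRing R_NormedModule f g x);
  auto. Qed.
Lemma Rcont_const c : Rcont (fun _ => c).
Proof. intros x; apply continuous_const. Qed.
Lemma Rcont_id : Rcont (fun x => x).
Proof. intros x; apply continuous_id. Qed.
Lemma Rcont_comp f g : Rcont f -> Rcont g -> Rcont (fun x => f (g x)).
Proof. intros Hf Hg x; apply (@continuous_comp R_UniformSpace R_UniformSpace R_UniformSpace g f);
  auto. Qed.
Lemma Rcont_cos : Rcont cos.
Proof. intros x; apply continuous_cos. Qed.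
Lemma Rcont_sin : Rcont sin.
Proof. intros x; apply continuous_sin. Qed.
Lemma Rcont_pow f n : Rcont f -> Rcont (fun x => f x ^ n).
Proof.
  intros H; induction n as [|n IH]; simpl; [apply Rcont_const|apply Rcont_mult; auto].
Qed.

Ltac rcont := cbv beta; try assumption;
  lazymatch goal with
  | |- Rcont (fun x => @?f x + @?g x) => apply (Rcont_plus f g); rcont
  | |- Rcont (fun x => @?f x - @?g x) => apply (Rcont_minus f g); rcont
  | |- Rcont (fun x => @?f x * @?g x) => apply (Rcont_mult f g); rcont
  | |- Rcont (fun x => @?f x ^ ?n) => apply (Rcont_pow f n); rcont
  | |- Rcont (fun x => cos (@?f x)) => apply (Rcont_comp cos f); [apply Rcont_cos|rcont]
  | |- Rcont (fun x => sin (@?f x)) => apply (Rcont_comp sin f); [apply Rcont_sin|rcont]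
  | |- Rcont _ => first [simple apply Rcont_const|simple apply Rcont_id|solve [auto]]
  end.

(** Integrals are typed in the carrier of a normed module; this exposes the type R to
    [ring]. *)
Ltac real_eq := match goal with |- @eq _ ?a ?b => change (@eq R a b) end.

Lemma RInt_Rplus f g a b : Rcont f -> Rcont g ->
  RInt (fun x => f x + g x) a b = RInt f a b + RInt g a b.
Proof. intros Hf Hg; apply (@RInt_plus R_CompleteNormedModule); apply Rcont_ex_RInt; auto. Qed.
Lemma RInt_Rminus f g a b : Rcont f -> Rcont g ->
  RInt (fun x => f x - g x) a b = RInt f a b - RInt g a b.
Proof. intros Hf Hg; apply (@RInt_minus R_CompleteNormedModule); apply Rcont_ex_RInt; auto. Qed.
Lemma RInt_Rscal c f a b : Rcont f -> RInt (fun x => c * f x) a b = c * RInt f a b.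
Proof. intros Hf; apply (@RInt_scal R_CompleteNormedModule); apply Rcont_ex_RInt; auto. Qed.
Lemma RInt_Rext (f g : R -> R) a b : (forall x, f x = g x) -> RInt f a b = RInt g a b.
Proof. intros E; apply RInt_ext; auto. Qed.

Lemma RInt_lower f a b k : a <= b -> Rcont f -> (forall x, a < x < b -> k <= f x) ->
  k * (b - a) <= RInt f a b.
Proof.
  intros Hab Hf H. replace (k * (b - a)) with (RInt (fun _ => k) a b).
  - apply RInt_le; auto; apply Rcont_ex_RInt; auto. apply Rcont_const.
  - rewrite RInt_const. unfold scal; simpl; unfold mult; simpl; ring.
Qed.

Lemma RInt_split f a b c : Rcont f -> RInt f a c = RInt f a b + RInt f b c.
Proof.
  intros H. symmetry. apply (@RInt_Chasles R_CompleteNormedModule); apply Rcont_ex_RInt; auto.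
Qed.

(** By the product formula for cosines one more factor of the kernel only involves the
    neighbouring frequencies m + 1 and m - 1. *)
Lemma cosine_orthogonal_kernel psi x0 d : Rcont psi ->
  (forall m : Z, RInt (fun x => psi x * cos (2 * PI * IZR m * (x - x0))) 0 1 = 0) ->
  forall (n : nat) (m : Z),
    RInt (fun x => psi x * ((1 + cos (2 * PI * (x - x0)) - d) ^ n
      * cos (2 * PI * IZR m * (x - x0)))) 0 1 = 0.
Proof.
  intros Hc H n; induction n as [|n IH]; intros m.
  - etransitivity; [|apply (H m)]. apply RInt_Rext; intros x; simpl; ring.
  - set (T := fun x => 1 + cos (2 * PI * (x - x0)) - d) in *.
    set (F := fun m x => psi x * (T x ^ n * cos (2 * PI * IZR m * (x - x0)))).
    assert (HF : forall m, Rcont (F m)) by (intros; unfold F, T; rcont).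
    transitivity (RInt (fun x => (1 - d) * F m x + (/ 2 * F (m + 1)%Z x + / 2 * F (m - 1)%Z x)) 0
      1).
    + apply RInt_Rext; intros x. unfold F. fold (T x). rewrite <- tech_pow_Rmult.
      rewrite plus_IZR, minus_IZR.
      replace (2 * PI * (IZR m + 1) * (x - x0)) with
        (2 * PI * IZR m * (x - x0) + 2 * PI * (x - x0)) by ring.
      replace (2 * PI * (IZR m - 1) * (x - x0)) with
        (2 * PI * IZR m * (x - x0) - 2 * PI * (x - x0)) by ring.
      rewrite cos_plus, cos_minus. unfold T at 1. field.
    + rewrite RInt_Rplus, RInt_Rscal, RInt_Rplus, !RInt_Rscal by rcont; auto.
      * unfold F; rewrite !IH; real_eq; ring.
Qed.

(** The powers of the kernel concentrate at x0: if psi x0 > 0, the integral of psi against a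
    high power would be large, but it vanishes by [cosine_orthogonal_kernel]. *)
Lemma fejer_vanish_pos psi x0 : Rcont psi ->
  (forall m : Z, RInt (fun x => psi x * cos (2 * PI * IZR m * (x - x0))) 0 1 = 0) ->
  0 < x0 < 1 -> 0 < psi x0 -> False.
Proof.
  intros Hc H Hx Hpos.
  destruct (Hc x0 (ball (psi x0) (psi x0 / 2))) as [d0 Hd0].
  { assert (P2 : 0 < psi x0 / 2) by lra. exists (mkposreal _ P2). auto. }
  (* Within distance d of x0 the function stays above psi x0 / 2 and the period is not left. *)
  set (d := Rmin (d0 / 2) (Rmin (x0 / 2) ((1 - x0) / 2))).
  assert (Hd : 0 < d).
  { unfold d. pose proof (cond_pos d0). repeat apply Rmin_glb_lt; lra. }
  assert (Hdd0 : d < d0). { unfold d. pose proof (cond_pos d0). pose proof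
    (Rmin_l (d0/2) (Rmin (x0 / 2) ((1 - x0) / 2))). lra. }
  assert (Hdx : d <= x0 / 2 /\ d <= (1 - x0) / 2).
  { unfold d. pose proof (Rmin_r (d0/2) (Rmin (x0 / 2) ((1 - x0) / 2))).
    pose proof (Rmin_l (x0 / 2) ((1 - x0) / 2)). pose proof (Rmin_r (x0 / 2) ((1 - x0) / 2)). lra. }
  assert (Heps : forall x, Rabs (x - x0) <= d -> psi x0 / 2 <= psi x).
  { intros x Hxd. specialize (Hd0 x).
    assert (B : ball x0 d0 x). { change (Rabs (x - x0) < d0). lra. }
    specialize (Hd0 B). change (Rabs (psi x - psi x0) < psi x0 / 2) in Hd0.
    apply Rabs_def2 in Hd0. lra. }
  assert (Hbd : exists K, 0 < K /\ forall x, 0 <= x <= 1 -> Rabs (psi x) <= K).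
  { destruct (continuity_ab_maj (fun x => Rabs (psi x)) 0 1) as [M [HM _]].
    - lra.
    - intros c _. apply continuity_pt_filterlim. apply (continuous_comp psi Rabs).
      + apply Hc. + apply continuous_Rabs.
    - exists (Rabs (psi M) + 1). split. { pose proof (Rabs_pos (psi M)); lra. }
      intros x Hx'. specialize (HM x Hx'). lra. }
  destruct Hbd as [K [HK Kb]].
  pose proof PI_RGT_0 as HPI.
  assert (Hd4 : d <= 1 / 4) by lra.
  (* T >= 1 within d of x0, T >= q > 1 within d / 2, and |T| <= 1 on the rest of the period. *)
  set (T := fun x => 1 + cos (2 * PI * (x - x0)) - cos (2 * PI * d)).
  assert (cosabs : forall x, cos (2 * PI * (x - x0)) = cos (2 * PI * Rabs (x - x0))).
  { intros x. unfold Rabs; destruct (Rcase_abs (x - x0)); auto.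
    replace (2 * PI * - (x - x0)) with (- (2 * PI * (x - x0))) by ring. rewrite cos_neg; auto. }
  set (q := 1 + cos (PI * d) - cos (2 * PI * d)).
  assert (Hq : 1 < q).
  { unfold q. assert (cos (2 * PI * d) < cos (PI * d)); [|lra].
    apply cos_decreasing_1; nra. }
  assert (T1 : forall x, Rabs (x - x0) <= d -> 1 <= T x).
  { intros x Hxx. unfold T. rewrite cosabs.
    assert (cos (2 * PI * d) <= cos (2 * PI * Rabs (x - x0))); [|lra].
    pose proof (Rabs_pos (x - x0)). apply cos_decr_1; nra. }
  assert (T2 : forall x, Rabs (x - x0) <= d / 2 -> q <= T x).
  { intros x Hxx. unfold T, q. rewrite cosabs.
    assert (cos (PI * d) <= cos (2 * PI * Rabs (x - x0))); [|lra].
    pose proof (Rabs_pos (x - x0)). apply cos_decr_1; nra. }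
  assert (T3 : forall x, 0 <= x <= 1 -> d <= Rabs (x - x0) -> Rabs (T x) <= 1).
  { intros x Hx01 Hxx. unfold T. rewrite cosabs.
    assert (Hu : Rabs (x - x0) <= 1 - d).
    { unfold Rabs; destruct (Rcase_abs (x - x0)); lra. }
    assert (cos (2 * PI * Rabs (x - x0)) <= cos (2 * PI * d)).
    { destruct (Rle_dec (Rabs (x - x0)) (1 / 2)) as [Hl|Hl].
      - apply cos_decr_1; nra.
      - replace (2 * PI * Rabs (x - x0)) with (- (2 * PI * (1 - Rabs (x - x0))) + 2 * INR 1 * PI) by
          (simpl; ring).
        rewrite cos_period, cos_neg. apply cos_decr_1; nra. }
    pose proof (COS_bound (2 * PI * Rabs (x - x0))). pose proof (COS_bound (2 * PI * d)).
    assert (0 <= cos (2 * PI * d)) by (apply cos_ge_0; nra).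
    apply Rabs_le. lra. }
  assert (HT : Rcont T) by (unfold T; rcont).
  (* The inner window contributes at least the first term and the complement of the window at
     least - K, while the whole integral is 0. *)
  assert (Main : forall n : nat, psi x0 / 2 * q ^ n * d - K <= 0).
  { intros n. set (F := fun x => psi x * T x ^ n).
    assert (HF : Rcont F) by (unfold F; rcont).
    assert (E : @eq R (RInt F 0 1) 0).
    { etransitivity; [|exact (cosine_orthogonal_kernel psi x0 (cos (2 * PI * d)) Hc H n 0%Z)].
      apply RInt_Rext; intros x; unfold F, T. rewrite Rmult_0_r, Rmult_0_l, cos_0; real_eq; ring. }
    rewrite (RInt_split F 0 (x0 - d) 1), (RInt_split F (x0 - d) (x0 - d / 2) 1),
      (RInt_split F (x0 - d / 2) (x0 + d / 2) 1),
        (RInt_split F (x0 + d / 2) (x0 + d) 1) in E by auto.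
    assert (Out : forall x, 0 <= x <= 1 -> d <= Rabs (x - x0) -> - K <= F x).
    { intros x Hx1 Hx2. unfold F.
      assert (Rabs (psi x * T x ^ n) <= K).
      { rewrite Rabs_mult, <- RPow_abs.
        replace K with (K * 1) by ring. apply Rmult_le_compat; auto using Rabs_pos.
        - apply pow_le, Rabs_pos.
        - rewrite <- (pow1 n). apply pow_incr. split; [apply Rabs_pos|auto]. }
      apply Rabs_le_between in H0; lra. }
    assert (In : forall x, Rabs (x - x0) <= d -> 0 <= F x).
    { intros x Hx1. unfold F. apply Rmult_le_pos.
      - specialize (Heps x Hx1); lra. - apply pow_le. specialize (T1 x Hx1); lra. }
    assert (I1 : - K * ((x0 - d) - 0) <= RInt F 0 (x0 - d)).
    { apply RInt_lower; auto; [lra|]. intros x Hx'. apply Out; [lra|].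
      rewrite Rabs_left; lra. }
    assert (I2 : 0 * ((x0 - d / 2) - (x0 - d)) <= RInt F (x0 - d) (x0 - d / 2)).
    { apply RInt_lower; auto; [lra|]. intros x Hx'. apply In. rewrite Rabs_left; lra. }
    assert (I3 : psi x0 / 2 * q ^ n * ((x0 + d / 2) - (x0 - d / 2)) <= RInt F (x0 - d / 2)
      (x0 + d / 2)).
    { apply RInt_lower; auto; [lra|]. intros x Hx'.
      assert (Ha : Rabs (x - x0) <= d / 2) by (apply Rabs_le; lra).
      unfold F. apply Rmult_le_compat; [lra|apply pow_le; lra|apply Heps; lra|].
      apply pow_incr. split; [lra|auto]. }
    assert (I4 : 0 * ((x0 + d) - (x0 + d / 2)) <= RInt F (x0 + d / 2) (x0 + d)).
    { apply RInt_lower; auto; [lra|]. intros x Hx'. apply In. rewrite Rabs_right; lra. }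
    assert (I5 : - K * (1 - (x0 + d)) <= RInt F (x0 + d) 1).
    { apply RInt_lower; auto; [lra|]. intros x Hx'. apply Out; [lra|].
      rewrite Rabs_right; lra. }
    nra. }
  set (a := psi x0 / 2 * d).
  assert (Ha : 0 < a) by (unfold a; nra).
  destruct (INR_unbounded (K / (a * (q - 1)))) as [n Hn].
  specialize (Main n). pose proof (poly n (q - 1) ltac:(lra)) as Hp.
  replace (1 + (q - 1)) with q in Hp by ring.
  assert (Haq : 0 < a * (q - 1)) by nra.
  assert (K < INR n * (a * (q - 1))).
  { apply Rmult_lt_reg_r with (/ (a * (q - 1))); [apply Rinv_0_lt_compat; auto|].
    rewrite Rmult_assoc, Rinv_r by lra. unfold Rdiv in Hn; lra. }
  unfold a in *. nra.
Qed.

Lemma real_fourier_vanish psi : Rcont psi ->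
  (forall m : Z, RInt (fun x => psi x * cos (2 * PI * IZR m * x)) 0 1 = 0) ->
  (forall m : Z, RInt (fun x => psi x * sin (2 * PI * IZR m * x)) 0 1 = 0) ->
  forall x, 0 < x < 1 -> psi x = 0.
Proof.
  intros Hc H1 H2 x0 Hx.
  assert (H : forall m : Z, RInt (fun x => psi x * cos (2 * PI * IZR m * (x - x0))) 0 1 = 0).
  { intros m. set (theta := 2 * PI * IZR m * x0).
    transitivity (RInt (fun x => cos theta * (psi x * cos (2 * PI * IZR m * x)) +
      sin theta * (psi x * sin (2 * PI * IZR m * x))) 0 1).
    - apply RInt_Rext; intros x.
      replace (2 * PI * IZR m * (x - x0)) with (2 * PI * IZR m * x - theta) by (unfold theta; ring).
      rewrite cos_minus; real_eq; ring.
    - rewrite RInt_Rplus, !RInt_Rscal, H1, H2 by rcont. real_eq; ring. }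
  destruct (Rtotal_order (psi x0) 0) as [Hl|[Hl|Hl]]; auto; exfalso.
  - apply (fejer_vanish_pos (fun x => - 1 * psi x) x0); auto; [rcont| |lra].
    intros m. transitivity (RInt (fun x => - 1 * (psi x * cos (2 * PI * IZR m * (x - x0)))) 0 1).
    + apply RInt_Rext; intros; real_eq; ring. + rewrite RInt_Rscal, H by rcont. real_eq; ring.
  - apply (fejer_vanish_pos psi x0); auto.
Qed.

Definition Ccont (g : R -> C) : Prop := Rcont (fun x => Re (g x)) /\ Rcont (fun x => Im (g x)).

Definition CInt (g : R -> C) : C := (RInt (fun x => Re (g x)) 0 1, RInt (fun x => Im (g x)) 0 1).

Lemma Ccont_mult f g : Ccont f -> Ccont g -> Ccont (fun x => (f x * g x)%C).
Proof.
  intros [A B] [A' B']; split.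
  - exact (Rcont_minus _ _ (Rcont_mult _ _ A A') (Rcont_mult _ _ B B')).
  - exact (Rcont_plus _ _ (Rcont_mult _ _ A B') (Rcont_mult _ _ B A')).
Qed.
Lemma Ccont_plus f g : Ccont f -> Ccont g -> Ccont (fun x => (f x + g x)%C).
Proof.
  intros [A B] [A' B']; split; [exact (Rcont_plus _ _ A A')|exact (Rcont_plus _ _ B B')].
Qed.
Lemma Ccont_const c : Ccont (fun _ => c).
Proof. split; [exact (Rcont_const (Re c))|exact (Rcont_const (Im c))]. Qed.
Lemma Ccont_is_Cd g g' : (forall s, is_Cd g s (g' s)) -> Ccont g.
Proof.
  intros H; split; intros x; apply (@ex_derive_continuous R_AbsRing R_NormedModule); eexists;
    apply H.
Qed.

Lemma CInt_ext f g : (forall x, f x = g x) -> CInt f = CInt g.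
Proof. intros E; f_equal; apply functional_extensionality; auto. Qed.

Lemma CInt_plus f g : Ccont f -> Ccont g ->
  CInt (fun x => (f x + g x)%C) = (CInt f + CInt g)%C.
Proof. intros [A B] [A' B']; apply C_ext; simpl; apply RInt_Rplus; auto. Qed.

Lemma CInt_scal c f : Ccont f -> CInt (fun x => (c * f x)%C) = (c * CInt f)%C.
Proof.
  intros [A B]; apply C_ext.
  - change (RInt (fun x => Re c * Re (f x) - Im c * Im (f x)) 0 1 =
      Re c * RInt (fun x => Re (f x)) 0 1 - Im c * RInt (fun x => Im (f x)) 0 1).
    rewrite RInt_Rminus; [|apply Rcont_mult; auto; apply Rcont_const|apply Rcont_mult; auto;
      apply Rcont_const].
    rewrite (RInt_Rscal (Re c)), (RInt_Rscal (Im c)) by auto. reflexivity.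
  - change (RInt (fun x => Re c * Im (f x) + Im c * Re (f x)) 0 1 =
      Re c * RInt (fun x => Im (f x)) 0 1 + Im c * RInt (fun x => Re (f x)) 0 1).
    rewrite RInt_Rplus; [|apply Rcont_mult; auto; apply Rcont_const|apply Rcont_mult; auto;
      apply Rcont_const].
    rewrite (RInt_Rscal (Re c)), (RInt_Rscal (Im c)) by auto. reflexivity.
Qed.

Lemma CInt_const c : CInt (fun _ => c) = c.
Proof.
  unfold CInt; apply C_ext; simpl; rewrite RInt_const; unfold scal; simpl; unfold mult; simpl; ring.
Qed.

Lemma CInt_deriv g g' : (forall s, is_Cd g s (g' s)) -> Ccont g' ->
  CInt g' = (g 1 - g 0)%C.
Proof.
  intros H [C1 C2]. apply C_ext; simpl; apply is_RInt_unique.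
  - apply (is_RInt_derive (fun s => Re (g s)) (fun s => Re (g' s))).
    + intros; apply H. + intros; apply C1.
  - apply (is_RInt_derive (fun s => Im (g s)) (fun s => Im (g' s))).
    + intros; apply H. + intros; apply C2.
Qed.

Lemma CInt_bound g K : Ccont g -> (forall x, 0 <= x <= 1 -> Cmod (g x) <= K) ->
  Cmod (CInt g) <= 2 * K.
Proof.
  intros [C1 C2] H. eapply Rle_trans; [apply Cmod_le_sum|]. simpl.
  assert (A : forall f, Rcont f -> (forall x, 0 <= x <= 1 -> Rabs (f x) <= K) ->
    Rabs (RInt f 0 1) <= K).
  { intros f Hf Hb. replace K with ((1 - 0) * K) by ring. apply abs_RInt_le_const; auto; [lra|].
    apply Rcont_ex_RInt; auto. }
  assert (Rabs (RInt (fun x => Re (g x)) 0 1) <= K).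
  { apply A; auto. intros x Hx. eapply Rle_trans; [apply re_le_Cmod|auto]. }
  assert (Rabs (RInt (fun x => Im (g x)) 0 1) <= K).
  { apply A; auto. intros x Hx. eapply Rle_trans; [apply im_le_Cmod|auto]. }
  lra.
Qed.

Lemma is_Cd_CInt (v vy : R -> R -> C) :
  (forall y x, is_Cd (fun y => v y x) y (vy y x)) ->
  (forall y x, continuity_2d_pt (fun y x => Re (vy y x)) y x /\
               continuity_2d_pt (fun y x => Im (vy y x)) y x) ->
  (forall y, Ccont (v y)) ->
  forall y, is_Cd (fun y => CInt (v y)) y (CInt (vy y)).
Proof.
  intros D C2 Cv y.
  assert (P : forall (f fy : R -> R -> R), (forall y x, is_derive (fun y => f y x) y (fy y x)) ->
    (forall y x, continuity_2d_pt fy y x) -> (forall y, Rcont (f y)) ->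
    is_derive (fun y => RInt (f y) 0 1) y (RInt (fy y) 0 1)).
  { intros f fy Df Cf Cc.
    replace (fy y) with (fun t => Derive (fun u => f u t) y).
    - apply (is_derive_RInt_param f 0 1 y).
      + exists (mkposreal 1 Rlt_0_1). intros; eexists; apply Df.
      + intros t _. apply continuity_2d_pt_ext with fy; auto.
        intros a b; symmetry; apply is_derive_unique; auto.
      + exists (mkposreal 1 Rlt_0_1). intros; apply Rcont_ex_RInt; auto.
    - apply functional_extensionality; intros t; apply is_derive_unique; auto. }
  split; simpl.
  - apply (P (fun y x => Re (v y x)) (fun y x => Re (vy y x))).
    + intros; apply D. + intros; apply C2. + intros; apply Cv.
  - apply (P (fun y x => Im (v y x)) (fun y x => Im (vy y x))).
    + intros; apply D. + intros; apply C2. + intros; apply Cv.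
Qed.

Definition cis (t : R) : C := Cexp (Ci * t)%C.

Lemma cis_cs t : cis t = (cos t, sin t).
Proof.
  unfold cis, Cexp. simpl. replace (0 * t - 1 * 0) with 0 by ring.
  replace (0 * 0 + 1 * t) with t by ring. rewrite exp_0. f_equal; ring.
Qed.
Lemma cis_add a b : cis (a + b) = (cis a * cis b)%C.
Proof. unfold cis. rewrite <- Cexp_add, RtoC_plus. f_equal; ring. Qed.
Lemma cis_0 : cis 0 = 1.
Proof. rewrite cis_cs, cos_0, sin_0; reflexivity. Qed.
Lemma Cmod_cis t : Cmod (cis t) = 1.
Proof. unfold cis. rewrite Cmod_Cexp. simpl. rewrite <- exp_0. f_equal; ring. Qed.
Lemma cis_nz t : cis t <> 0.
Proof. apply Cexp_neq_0. Qed.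
Lemma cis_conj t : Cconj (cis t) = cis (- t).
Proof. rewrite !cis_cs, cos_neg, sin_neg. reflexivity. Qed.
Lemma cis_2PI m : cis (2 * PI * IZR m) = 1.
Proof. rewrite cis_cs, cos_2PI_IZR, sin_2PI_IZR. reflexivity. Qed.
Lemma cis_inv a b : a + b = 0 -> (cis a * cis b)%C = 1.
Proof. intros E. rewrite <- cis_add, E. apply cis_0. Qed.

Definition ei (w : R) (x : R) : C := cis (w * x).

Lemma ei_cs w x : ei w x = (cos (w * x), sin (w * x)).
Proof. apply cis_cs. Qed.

Lemma is_Cd_ei (w x : R) : is_Cd (ei w) x (Ci * w * ei w x)%C.
Proof.
  unfold ei, cis. eapply is_Cd_val.
  - apply is_Cd_Cexp, is_Cd_scal, is_Cd_RtoC, is_derive_scal, (@is_derive_id R_AbsRing).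
  - unfold one; simpl. rewrite Rmult_1_r. ring.
Qed.

Lemma Ccont_ei w : Ccont (ei w).
Proof. eapply Ccont_is_Cd. intros; apply is_Cd_ei. Qed.

Lemma fourier_vanish g : Ccont g ->
  (forall m : Z, CInt (fun x => (g x * ei (- (2 * PI * IZR m)) x)%C) = 0) ->
  forall x, 0 < x < 1 -> g x = 0.
Proof.
  intros [C1 C2] H.
  assert (K : forall m : Z,
    RInt (fun x => Re (g x) * cos (2 * PI * IZR m * x)) 0 1 = 0 /\
    RInt (fun x => Re (g x) * sin (2 * PI * IZR m * x)) 0 1 = 0 /\
    RInt (fun x => Im (g x) * cos (2 * PI * IZR m * x)) 0 1 = 0 /\
    RInt (fun x => Im (g x) * sin (2 * PI * IZR m * x)) 0 1 = 0).
  { intros m.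
    set (a := RInt (fun x => Re (g x) * cos (2 * PI * IZR m * x)) 0 1).
    set (b := RInt (fun x => Re (g x) * sin (2 * PI * IZR m * x)) 0 1).
    set (c := RInt (fun x => Im (g x) * cos (2 * PI * IZR m * x)) 0 1).
    set (d := RInt (fun x => Im (g x) * sin (2 * PI * IZR m * x)) 0 1).
    assert (E1 := H m). assert (E2 := H (- m)%Z).
    assert (F1 : Re (CInt (fun x => (g x * ei (- (2 * PI * IZR m)) x)%C)) = a + d).
    { unfold a, d. rewrite <- RInt_Rplus by rcont. apply RInt_Rext. intros x. rewrite ei_cs.
      rewrite Ropp_mult_distr_l_reverse, cos_neg, sin_neg. unfold Re, Im; simpl; real_eq; ring. }
    assert (F2 : Im (CInt (fun x => (g x * ei (- (2 * PI * IZR m)) x)%C)) = c - b).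
    { unfold b, c. rewrite <- RInt_Rminus by rcont. apply RInt_Rext. intros x. rewrite ei_cs.
      rewrite Ropp_mult_distr_l_reverse, cos_neg, sin_neg. unfold Re, Im; simpl; real_eq; ring. }
    assert (F3 : Re (CInt (fun x => (g x * ei (- (2 * PI * IZR (- m))) x)%C)) = a - d).
    { unfold a, d. rewrite <- RInt_Rminus by rcont. apply RInt_Rext. intros x. rewrite ei_cs,
      opp_IZR.
      replace (- (2 * PI * - IZR m) * x) with (2 * PI * IZR m * x) by ring.
      unfold Re, Im; simpl; real_eq; ring. }
    assert (F4 : Im (CInt (fun x => (g x * ei (- (2 * PI * IZR (- m))) x)%C)) = c + b).
    { unfold c, b. rewrite <- RInt_Rplus by rcont. apply RInt_Rext. intros x. rewrite ei_cs,
      opp_IZR.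
      replace (- (2 * PI * - IZR m) * x) with (2 * PI * IZR m * x) by ring.
      unfold Re, Im; simpl; real_eq; ring. }
    rewrite E1 in F1, F2. rewrite E2 in F3, F4. simpl in F1, F2, F3, F4.
    repeat split; lra. }
  intros x Hx.
  assert (R1 := real_fourier_vanish (fun x => Re (g x)) C1).
  assert (R2 := real_fourier_vanish (fun x => Im (g x)) C2).
  apply C_ext; [refine (R1 _ _ x Hx)|refine (R2 _ _ x Hx)]; intros m;
    destruct (K m) as (K1 & K2 & K3 & K4); assumption.
Qed.

(** [fourier_vanish] covers the interior of the period and continuity its endpoint 0.
    Periodicity of the modulus is enough to leave the period, and it is what quasi-periodic
    functions have. *)
Lemma fourier_vanish_periodic g : Ccont g -> (forall x, Cmod (g (x + 1)) = Cmod (g x)) ->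
  (forall m : Z, CInt (fun x => (g x * ei (- (2 * PI * IZR m)) x)%C) = 0) ->
  forall x, g x = 0.
Proof.
  intros Hc Hp H.
  assert (In := fourier_vanish g Hc H).
  assert (Z0 : g 0 = 0).
  { destruct Hc as [C1 C2].
    assert (A : forall f, Rcont f -> (forall x, 0 < x < 1 -> f x = 0) -> f 0 = 0).
    { intros f Hf Hz.
      destruct (Req_dec (f 0) 0) as [E|E]; auto. exfalso.
      assert (Hpos : 0 < Rabs (f 0)) by (apply Rabs_pos_lt; auto).
      destruct (Hf 0 (ball (f 0) (Rabs (f 0)))) as [d Hd]. { exists (mkposreal _ Hpos); auto. }
      set (u := Rmin (d / 2) (1 / 2)).
      assert (Hu : 0 < u). { unfold u; apply Rmin_glb_lt; pose proof (cond_pos d); lra. }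
      assert (Hu1 : u < d). { unfold u; pose proof (Rmin_l (d / 2) (1 / 2));
        pose proof (cond_pos d); lra. }
      assert (Hu2 : u < 1). { unfold u; pose proof (Rmin_r (d / 2) (1 / 2)); lra. }
      assert (B : ball 0 d u). { change (Rabs (u - 0) < d). rewrite Rminus_0_r, Rabs_pos_eq; lra. }
      specialize (Hd u B). change (Rabs (f u - f 0) < Rabs (f 0)) in Hd.
      rewrite Hz in Hd by lra. replace (0 - f 0) with (- f 0) in Hd by ring.
      rewrite Rabs_Ropp in Hd. lra. }
    apply C_ext; simpl.
    - apply (A (fun x => Re (g x))); auto. intros x Hx; rewrite In; auto.
    - apply (A (fun x => Im (g x))); auto. intros x Hx; rewrite In; auto. }
  assert (I1 : forall x, 0 <= x < 1 -> Cmod (g x) = 0).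
  { intros x Hx. destruct (Req_dec x 0) as [-> | E]; [rewrite Z0; apply Cmod_0|].
    rewrite In by lra. apply Cmod_0. }
  assert (PN : forall (n : nat) x, Cmod (g (x + INR n)) = Cmod (g x)).
  { induction n as [|n IH]; intros x; [f_equal; f_equal; simpl; ring|].
    rewrite S_INR, <- Rplus_assoc, Hp, IH; auto. }
  intros x. apply Cmod_eq_0.
  destruct (archimed x) as [A1 A2].
  set (k := (up x - 1)%Z).
  assert (Hk : IZR k <= x < IZR k + 1). { unfold k. rewrite minus_IZR. lra. }
  destruct (Z_le_gt_dec 0 k) as [Hz|Hz].
  - replace x with ((x - IZR k) + INR (Z.to_nat k)).
    + rewrite PN. apply I1. lra.
    + rewrite INR_IZR_INZ, Z2Nat.id by auto. ring.
  - rewrite <- (PN (Z.to_nat (- k))). rewrite INR_IZR_INZ, Z2Nat.id, opp_IZR by lia.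
    apply I1. lra.
Qed.

(** * Functions of fixed central frequency *)

Lemma ei_cis w x : ei w x = cis (w * x).
Proof. reflexivity. Qed.

Lemma grad_cis (h : Heis -> R) p a b c :
  is_derive (fun s => h ((s, Im (fst p)), snd p)) (Re (fst p)) a ->
  is_derive (fun s => h ((Re (fst p), s), snd p)) (Im (fst p)) b ->
  is_derive (fun s => h (fst p, s)) (snd p) c ->
  grad (fun p => cis (h p)) p (Ci * a * cis (h p))%C
    (Ci * b * cis (h p))%C (Ci * c * cis (h p))%C.
Proof.
  intros H1 H2 H3. unfold cis.
  eapply grad_val; [apply grad_Cexp|..].
  - apply grad_mult; [apply grad_const|].
    split; [|split].
    + exact (is_Cd_RtoC _ _ _ H1). + exact (is_Cd_RtoC _ _ _ H2). + exact (is_Cd_RtoC _ _ _ H3).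
  - cbv beta. ring.
  - cbv beta. ring.
  - cbv beta. ring.
Qed.

Lemma CiCi : (Ci * Ci)%C = (- RtoC 1)%C.
Proof. re_im. Qed.

(** On such functions d_t is the scalar i a, so that Z and Zbar become operators in z alone. *)
Definition freq (a : R) (f : Heis -> C) : Prop :=
  forall z t, f (z, t) = (cis (a * t) * f (z, 0))%C.

Lemma freq_of_dt (a : R) f : smooth f -> (forall p, d_t f p = (Ci * a * f p)%C) -> freq a f.
Proof.
  intros Hs H z t.
  assert (D : forall s, is_Cd (fun s => (cis (- a * s) * f (z, s))%C) s 0).
  { intros s. eapply is_Cd_val.
    - apply is_Cd_mult; [exact (is_Cd_ei (- a) s)|].
      destruct (grad_smooth f Hs (z, s)) as (_ & _ & G). exact G.
    - rewrite H. rewrite ei_cis, RtoC_opp. ring. }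
  pose proof (is_Cd_eq0_const _ D t) as E. cbv beta in E.
  rewrite Rmult_0_r, cis_0, Cmult_1_l in E. rewrite <- E, Cmult_assoc, cis_inv by ring. ring.
Qed.

Lemma freq_dt (a : R) f p : freq a f -> has_dt f p (Ci * a * f p)%C.
Proof.
  intros H. destruct p as [z t]. unfold has_dt, slice_t. cbn [fst snd].
  apply is_Cd_ext with (fun s => (cis (a * s) * f (z, 0))%C).
  { intros u; symmetry; apply H. }
  eapply is_Cd_val; [apply is_Cd_mult; [exact (is_Cd_ei a t)|apply is_Cd_const]|].
  rewrite (H z t), ei_cis. ring.
Qed.

Lemma freq_d_t (a : R) f p : freq a f -> d_t f p = (Ci * a * f p)%C.
Proof. intros H; apply has_dt_eq, freq_dt; auto. Qed.

Lemma freq_dx a f : smooth f -> freq a f -> freq a (d_x f).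
Proof.
  intros Hs H [x y] t. apply has_dx_eq. unfold has_dx. cbn [fst snd Re Im].
  apply is_Cd_ext with (fun s => (cis (a * t) * slice_x f ((x, y), 0) s)%C).
  { intros u; unfold slice_x; cbn [fst snd]. symmetry; apply H. }
  apply is_Cd_scal. destruct (grad_smooth f Hs ((x, y), 0)) as (A & _ & _). exact A.
Qed.

Lemma freq_dy a f : smooth f -> freq a f -> freq a (d_y f).
Proof.
  intros Hs H [x y] t. apply has_dy_eq. unfold has_dy. cbn [fst snd Re Im].
  apply is_Cd_ext with (fun s => (cis (a * t) * slice_y f ((x, y), 0) s)%C).
  { intros u; unfold slice_y; cbn [fst snd]. symmetry; apply H. }
  apply is_Cd_scal. destruct (grad_smooth f Hs ((x, y), 0)) as (_ & A & _). exact A.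
Qed.

Lemma freq_Zop_eq a f p : freq a f -> Zop f p =
  ((d_x f p - Ci * d_y f p) / 2 - a * Cconj (fst p) * f p)%C.
Proof.
  intros H. unfold Zop, d_z. rewrite (freq_d_t a f p H).
  replace (Ci * Cconj (fst p) * (Ci * a * f p))%C with
    (Ci * Ci * (a * Cconj (fst p) * f p))%C by ring.
  rewrite CiCi. ring.
Qed.

Lemma freq_Zbarop_eq a f p : freq a f -> Zbarop f p =
  ((d_x f p + Ci * d_y f p) / 2 + a * fst p * f p)%C.
Proof.
  intros H. unfold Zbarop, d_zbar. rewrite (freq_d_t a f p H).
  replace (Ci * fst p * (Ci * a * f p))%C with
    (Ci * Ci * (a * fst p * f p))%C by ring.
  rewrite CiCi. ring.
Qed.

Lemma freq_Zop a f : smooth f -> freq a f -> freq a (Zop f).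
Proof.
  intros Hs H z t. rewrite !(freq_Zop_eq a) by auto.
  rewrite (freq_dx a f Hs H z t), (freq_dy a f Hs H z t), (H z t). cbn [fst snd]. unfold Cdiv. ring.
Qed.

Lemma freq_Zbarop a f : smooth f -> freq a f -> freq a (Zbarop f).
Proof.
  intros Hs H z t. rewrite !(freq_Zbarop_eq a) by auto.
  rewrite (freq_dx a f Hs H z t), (freq_dy a f Hs H z t), (H z t). cbn [fst snd]. unfold Cdiv. ring.
Qed.

Lemma freq_conj a f : freq a f -> freq (- a) (fun p => Cconj (f p)).
Proof.
  intros H z t. cbv beta. rewrite H, Cmult_conj, cis_conj. f_equal. f_equal. ring.
Qed.

Lemma grad_z p : grad (fun p => fst p) p 1 Ci 0.
Proof.
  eapply grad_val; [apply (grad_hol (fun z => z)), is_CC_id|..]; auto; ring.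
Qed.

Lemma grad_zbar p : grad (fun p => Cconj (fst p)) p 1 (- Ci)%C (RtoC 0).
Proof.
  eapply grad_val; [apply grad_conj, grad_z|..]; re_im.
Qed.

Lemma RtoC2_nz : RtoC 2 <> 0.
Proof. intros H. apply RtoC_inj in H. lra. Qed.

(** The fields satisfy [Z, Zbar] = -2i d_t, and d_t is the scalar i a. This makes Z and Zbar
    the raising and lowering operators of an oscillator. *)
Lemma freq_commutator a f p : smooth f -> freq a f ->
  Zop (Zbarop f) p = (Zbarop (Zop f) p + RtoC (2 * a) * f p)%C.
Proof.
  intros Hs H.
  destruct (smooth_grad f Hs) as (_ & Hx & Hy & _ & G).
  assert (E1 : Zbarop f = fun p => (RtoC (/ 2) * (d_x f p + Ci * d_y f p) + a * (fst p * f p))%C).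
  { apply functional_extensionality; intros q. rewrite (freq_Zbarop_eq a) by auto.
    unfold Cdiv. rewrite RtoC_inv by lra. ring. }
  assert (E2 : Zop f = fun p => (RtoC (/ 2) * (d_x f p + - Ci * d_y f p) + RtoC (- a)
    * (Cconj (fst p) * f p))%C).
  { apply functional_extensionality; intros q. rewrite (freq_Zop_eq a) by auto.
    unfold Cdiv. rewrite RtoC_inv, RtoC_opp by lra. ring. }
  rewrite (freq_Zop_eq a (Zbarop f)) by (apply freq_Zbarop; auto).
  rewrite (freq_Zbarop_eq a (Zop f)) by (apply freq_Zop; auto).
  assert (G1 := grad_plus _ _ p _ _ _ _ _ _
     (grad_mult _ _ p _ _ _ _ _ _ (grad_const (RtoC (/ 2)) p)
       (grad_plus _ _ p _ _ _ _ _ _ (grad_smooth _ Hx p)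
         (grad_mult _ _ p _ _ _ _ _ _ (grad_const Ci p) (grad_smooth _ Hy p))))
     (grad_mult _ _ p _ _ _ _ _ _ (grad_const (RtoC a) p)
       (grad_mult _ _ p _ _ _ _ _ _ (grad_z p) (G p)))).
  assert (G2 := grad_plus _ _ p _ _ _ _ _ _
     (grad_mult _ _ p _ _ _ _ _ _ (grad_const (RtoC (/ 2)) p)
       (grad_plus _ _ p _ _ _ _ _ _ (grad_smooth _ Hx p)
         (grad_mult _ _ p _ _ _ _ _ _ (grad_const (- Ci)%C p) (grad_smooth _ Hy p))))
     (grad_mult _ _ p _ _ _ _ _ _ (grad_const (RtoC (- a)) p)
       (grad_mult _ _ p _ _ _ _ _ _ (grad_zbar p) (G p)))).
  cbv beta in G1, G2. rewrite <- E1 in G1. rewrite <- E2 in G2.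
  apply grad_eq in G1. apply grad_eq in G2.
  destruct G1 as (X1 & X2 & _). destruct G2 as (Y1 & Y2 & _).
  rewrite X1, X2, Y1, Y2, E1, E2. cbv beta.
  rewrite (d_xy_comm f p Hs).
  unfold Cdiv. rewrite RtoC_mult, RtoC_opp, RtoC_inv by lra.
  assert (I2 : (Ci * Ci)%C = (- RtoC 1)%C) by re_im.
  generalize (d_x (d_x f) p) (d_y (d_x f) p) (d_y (d_y f) p) (d_x f p) (d_y f p) (f p) (fst p).
  intros fxx fxy fyy fx fy f0 z.
  replace (2 * a * f0)%C with
    (2 * 2 * / 2 * (a * f0))%C
    by (field; exact RtoC2_nz).
  ring [I2].
Qed.

(** * Quasi-periodicity *)

(** The multiplier is the one produced by the twisted group law for the translation by w,
    which is why Z and Zbar preserve the condition. *)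
Definition qp (a : R) (w : C) (f : Heis -> C) : Prop :=
  forall z t, f ((z + w)%C, t) = (cis (2 * a * Im (Cconj w * z)%C) * f (z, t))%C.

Lemma grad_multiplier a w p :
  grad (fun p => cis (2 * a * Im (Cconj w * fst p)%C)) p
    (Ci * RtoC (- (2 * a * Im w)) * cis (2 * a * Im (Cconj w * fst p)%C))%C
    (Ci * RtoC (2 * a * Re w) * cis (2 * a * Im (Cconj w * fst p)%C))%C
    (RtoC 0).
Proof.
  destruct w as [w1 w2].
  eapply grad_val; [apply (grad_cis (fun p => 2 * a * Im (Cconj (w1, w2) * fst p)%C) p
     (- (2 * a * w2)) (2 * a * w1) 0)|..]; try reflexivity.
  - simpl. auto_derive; auto. ring.
  - simpl. auto_derive; auto. ring.
  - simpl. auto_derive; auto.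
  - cbv beta. ring.
Qed.

Lemma grad_translate f w p a b c : grad f ((fst p + w)%C, snd p) a b c ->
  grad (fun p => f ((fst p + w)%C, snd p)) p a b c.
Proof.
  destruct p as [[x y] t], w as [w1 w2]. intros (H1 & H2 & H3).
  split; [|split].
  - exact (is_Cd_shift (fun s => f ((s, y + w2), t)) x a w1 H1).
  - exact (is_Cd_shift (fun s => f ((x + w1, s), t)) y b w2 H2).
  - exact H3.
Qed.

Lemma qp_grad a w f z t : smooth f -> qp a w f ->
  let m := cis (2 * a * Im (Cconj w * z)%C) in
  d_x f ((z + w)%C, t) = (m * (d_x f (z, t) + Ci * RtoC (- (2 * a * Im w)) * f (z, t)))%C /\
  d_y f ((z + w)%C, t) = (m * (d_y f (z, t) + Ci * RtoC (2 * a * Re w) * f (z, t)))%C.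
Proof.
  intros Hs H m.
  assert (G1 := grad_translate f w (z, t) _ _ _ (grad_smooth f Hs _)).
  assert (G2 := grad_mult _ _ (z, t) _ _ _ _ _ _ (grad_multiplier a w (z, t))
    (grad_smooth f Hs (z, t))).
  cbn [fst snd] in G1, G2. fold m in G2.
  replace (fun p : Heis => f ((fst p + w)%C, snd p)) with
    (fun p : Heis => (cis (2 * a * Im (Cconj w * fst p)%C) * f p)%C) in G1.
  - apply grad_eq in G1. apply grad_eq in G2. destruct G1 as (A1 & A2 & _), G2 as (B1 & B2 & _).
    rewrite <- A1, <- A2, B1, B2. split; ring.
  - apply functional_extensionality; intros [z' t']. symmetry; apply H.
Qed.

Lemma qp_Zbarop a w f : smooth f -> freq a f -> qp a w f -> qp a w (Zbarop f).
Proof.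
  intros Hs Ht H z t. rewrite !(freq_Zbarop_eq a) by auto.
  destruct (qp_grad a w f z t Hs H) as [E1 E2]. rewrite E1, E2, H. cbn [fst snd].
  set (m := cis _). destruct w as [w1 w2]. cbn [Re Im fst snd].
  replace ((w1, w2) : C) with (w1 + Ci * w2)%C by re_im.
  rewrite !RtoC_opp, !RtoC_mult.
  pose proof CiCi as I2.
  unfold Cdiv. field_simplify_eq. ring [I2].
Qed.

Lemma qp_Zop a w f : smooth f -> freq a f -> qp a w f -> qp a w (Zop f).
Proof.
  intros Hs Ht H z t. rewrite !(freq_Zop_eq a) by auto.
  destruct (qp_grad a w f z t Hs H) as [E1 E2]. rewrite E1, E2, H. cbn [fst snd].
  set (m := cis _). destruct w as [w1 w2]. cbn [Re Im fst snd].
  rewrite Cplus_conj.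
  replace (Cconj (w1, w2)) with (w1 - Ci * w2)%C by re_im.
  rewrite !RtoC_opp, !RtoC_mult.
  pose proof CiCi as I2.
  unfold Cdiv. field_simplify_eq. ring [I2].
Qed.

Lemma qp_conj a w f : qp a w f -> qp (- a) w (fun p => Cconj (f p)).
Proof.
  intros H z t. rewrite H, Cmult_conj, cis_conj. f_equal. f_equal. ring.
Qed.

Lemma qp_Cmod a w f z t : qp a w f -> Cmod (f ((z + w)%C, t)) = Cmod (f (z, t)).
Proof. intros H. rewrite H, Cmod_mult, Cmod_cis. ring. Qed.

(** * Fourier coefficients along horizontal lines *)

Lemma RInt_shift (f : R -> R) a b c : Rcont f ->
  RInt (fun x => f (x + c)) a b = RInt f (a + c) (b + c).
Proof.
  intros Hf.
  assert (E := RInt_comp_lin f 1 c a b).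
  replace (1 * a + c) with (a + c) in E by ring. replace (1 * b + c) with (b + c) in E by ring.
  rewrite <- E by (apply Rcont_ex_RInt; auto).
  apply RInt_Rext; intros x. unfold scal; simpl; unfold mult; simpl.
  rewrite !Rmult_1_l. reflexivity.
Qed.

Lemma RInt_period_shift (f : R -> R) c : Rcont f -> (forall x, f (x + 1) = f x) ->
  RInt (fun x => f (x + c)) 0 1 = RInt f 0 1.
Proof.
  intros Hf Hp. rewrite RInt_shift by auto.
  replace (0 + c) with c by ring. replace (1 + c) with (c + 1) by ring.
  rewrite (RInt_split f c 0 (c + 1)), (RInt_split f 0 1 (c + 1)) by auto.
  assert (E : RInt f 1 (c + 1) = RInt f 0 c).
  { replace 1 with (0 + 1) at 1 by ring. rewrite <- RInt_shift by auto. apply RInt_Rext; auto. }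
  rewrite E. assert (E2 := RInt_split f c 0 c Hf). rewrite RInt_point in E2.
  unfold zero in E2; simpl in E2. lra.
Qed.

Lemma CInt_period_shift g c : Ccont g -> (forall x, g (x + 1) = g x) ->
  CInt (fun x => g (x + c)) = CInt g.
Proof.
  intros [C1 C2] Hp. apply C_ext.
  - apply (RInt_period_shift (fun x => Re (g x)) c C1). intros; rewrite Hp; auto.
  - apply (RInt_period_shift (fun x => Im (g x)) c C2). intros; rewrite Hp; auto.
Qed.

Definition xh (p : Heis) : C := RtoC (Re (fst p)).
Definition yh (p : Heis) : C := RtoC (Im (fst p)).

Lemma smooth_xh : smooth xh.
Proof.
  replace xh with (fun p : Heis => (RtoC (/ 2) * (fst p + Cconj (fst p)))%C).
  - apply smooth_scal, smooth_plus; [apply smooth_z|apply smooth_conj, smooth_z].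
  - apply functional_extensionality; intros [[x y] t]. unfold xh; re_im. field.
Qed.

Lemma smooth_yh : smooth yh.
Proof.
  replace yh with (fun p : Heis => (RtoC (/ 2) * - Ci * (fst p + RtoC (-1) * Cconj (fst p)))%C).
  - apply smooth_scal, smooth_plus; [apply smooth_z|apply smooth_scal, smooth_conj, smooth_z].
  - apply functional_extensionality; intros [[x y] t]. unfold yh; re_im. field.
Qed.

Definition hor (V : Heis -> C) (y x : R) : C := V ((x, y), 0).

Lemma smooth_slice_x V y x : smooth V -> is_Cd (hor V y) x (d_x V ((x, y), 0)).
Proof. intros H. destruct (grad_smooth V H ((x, y), 0)) as (G & _ & _). exact G. Qed.
Lemma smooth_slice_y V y x : smooth V -> is_Cd (fun y => hor V y x) y (d_y V ((x, y), 0)).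
Proof. intros H. destruct (grad_smooth V H ((x, y), 0)) as (_ & G & _). exact G. Qed.

Lemma hor_cont V y : smooth V -> Ccont (hor V y).
Proof. intros H. eapply Ccont_is_Cd. intros x; apply smooth_slice_x; auto. Qed.

Lemma continuity_2d_swap (f : R -> R -> R) x y :
  continuity_2d_pt f x y -> continuity_2d_pt (fun b a => f a b) y x.
Proof.
  intros H e. destruct (H e) as [d Hd]. exists d. intros u v Hu Hv. apply Hd; auto.
Qed.

Lemma hor_CInt_dy V y : smooth V ->
  is_Cd (fun y => CInt (hor V y)) y (CInt (hor (d_y V) y)).
Proof.
  intros H. apply is_Cd_CInt.
  - intros; apply smooth_slice_y; auto.
  - intros b a. destruct (smooth_grad V H) as (_ & _ & Hy & _).
    destruct (contH_2d _ (Hy 0%nat) 0 a b) as [C1 C2].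
    split; [exact (continuity_2d_swap _ _ _ C1)|exact (continuity_2d_swap _ _ _ C2)].
  - intros; apply hor_cont; auto.
Qed.

Lemma hor_CInt_dx V y : smooth V -> CInt (hor (d_x V) y) = (hor V y 1 - hor V y 0)%C.
Proof.
  intros H. apply (CInt_deriv (hor V y)).
  - intros; apply smooth_slice_x; auto.
  - apply hor_cont. apply smooth_grad; auto.
Qed.

(** Multiplication by this phase cancels the multiplier of the translation by 1 and moves
    the Fourier mode of index m to the constant mode. *)
Definition phase (a b : R) (p : Heis) : C :=
  cis (- (2 * a * Im (fst p) + b) * Re (fst p)).

Lemma smooth_phase a b : smooth (phase a b).
Proof.
  replace (phase a b) with (fun p : Heis => Cexp (- Ci * ((RtoC (2 * a) * yh p + b) * xh p))%C).
  - apply smooth_Cexp, smooth_scal, smooth_mult; [|apply smooth_xh].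
    apply smooth_plus; [|apply smooth_const]. apply smooth_scal, smooth_yh.
  - apply functional_extensionality; intros p. unfold phase, cis, xh, yh. f_equal.
    rewrite !RtoC_mult, RtoC_opp, RtoC_plus, !RtoC_mult. ring.
Qed.

Lemma grad_phase a b p : grad (phase a b) p
   (Ci * RtoC (- (2 * a * Im (fst p) + b)) * phase a b p)%C
   (Ci * RtoC (- (2 * a * Re (fst p))) * phase a b p)%C
   (RtoC 0).
Proof.
  eapply grad_val; [apply (grad_cis (fun p => - (2 * a * Im (fst p) + b) * Re (fst p)) p
    (- (2 * a * Im (fst p) + b)) (- (2 * a * Re (fst p))) 0)|..]; try reflexivity.
  - simpl. auto_derive; auto. ring.
  - simpl. auto_derive; auto. ring.
  - simpl. auto_derive; auto.
  - cbv beta. ring.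
Qed.

Definition untwist (a : R) (m : Z) (u : Heis -> C) (p : Heis) : C :=
  (phase a (2 * PI * IZR m) p * u p)%C.

Lemma smooth_untwist a m u : smooth u -> smooth (untwist a m u).
Proof. intros H. apply smooth_mult; auto. apply smooth_phase. Qed.

Definition coef (a : R) (m : Z) (u : Heis -> C) (y : R) : C := CInt (hor (untwist a m u) y).

Lemma Cplus_IZR1 x y : (x + 1, y) = ((x, y) + 1)%C.
Proof. re_im. Qed.

Lemma untwist_periodic a m u y x : qp a 1 u -> hor (untwist a m u) y (x + 1)
  = hor (untwist a m u) y x.
Proof.
  intros H. unfold hor, untwist, phase. rewrite Cplus_IZR1, H, Cmult_assoc, <- cis_add. f_equal.
  cbn [fst snd]. unfold Re, Im; simpl.
  replace (- (2 * a * (y + 0) + 2 * PI * IZR m) * (x + 1) + 2 * a * (1 * y + - 0 * x)) with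
    (- (2 * a * y + 2 * PI * IZR m) * x + 2 * PI * IZR (- m)) by (rewrite opp_IZR; ring).
  rewrite cis_add, cis_2PI. ring.
Qed.

(** Zbar u = 0 expresses d_y u through d_x u, and x-derivatives of periodic functions have
    mean zero; only the derivative of the phase and the zeroth order term of Zbar remain. *)
Lemma coef_ode a m u y : smooth u -> freq a u -> (forall p, Zbarop u p = 0) -> qp a 1 u ->
  is_Cd (coef a m u) y (RtoC (- (4 * a * y + 2 * PI * IZR m)) * coef a m u y)%C.
Proof.
  intros Hs Ht Hz Hq. set (V := untwist a m u). assert (HV : smooth V) by (apply smooth_untwist;
    auto).
  eapply is_Cd_val; [apply (hor_CInt_dy V y HV)|].
  transitivity (CInt (fun x => (Ci * hor (d_x V) y x + RtoC (- (4 * a * y + 2 * PI * IZR m))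
    * hor V y x)%C)).
  - apply CInt_ext; intros x. unfold hor.
    set (p := ((x, y), 0) : Heis).
    assert (G := grad_mult _ _ p _ _ _ _ _ _ (grad_phase a (2 * PI * IZR m) p)
      (grad_smooth u Hs p)).
    apply grad_eq in G. destruct G as (G1 & G2 & _).
    change (d_x V p) with (d_x (fun p => (phase a (2 * PI * IZR m) p * u p)%C) p).
    change (d_y V p) with (d_y (fun p => (phase a (2 * PI * IZR m) p * u p)%C) p).
    rewrite G1, G2. change (V p) with (phase a (2 * PI * IZR m) p * u p)%C.
    specialize (Hz p). rewrite (freq_Zbarop_eq a u p Ht) in Hz.
    set (F := phase a (2 * PI * IZR m) p).
    (* Zbar u = 0 solved for d_y u. *)
    assert (Hy : d_y u p = (Ci * d_x u p + 2 * Ci * (a * fst p) * u p)%C).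
    { pose proof CiCi as I2.
      assert (Hi : (Ci * d_y u p)%C = (- d_x u p - 2 * (a * fst p * u p))%C).
      { transitivity (2 * ((d_x u p + Ci * d_y u p) / 2 + a * fst p * u p)
        - (d_x u p + 2 * (a * fst p * u p)))%C.
        - field.
        - rewrite Hz. ring. }
      transitivity (- Ci * (Ci * d_y u p))%C; [ring [I2]|rewrite Hi; ring]. }
    rewrite Hy. unfold p; cbn [fst snd Re Im].
    replace ((x, y) : C) with (x + Ci * y)%C by re_im.
    pose proof CiCi as I2.
    rewrite !RtoC_opp, !RtoC_plus, !RtoC_mult.
    replace (RtoC 4) with (2 * 2)%C by (rewrite <- RtoC_mult; f_equal; ring).
    ring [I2].
  - assert (Hx : smooth (d_x V)) by (apply smooth_grad; auto).
    assert (C1 := hor_cont V y HV). assert (C2 := hor_cont (d_x V) y Hx).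
    rewrite CInt_plus; [|exact (Ccont_mult _ _ (Ccont_const _) C2)|exact
      (Ccont_mult _ _ (Ccont_const _) C1)].
    rewrite (CInt_scal Ci (hor (d_x V) y)), (CInt_scal _ (hor V y)) by auto.
    rewrite hor_CInt_dx by auto.
    assert (E : hor V y 1 = hor V y 0).
    { replace 1 with (0 + 1) by ring. apply untwist_periodic; auto. }
    rewrite E. change (coef a m u y) with (CInt (hor V y)). ring.
Qed.

Lemma coef_formula a m u y : smooth u -> freq a u -> (forall p, Zbarop u p = 0) -> qp a 1 u ->
  coef a m u y = (RtoC (exp (- (2 * a * y * y + 2 * PI * IZR m * y))) * coef a m u 0)%C.
Proof.
  intros Hs Ht Hz Hq.
  set (E := fun y => RtoC (exp (2 * a * y * y + 2 * PI * IZR m * y))).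
  assert (D : forall s, is_Cd (fun s => (E s * coef a m u s)%C) s 0).
  { intros s. eapply is_Cd_val.
    - apply is_Cd_mult; [|apply coef_ode; auto].
      apply is_Cd_RtoC. instantiate (1 := (4 * a * s + 2 * PI * IZR m)
        * exp (2 * a * s * s + 2 * PI * IZR m * s)).
      auto_derive; auto. ring.
    - unfold E. rewrite !RtoC_mult, RtoC_opp. ring. }
  pose proof (is_Cd_eq0_const _ D y) as K. cbv beta in K.
  assert (E0 : E 0 = 1).
  { unfold E. rewrite <- exp_0. f_equal. f_equal. ring. }
  rewrite E0, Cmult_1_l in K. rewrite <- K, Cmult_assoc. unfold E.
  rewrite <- RtoC_mult, <- exp_plus.
  replace (- _ + _) with 0 by ring. rewrite exp_0. ring.
Qed.

(** On each horizontal line this is Fourier uniqueness for u times a phase. *)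
Lemma coef_all_zero a u : smooth u -> freq a u -> qp a 1 u ->
  (forall m y, coef a m u y = 0) -> forall p, u p = 0.
Proof.
  intros Hs Ht Hq H. intros [[x y] t]. rewrite Ht.
  assert (K : forall x, (cis (- (2 * a * y) * x) * u ((x, y), 0))%C = 0).
  { apply fourier_vanish_periodic.
    - apply Ccont_mult; [exact (Ccont_ei (- (2 * a * y)))|exact (hor_cont u y Hs)].
    - intros x'. rewrite !Cmod_mult, !Cmod_cis, Cplus_IZR1. f_equal. apply (qp_Cmod a); auto.
    - intros m. rewrite <- (H m y). apply CInt_ext; intros x'.
      unfold hor, untwist, phase, ei. fold (cis (- (2 * PI * IZR m) * x')). cbn [fst snd Re Im].
      rewrite <- (Cmult_comm (cis (- (2 * PI * IZR m) * x'))), Cmult_assoc,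
        <- cis_add. f_equal. f_equal. unfold Re, Im; simpl. ring. }
  specialize (K x).
  assert (E : u ((x, y), 0) = 0).
  { rewrite <- (Cmult_1_l (u ((x, y), 0))), <- (cis_inv (2 * a * y * x) (- (2 * a * y) * x)) by
    ring.
    rewrite <- Cmult_assoc, K. apply Cmult_0_r. }
  exact (eq_trans (f_equal (Cmult (cis (a * t))) E) (Cmult_0_r _)).
Qed.

Lemma linear_bounded_zero A K : 0 <= A -> (exists l0 : nat, forall l : nat, (l0 <= l)%nat -> A
  * (1 + INR l) <= K) -> A = 0.
Proof.
  intros HA [l0 H]. destruct (Req_dec A 0) as [E|E]; auto. exfalso.
  assert (HAp : 0 < A) by lra.
  destruct (INR_unbounded (K / A)) as [n Hn].
  specialize (H (max l0 n) (Nat.le_max_l _ _)).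
  assert (INR n <= INR (max l0 n)) by (apply le_INR, Nat.le_max_r).
  assert (K < A * INR n).
  { apply Rmult_lt_reg_l with (/ A); [apply Rinv_0_lt_compat; auto|].
    rewrite <- Rmult_assoc, Rinv_l by lra. unfold Rdiv in Hn; lra. }
  nra.
Qed.

(** The vertical translation by sqrt 3 is 2 eta - 1. *)
Lemma vertical_shift a u x y t : qp a 1 u -> qp a eta u ->
  Cmod (u ((x, y + s3), t)) = Cmod (u ((x, y), t)).
Proof.
  intros H1 H2.
  transitivity (Cmod (u (((x, y + s3)%R + 1)%C, t))); [symmetry; apply (qp_Cmod a); auto|].
  assert (E : ((x, y + s3)%R + 1)%C = ((x, y) + eta + eta)%C).
  { rewrite eta_eq. re_im; field. }
  rewrite E, !(qp_Cmod a eta u) by auto. reflexivity.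
Qed.

(** The conjugate w of u has frequency -a and Zbar w = 0, so by [coef_formula] its Fourier
    coefficients along horizontal lines grow like exp (2 a y^2 - 2 pi m y) unless they
    vanish. They are bounded, since |w| is bounded on one line and [vertical_shift] moves
    that line arbitrarily high. *)
Lemma Zop_kernel_zero a u : 0 < a -> smooth u -> freq a u -> qp a 1 u -> qp a eta u ->
  (forall p, Zop u p = 0) -> forall p, u p = 0.
Proof.
  intros Ha Hs Ht H1 H2 Hz.
  set (w := fun p => Cconj (u p)).
  assert (Hws : smooth w) by (apply smooth_conj; auto).
  assert (Hwt : freq (- a) w) by (apply freq_conj; auto).
  assert (Hw1 : qp (- a) (RtoC 1) w) by (apply qp_conj; auto).
  assert (Hw2 : qp (- a) eta w) by (apply qp_conj; auto).
  assert (Hwz : forall p, Zbarop w p = 0).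
  { intros p. unfold w. rewrite Zbarop_conj, Hz by auto. re_im. }
  assert (Hvs : forall (l : nat) x, Cmod (w ((x, s3 * INR l), 0)) = Cmod (w ((x, 0), 0))).
  { induction l as [|l IH]; intros x; [rewrite Rmult_0_r; auto|].
    rewrite S_INR. replace (s3 * (INR l + 1)) with (s3 * INR l + s3) by ring.
    rewrite (vertical_shift (- a)); auto. }
  assert (Hbd : exists K, forall x, 0 <= x <= 1 -> Cmod (w ((x, 0), 0)) <= K).
  { destruct (hor_cont w 0 Hws) as [C1 C2].
    assert (B : forall f, Rcont f -> exists K, forall x, 0 <= x <= 1 -> Rabs (f x) <= K).
    { intros f Hf. destruct (continuity_ab_maj (fun x => Rabs (f x)) 0 1) as [M [HM _]].
      - lra.
      - intros c _. apply continuity_pt_filterlim. apply (continuous_comp f Rabs);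
          [apply Hf|apply continuous_Rabs].
      - exists (Rabs (f M)). auto. }
    destruct (B _ C1) as [K1 B1]. destruct (B _ C2) as [K2 B2].
    exists (K1 + K2). intros x Hx. eapply Rle_trans; [apply Cmod_le_sum|].
    specialize (B1 x Hx). specialize (B2 x Hx). unfold hor in *. lra. }
  destruct Hbd as [K HK].
  assert (Hc0 : forall m, coef (- a) m w 0 = 0).
  { intros m. apply Cmod_eq_0. apply linear_bounded_zero with (2 * K); [apply Cmod_ge_0|].
    pose proof s3_pos as S3. pose proof s3_sq as SS.
    (* At height y = l sqrt 3 the exponent is 6 a l^2 - 2 pi m sqrt 3 l, which exceeds l for
       large l. *)
    destruct (INR_unbounded ((1 + 2 * PI * Rabs (IZR m) * s3) / (6 * a))) as [l0 Hl0].
    exists l0. intros l Hl.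
    assert (Bd : Cmod (coef (- a) m w (s3 * INR l)) <= 2 * K).
    { apply CInt_bound; [apply hor_cont, smooth_untwist; auto|].
      intros x Hx. unfold hor, untwist, phase. rewrite Cmod_mult, Cmod_cis, Rmult_1_l, Hvs. auto. }
    rewrite coef_formula in Bd by auto.
    rewrite Cmod_mult, Cmod_R, Rabs_pos_eq in Bd by (left; apply exp_pos).
    assert (HL : INR l <= - (2 * - a * (s3 * INR l) * (s3 * INR l) + 2 * PI * IZR m
      * (s3 * INR l))).
    { replace (- (2 * - a * (s3 * INR l) * (s3 * INR l) + 2 * PI * IZR m * (s3 * INR l)))
        with (INR l * (2 * (s3 * s3) * a * INR l - 2 * PI * IZR m * s3)) by ring.
      rewrite SS. rewrite <- (Rmult_1_r (INR l)) at 1.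
      apply Rmult_le_compat_l; [apply pos_INR|].
      assert (Hl' : INR l0 <= INR l) by (apply le_INR; auto).
      assert (1 + 2 * PI * Rabs (IZR m) * s3 < 6 * a * INR l0).
      { apply Rmult_lt_reg_l with (/ (6 * a)); [apply Rinv_0_lt_compat; lra|].
        rewrite <- Rmult_assoc, Rinv_l by lra. unfold Rdiv in Hl0; lra. }
      assert (2 * PI * IZR m * s3 <= 2 * PI * Rabs (IZR m) * s3).
      { pose proof PI_RGT_0. apply Rmult_le_compat_r; [lra|]. apply Rmult_le_compat_l;
        [lra|]. apply Rle_abs. }
      nra. }
    apply Rle_trans with (2 := Bd). rewrite Rmult_comm. apply Rmult_le_compat_r; [apply Cmod_ge_0|].
    eapply Rle_trans; [|apply exp_le_mono; exact HL].
    destruct (Req_dec (INR l) 0) as [E|E]; [rewrite E, exp_0; lra|].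
    left; apply exp_ineq1; auto. }
  intros p.
  assert (Hw0 : w p = 0).
  { apply (coef_all_zero (- a) w); auto. intros m y. rewrite coef_formula,
    Hc0 by auto. apply Cmult_0_r. }
  apply Cmod_eq_0. rewrite <- Cmod_conj. fold (w p). rewrite Hw0. apply Cmod_0.
Qed.

(** The translation by eta raises the line by sqrt 3 / 2 and, because of the multiplier,
    shifts the Fourier index by M; going back down multiplies the coefficient by the nonzero
    factor of [coef_formula]. *)
Lemma coef_eta a M m u : smooth u -> freq a u -> (forall p, Zbarop u p = 0) ->
  qp a 1 u -> qp a eta u -> a * s3 = PI * INR M ->
  coef a m u 0 = 0 <-> coef a (m + Z.of_nat M) u 0 = 0.
Proof.
  intros Hs Ht Hz H1 H2 Ha.
  assert (E1 : coef a m u (s3 / 2) = (cis (a * s3 / 2 - PI * (IZR m + INR M))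
    * coef a (m + Z.of_nat M) u 0)%C).
  { unfold coef. rewrite <- (CInt_period_shift (hor (untwist a (m + Z.of_nat M) u) 0) (- (1 / 2))).
    - rewrite <- CInt_scal.
      + apply CInt_ext. intros x. unfold hor, untwist, phase. cbn [fst snd].
        replace (x, s3 / 2) with ((x + - (1 / 2), 0)%R + eta)%C by (rewrite eta_eq; re_im; field).
        rewrite H2, !Cmult_assoc, <- !cis_add. f_equal. f_equal.
        rewrite eta_eq. unfold Re, Im; simpl. rewrite plus_IZR, <- INR_IZR_INZ.
        replace (2 * PI * (IZR m + INR M)) with (2 * PI * IZR m + 2 * (a * s3)) by (rewrite Ha;
          ring).
        replace (PI * (IZR m + INR M)) with (PI * IZR m + a * s3) by (rewrite Ha; ring).
        field.
      + pose proof (hor_cont (untwist a (m + Z.of_nat M) u) 0 (smooth_untwist _ _ _ Hs)) as [C1 C2].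
        split; [exact (Rcont_comp _ _ C1 (Rcont_plus _ _ Rcont_id (Rcont_const _)))|
          exact (Rcont_comp _ _ C2 (Rcont_plus _ _ Rcont_id (Rcont_const _)))].
    - apply hor_cont, smooth_untwist; auto.
    - intros; apply untwist_periodic; auto. }
  rewrite coef_formula in E1 by auto.
  assert (Enz : RtoC (exp (- (2 * a * (s3 / 2) * (s3 / 2) + 2 * PI * IZR m * (s3 / 2)))) <> 0).
  { intros E. apply RtoC_inj in E. pose proof
    (exp_pos (- (2 * a * (s3 / 2) * (s3 / 2) + 2 * PI * IZR m * (s3 / 2)))). lra. }
  pose proof (cis_nz (a * s3 / 2 - PI * (IZR m + INR M))) as Cnz.
  split; intros E; rewrite E, Cmult_0_r in E1.
  - destruct (Ceq_dec (coef a (m + Z.of_nat M) u 0) (RtoC 0)) as [|N]; auto.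
    exfalso. apply (Cmult_neq_0 _ _ Cnz N). auto.
  - destruct (Ceq_dec (coef a m u 0) (RtoC 0)) as [|N]; auto.
    exfalso. apply (Cmult_neq_0 _ _ Enz N). auto.
Qed.

(** By [coef_eta] the vanishing of a coefficient depends on its index modulo M only. *)
Lemma coef_determines a M u : (0 < M)%nat -> smooth u -> freq a u -> (forall p, Zbarop u p = 0) ->
  qp a 1 u -> qp a eta u -> a * s3 = PI * INR M ->
  (forall j, (j < M)%nat -> coef a (Z.of_nat j) u 0 = 0) -> forall p, u p = 0.
Proof.
  intros HM Hs Ht Hz H1 H2 Ha H.
  assert (St : forall m, coef a m u 0 = 0 <-> coef a (m + Z.of_nat M) u 0 = 0)
    by (intros; apply coef_eta; auto).
  assert (All : forall (n : nat) m, coef a m u 0 = 0 <-> coef a (m + Z.of_nat n * Z.of_nat M) u 0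
    = 0).
  { induction n as [|n IH]; intros m.
    - rewrite Z.mul_0_l, Z.add_0_r; tauto.
    - rewrite IH, St. replace (m + Z.of_nat (S n) * Z.of_nat M)%Z with
        (m + Z.of_nat n * Z.of_nat M + Z.of_nat M)%Z by lia. tauto. }
  apply (coef_all_zero a u); auto. intros m y. rewrite coef_formula by auto.
  assert (E : coef a m u 0 = 0); [|rewrite E; apply Cmult_0_r].
  assert (HMz : (0 < Z.of_nat M)%Z) by lia.
  pose proof (Z.mod_pos_bound m _ HMz) as Hr. pose proof (Z.div_mod m (Z.of_nat M) ltac:(lia)) as
    Hd.
  set (q := (m / Z.of_nat M)%Z) in *. set (r := (m mod Z.of_nat M)%Z) in *.
  assert (Hr0 : coef a r u 0 = 0).
  { rewrite <- (Z2Nat.id r) by lia. apply H. lia. }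
  destruct (Z_le_gt_dec 0 q) as [Hq|Hq].
  - apply (proj1 (All (Z.to_nat q) r)) in Hr0. rewrite Z2Nat.id in Hr0 by auto.
    replace m with (r + q * Z.of_nat M)%Z by lia. auto.
  - apply (proj2 (All (Z.to_nat (- q)) m)). rewrite Z2Nat.id by lia.
    replace (m + - q * Z.of_nat M)%Z with r by lia. auto.
Qed.

(** * Finite sums and dimension *)

Definition csum {A} (l : list A) (F : A -> C) : C :=
  fold_right (fun x s => (F x + s)%C) (RtoC 0) l.

Lemma csum_ext {A} (l : list A) F G : (forall x, In x l -> F x = G x) -> csum l F = csum l G.
Proof.
  induction l as [|x l IH]; intros H; simpl; auto.
  rewrite H, IH; simpl; auto. intros; apply H; simpl; auto.
Qed.
Lemma csum_app {A} (l l' : list A) F : csum (l ++ l') F = (csum l F + csum l' F)%C.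
Proof. induction l as [|x l IH]; simpl; [ring|rewrite IH; ring]. Qed.
Lemma csum_plus {A} (l : list A) F G :
  csum l (fun x => (F x + G x)%C) = (csum l F + csum l G)%C.
Proof. induction l as [|x l IH]; simpl; [ring|rewrite IH; ring]. Qed.
Lemma csum_scal {A} (l : list A) c F : csum l (fun x => (c * F x)%C) = (c * csum l F)%C.
Proof. induction l as [|x l IH]; simpl; [ring|rewrite IH; ring]. Qed.
Lemma csum_zero {A} (l : list A) (F : A -> C) : (forall x, In x l -> F x = 0) -> csum l F = 0.
Proof.
  induction l as [|x l IH]; intros H; simpl; auto. rewrite H, IH; simpl; auto; [ring|].
  intros; apply H; simpl; auto.
Qed.
Lemma csum_map {A B} (g : A -> B) (l : list A) F : csum (map g l) F = csum l (fun x => F (g x)).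
Proof. induction l as [|x l IH]; simpl; [auto|rewrite IH; auto]. Qed.
Lemma csum_perm {A} (l l' : list A) F : Permutation l l' -> csum l F = csum l' F.
Proof. induction 1; simpl; auto; try congruence. ring. Qed.
Lemma csum_swap {A B} (l : list A) (l' : list B) F :
  csum l (fun x => csum l' (F x)) = csum l' (fun y => csum l (fun x => F x y)).
Proof.
  induction l as [|x l IH]; simpl; [symmetry; apply csum_zero; auto|].
  rewrite IH, csum_plus. reflexivity.
Qed.
Lemma csum_single {A} (l : list A) x (F : A -> C) : NoDup l -> In x l ->
  (forall y, In y l -> y <> x -> F y = 0) -> csum l F = F x.
Proof.
  intros N I H. destruct (in_split x l I) as (l1 & l2 & ->).
  apply NoDup_remove_2 in N. rewrite csum_app. simpl.
  rewrite (csum_zero l1), (csum_zero l2); [ring| |].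
  - intros y Hy. apply H; [apply in_or_app; simpl; auto|]. intros ->. apply N, in_or_app; auto.
  - intros y Hy. apply H; [apply in_or_app; auto|]. intros ->. apply N, in_or_app; auto.
Qed.
Lemma csum_filter {A} (P : A -> bool) (l : list A) (F : A -> C) :
  (forall x, In x l -> P x = false -> F x = 0) -> csum l F = csum (filter P l) F.
Proof.
  induction l as [|x l IH]; intros H; simpl; auto.
  assert (E : csum l F = csum (filter P l) F) by (apply IH; intros; apply H; simpl; auto).
  destruct (P x) eqn:Ex; simpl; rewrite E; auto. rewrite H; simpl; auto. ring.
Qed.

(** Gaussian elimination: either the last coordinate vanishes on all vectors, or one vector
    is used to clear it from the others. *)
Lemma dependence {A} (eqd : forall x y : A, {x = y} + {x <> y}) (n : nat) : forall (l : list A),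
  NoDup l -> (n < length l)%nat ->
  forall v : A -> nat -> C, exists a : A -> C, (exists i, In i l /\ a i <> 0) /\
    forall j, (j < n)%nat -> csum l (fun i => (a i * v i j)%C) = 0.
Proof.
  induction n as [|n IH]; intros l N L v.
  - destruct l as [|x l]; [simpl in L; lia|]. exists (fun _ => RtoC 1). split.
    + exists x; split; [simpl; auto|apply C1_nz].
    + intros; lia.
  - destruct (Exists_dec (fun i => v i n <> 0) l) as [E|E].
    { intros i. destruct (Ceq_dec (v i n) (RtoC 0)); [right|left]; auto. }
    + apply Exists_exists in E. destruct E as (i0 & I0 & E0).
      destruct (in_split i0 l I0) as (l1 & l2 & ->).
      pose proof (NoDup_remove_1 _ _ _ N) as N1. pose proof (NoDup_remove_2 _ _ _ N) as N2.
      destruct (IH (l1 ++ l2) N1) with (v := fun i j => (v i j - v i n / v i0 n * v i0 j)%C)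
        as (a & (i & Ii & Ia) & Ha).
      { rewrite length_app in *. simpl in L. lia. }
      set (a0 := (- csum (l1 ++ l2) (fun i => (a i * (v i n / v i0 n))%C))%C).
      exists (fun y => if eqd y i0 then a0 else a y). split.
      * exists i. split. { apply in_app_or in Ii. apply in_or_app. simpl; tauto. }
        destruct (eqd i i0) as [Ei|_]; [exfalso; rewrite Ei in Ii; exact (N2 Ii)|exact Ia].
      * assert (Ex : forall j, csum (l1 ++ i0 :: l2)
          (fun i => ((if eqd i i0 then a0 else a i) * v i j)%C) =
          csum (l1 ++ l2) (fun i => (a i * (v i j - v i n / v i0 n * v i0 j))%C)).
        { intros j.
          transitivity (a0 * v i0 j + csum (l1 ++ l2) (fun i => (a i * v i j)%C))%C.
          - rewrite (csum_perm _ (i0 :: l1 ++ l2)) by (symmetry; apply Permutation_middle).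
            cbn [csum fold_right]. fold (csum (l1 ++ l2)
              (fun i => ((if eqd i i0 then a0 else a i) * v i j)%C)).
            destruct (eqd i0 i0) as [_|]; [|congruence]. f_equal.
            apply csum_ext. intros y Hy. destruct (eqd y i0) as [Ei|_]; auto. exfalso;
              rewrite Ei in Hy; exact (N2 Hy).
          - unfold a0.
            replace (- csum (l1 ++ l2) (fun i => (a i * (v i n / v i0 n))%C) * v i0 j)%C
              with (- v i0 j * csum (l1 ++ l2) (fun i => (a i * (v i n / v i0 n))%C))%C by ring.
            rewrite <- csum_scal, <- csum_plus. apply csum_ext. intros; ring. }
        intros j Hj. rewrite Ex. destruct (Nat.eq_dec j n) as [->|].
        -- apply csum_zero. intros; field; auto.
        -- apply Ha; lia.
    + destruct (IH l N) with (v := v) as (a & Ha1 & Ha2); [lia|].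
      exists a; split; auto. intros j Hj. destruct (Nat.eq_dec j n) as [->|]; [|apply Ha2; lia].
      apply csum_zero. intros x Hx.
      destruct (Ceq_dec (v x n) (RtoC 0)) as [Z|Z]; [rewrite Z; ring|].
      exfalso; apply E, Exists_exists; eauto.
Qed.

(** Turns coefficients numbered as in [has_dim] into coefficients indexed by the entries of
    the list. *)
Fixpoint pos {A} (eqd : forall x y : A, {x = y} + {x <> y}) (x : A) (l : list A) : nat :=
  match l with
  | nil => O
  | y :: l' => if eqd x y then O else S (pos eqd x l')
  end.

Lemma pos_nth {A} (eqd : forall x y : A, {x = y} + {x <> y}) l d i : NoDup l ->
  (i < length l)%nat -> pos eqd (nth i l d) l = i.
Proof.
  intros N; revert i; induction N as [|x l Hx N IH]; intros i Hi; simpl in *; [lia|].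
  destruct i as [|i]; simpl.
  - destruct (eqd x x); congruence.
  - destruct (eqd (nth i l d) x) as [E|E].
    + exfalso; apply Hx. rewrite <- E. apply nth_In; lia.
    + rewrite IH; auto; lia.
Qed.

Lemma sum_n_m_nth {A} (l : list A) d (F : A -> C) :
  sum_n_m (fun i => F (nth (i - 1) l d)) 1 (length l) = csum l F.
Proof.
  induction l as [|x l IH].
  - rewrite sum_n_m_zero by (simpl; lia). reflexivity.
  - simpl length. rewrite sum_Sn_m by lia. simpl csum.
    rewrite <- IH, <- sum_n_m_S. apply (f_equal2 Cplus);
      [reflexivity|]. apply sum_n_m_ext_loc. intros k Hk.
    replace (S k - 1)%nat with k by lia. destruct k as [|k]; [lia|].
    simpl nth. rewrite ?Nat.sub_succ, ?Nat.sub_0_r; reflexivity.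
Qed.

Lemma has_dim_of_list {A} (eqd : forall x y : A, {x = y} + {x <> y}) (V : (Heis -> C) -> Prop)
  (l : list A) (b : A -> Heis -> C) : NoDup l ->
  (forall x, In x l -> V (b x)) ->
  (forall a : A -> C, (forall p, csum l (fun x => (a x * b x p)%C) = 0) ->
     forall x, In x l -> a x = 0) ->
  (forall f, V f -> exists a : A -> C, forall p, f p = csum l (fun x => (a x * b x p)%C)) ->
  has_dim V (length l).
Proof.
  intros N H1 H2 H3.
  destruct l as [|d l0].
  - exists (fun _ _ => RtoC 0). split; [intros; simpl in *; lia|split; [intros; simpl in *; lia|]].
    intros f Hf. destruct (H3 f Hf) as [a Ha]. exists (fun _ => RtoC 0). intros p. rewrite Ha.
    unfold lincomb. rewrite sum_n_m_zero by (simpl; lia). reflexivity.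
  - set (l := d :: l0) in *.
    assert (L : forall a p, lincomb (length l) a (fun i => b (nth (i - 1) l d)) p =
      csum l (fun x => (a (S (pos eqd x l)) * b x p)%C)).
    { intros a p. rewrite <- (sum_n_m_nth l d). unfold lincomb. apply sum_n_m_ext_loc.
      intros k Hk. rewrite pos_nth by (auto; lia). f_equal. f_equal. lia. }
    (* Basis vectors are numbered from 1. *)
    exists (fun i => b (nth (i - 1) l d)). split; [|split].
    + intros i Hi. apply H1, nth_In. lia.
    + intros a Ha i Hi.
      assert (E := H2 (fun x => a (S (pos eqd x l)))). cbv beta in E.
      specialize (E (fun p => eq_trans (eq_sym (L a p)) (Ha p)) (nth (i - 1) l d)).
      rewrite pos_nth in E by (auto; lia). replace (S (i - 1)) with i in E by lia.
      apply E. apply nth_In; lia.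
    + intros f Hf. destruct (H3 f Hf) as [a Ha].
      exists (fun i => a (nth (i - 1) l d)). intros p. rewrite Ha.
      unfold lincomb. symmetry. apply (sum_n_m_nth l d (fun x => (a x * b x p)%C)).
Qed.

(** * Landau levels *)

Lemma csum_smooth {A} (l : list A) (a : A -> C) b : (forall x, In x l -> smooth (b x)) ->
  smooth (fun p => csum l (fun x => (a x * b x p)%C)).
Proof.
  induction l as [|x l IH]; intros H; simpl; [apply smooth_const|].
  apply smooth_plus; [apply smooth_scal, H; simpl; auto|apply IH; intros; apply H; simpl; auto].
Qed.

Lemma csum_Zop {A} (l : list A) (a : A -> C) b p : (forall x, In x l -> smooth (b x)) ->
  Zop (fun p => csum l (fun x => (a x * b x p)%C)) p = csum l (fun x => (a x * Zop (b x) p)%C).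
Proof.
  induction l as [|x l IH]; intros H; simpl.
  - rewrite (Zop_grad _ _ _ _ _ (grad_const 0 p)). unfold Cdiv; ring.
  - rewrite (Zop_plus (fun p => (a x * b x p)%C)).
    + rewrite Zop_scal by (apply H; simpl; auto). rewrite IH; auto. intros; apply H; simpl; auto.
    + apply smooth_scal, H; simpl; auto.
    + apply csum_smooth. intros; apply H; simpl; auto.
Qed.

Lemma csum_Zbarop {A} (l : list A) (a : A -> C) b p : (forall x, In x l -> smooth (b x)) ->
  Zbarop (fun p => csum l (fun x => (a x * b x p)%C)) p
    = csum l (fun x => (a x * Zbarop (b x) p)%C).
Proof.
  induction l as [|x l IH]; intros H; simpl.
  - rewrite (Zbarop_grad _ _ _ _ _ (grad_const 0 p)). unfold Cdiv; ring.
  - rewrite (Zbarop_plus (fun p => (a x * b x p)%C)).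
    + rewrite Zbarop_scal by (apply H; simpl; auto). rewrite IH; auto. intros; apply H; simpl; auto.
    + apply smooth_scal, H; simpl; auto.
    + apply csum_smooth. intros; apply H; simpl; auto.
Qed.

Lemma csum_freq {A} al (l : list A) (a : A -> C) b : (forall x, In x l -> freq al (b x)) ->
  freq al (fun p => csum l (fun x => (a x * b x p)%C)).
Proof.
  intros H z t. rewrite <- csum_scal. apply csum_ext. intros x Hx. rewrite (H x Hx z t). ring.
Qed.

Lemma csum_qp {A} al w (l : list A) (a : A -> C) b : (forall x, In x l -> qp al w (b x)) ->
  qp al w (fun p => csum l (fun x => (a x * b x p)%C)).
Proof.
  intros H z t. rewrite <- csum_scal. apply csum_ext. intros x Hx. rewrite (H x Hx z t). ring.
Qed.

Lemma coef_csum {A} al m (l : list A) (a : A -> C) b y : (forall x, In x l -> smooth (b x)) ->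
  coef al m (fun p => csum l (fun x => (a x * b x p)%C)) y
    = csum l (fun x => (a x * coef al m (b x) y)%C).
Proof.
  induction l as [|x l IH]; intros H; simpl.
  - unfold coef. rewrite (CInt_ext _ (fun _ => RtoC 0)); [apply CInt_const|].
    intros x. unfold hor, untwist. apply Cmult_0_r.
  - rewrite <- IH by (intros; apply H; simpl; auto). unfold coef.
    rewrite <- CInt_scal by (apply hor_cont, smooth_untwist, H; simpl; auto).
    rewrite <- CInt_plus.
    + apply CInt_ext. intros u. unfold hor, untwist. ring.
    + apply (Ccont_mult (fun _ => a x)); [apply Ccont_const|]. apply hor_cont, smooth_untwist, H;
        simpl; auto.
    + apply hor_cont, smooth_untwist, csum_smooth. intros; apply H; simpl; auto.
Qed.

(** Sections of the line bundle over the torus C / L_eta that belongs to the central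
    character of frequency a. *)
Definition section (a : R) (f : Heis -> C) : Prop :=
  smooth f /\ freq a f /\ qp a 1 f /\ qp a eta f.

Lemma section_Zop a f : section a f -> section a (Zop f).
Proof.
  intros (H1 & H2 & H3 & H4). split; [apply smooth_Zop; auto|split;
    [apply freq_Zop; auto|split; apply qp_Zop; auto]].
Qed.
Lemma section_Zbarop a f : section a f -> section a (Zbarop f).
Proof.
  intros (H1 & H2 & H3 & H4). split; [apply smooth_Zbarop; auto|split;
    [apply freq_Zbarop; auto|split; apply qp_Zbarop; auto]].
Qed.
Lemma section_csum {A} al (l : list A) a b : (forall x, In x l -> section al (b x)) ->
  section al (fun p => csum l (fun x => (a x * b x p)%C)).
Proof.
  intros H. split; [|split; [|split]].
  - apply csum_smooth; intros; apply H; auto.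
  - apply csum_freq; intros; apply H; auto.
  - apply csum_qp; intros; apply H; auto.
  - apply csum_qp; intros; apply H; auto.
Qed.

Definition ground (a : R) (f : Heis -> C) : Prop := section a f /\ forall p, Zbarop f p = 0.

(** The eigenvalue equation of the sub-Laplacian for the eigenvalue (2k+1) a / r, rewritten
    by means of the commutator. *)
Definition level (a : R) (k : nat) (f : Heis -> C) : Prop :=
  section a f /\ forall p, Zop (Zbarop f) p = (RtoC (- (2 * a * INR k)) * f p)%C.

Definition raise (k : nat) (f : Heis -> C) : Heis -> C := Nat.iter k Zop f.

Definition independent {A} (l : list A) (b : A -> Heis -> C) : Prop :=
  forall a : A -> C, (forall p, csum l (fun x => (a x * b x p)%C) = 0) ->
     forall x, In x l -> a x = 0.
Definition spans {A} (l : list A) (b : A -> Heis -> C) (V : (Heis -> C) -> Prop) : Prop :=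
  forall f, V f -> exists a : A -> C, forall p, f p = csum l (fun x => (a x * b x p)%C).

(** Together with f there are M + 1 ground states, but only M Fourier coefficients to tell
    them apart; the resulting dependence must involve f. *)
Lemma ground_spans a M (l : list nat) b : (0 < M)%nat -> a * s3 = PI * INR M ->
  NoDup l -> length l = M -> (forall q, In q l -> ground a (b q)) -> independent l b ->
  spans l b (ground a).
Proof.
  intros HM Ha N L Hb Ind f Hf.
  (* None stands for f. *)
  set (l' := None :: map Some l).
  set (b' := fun o : option nat => match o with None => f | Some q => b q end).
  assert (N' : NoDup l').
  { apply NoDup_cons.
    - intros I. apply in_map_iff in I. destruct I as (x & E & _). discriminate.
    - apply FinFun.Injective_map_NoDup; auto. intros x y E; congruence. }
  assert (eqd : forall x y : option nat, {x = y} + {x <> y}) by (decide equality; apply Nat.eq_dec).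
  assert (Hb' : forall o, In o l' -> ground a (b' o)).
  { intros o [<- |I]; simpl; auto. apply in_map_iff in I. destruct I as (q & <- & I). simpl; auto. }
  destruct (dependence eqd M l' N') with (v := fun o j => coef a (Z.of_nat j) (b' o) 0)
    as (c & (i & Ii & Ci0) & Hc).
  { unfold l'. simpl. rewrite length_map. lia. }
  set (u := fun p => csum l' (fun o => (c o * b' o p)%C)).
  assert (Hu : forall p, u p = 0).
  { assert (Su : section a u) by (apply section_csum; intros; apply Hb'; auto).
    destruct Su as (S1 & S2 & S3 & S4).
    apply (coef_determines a M u); auto.
    - intros p. unfold u. rewrite csum_Zbarop by (intros; apply Hb'; auto).
      apply csum_zero. intros o Ho. destruct (Hb' o Ho) as [_ Z]. rewrite Z. ring.
    - intros j Hj. unfold u. rewrite coef_csum by (intros; apply Hb'; auto). apply Hc; auto. }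
  assert (Eu : forall p, (c None * f p + csum l (fun q => (c (Some q) * b q p)%C))%C = 0).
  { intros p. rewrite <- (Hu p). unfold u, l'. simpl. f_equal. symmetry; apply csum_map. }
  assert (C0 : c None <> 0).
  { intros E. assert (Hz := Ind (fun q => c (Some q))). cbv beta in Hz.
    assert (K : forall x, In x l -> c (Some x) = 0).
    { apply Hz. intros p. rewrite <- (Eu p), E. ring. }
    destruct Ii as [<- |Ii]; auto. apply in_map_iff in Ii. destruct Ii as (q & <- & I). auto. }
  exists (fun q => (- (c (Some q) / c None))%C). intros p.
  transitivity (- (/ c None) * csum l (fun q => (c (Some q) * b q p)%C))%C.
  - replace (csum l (fun q => (c (Some q) * b q p)%C)) with (- (c None * f p))%C.
    + field; auto.
    + specialize (Eu p). rewrite <- (Cplus_0_r (- _)%C), <- Eu. ring.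
  - rewrite <- csum_scal. apply csum_ext. intros; unfold Cdiv; ring.
Qed.

Lemma raise_section a k f : section a f -> section a (raise k f).
Proof. intros H; induction k; simpl; auto. apply section_Zop; auto. Qed.

(** Zbar annihilates f, and moving it past one factor Z costs -2a by the commutator. *)
Lemma Zbarop_raise a k f p : ground a f ->
  Zbarop (raise (S k) f) p = (RtoC (- (2 * a * INR (S k))) * raise k f p)%C.
Proof.
  intros [Hs Hz].
  revert p; induction k as [|k IH]; intros p.
  - assert (K := freq_commutator a f p (proj1 Hs) (proj1 (proj2 Hs))).
    assert (E : Zop (Zbarop f) p = 0).
    { replace (Zbarop f) with (fun _ : Heis => RtoC 0) by (apply functional_extensionality; auto).
      rewrite (Zop_grad _ _ _ _ _ (grad_const 0 p)). unfold Cdiv; ring. }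
    rewrite E in K. simpl.
    replace (Zbarop (Zop f) p) with (- (RtoC (2 * a) * f p))%C.
    + rewrite !RtoC_opp, Rmult_1_r. ring.
    + rewrite <- (Cplus_0_r (- _)%C), K. ring.
  - set (g := raise (S k) f) in *.
    assert (Sg : section a g) by (apply raise_section; auto).
    assert (K := freq_commutator a g p (proj1 Sg) (proj1 (proj2 Sg))).
    assert (E : Zop (Zbarop g) p = (RtoC (- (2 * a * INR (S k))) * g p)%C).
    { replace (Zbarop g) with (fun p => (RtoC (- (2 * a * INR (S k))) * raise k f p)%C)
        by (apply functional_extensionality; intros; symmetry; apply IH).
      rewrite Zop_scal by (apply (raise_section a k f); auto). reflexivity. }
    rewrite E in K. change (raise (S (S k)) f) with (Zop g).
    replace (Zbarop (Zop g) p) with (RtoC (- (2 * a * INR (S k))) * g p - RtoC (2 * a) * g p)%C.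
    + rewrite (S_INR (S k)). rewrite !RtoC_opp, !RtoC_mult, RtoC_plus. ring.
    + rewrite K. ring.
Qed.

Lemma raise_level a k f : ground a f -> level a k (raise k f).
Proof.
  intros H. split; [apply raise_section, H|]. intros p. destruct k as [|k].
  - simpl. replace (Zbarop f) with (fun _ : Heis => RtoC 0)
      by (apply functional_extensionality; symmetry; apply H).
    rewrite (Zop_grad _ _ _ _ _ (grad_const 0 p)). rewrite Rmult_0_r, RtoC_opp. unfold Cdiv; ring.
  - replace (Zbarop (raise (S k) f)) with (fun p => (RtoC (- (2 * a * INR (S k))) * raise k f p)%C)
      by (apply functional_extensionality; intros; symmetry; apply Zbarop_raise; auto).
    rewrite Zop_scal by (apply (raise_section a k f), H). reflexivity.
Qed.

(** Zbar undoes one application of Z up to a nonzero scalar, so a relation on one level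
    descends to the level below. *)
Lemma raise_independent a k (l : list nat) b : 0 < a -> (forall q, In q l -> ground a (b q)) ->
  independent l b -> independent l (fun q => raise k (b q)).
Proof.
  intros Ha Hb Ind. induction k as [|k IH]; auto.
  intros c Hc. apply IH. intros p.
  assert (E : Zbarop (fun p => csum l (fun x => (c x * raise (S k) (b x) p)%C)) p = 0).
  { replace (fun p => csum l (fun x => (c x * raise (S k) (b x) p)%C)) with (fun _ : Heis => RtoC 0)
      by (apply functional_extensionality; intros; symmetry; apply Hc).
    rewrite (Zbarop_grad _ _ _ _ _ (grad_const 0 p)). unfold Cdiv; ring. }
  rewrite (csum_Zbarop l c (fun x => raise (S k) (b x))) in E
    by (intros x Hx; apply (raise_section a (S k)), Hb; auto).
  rewrite (csum_ext _ _ (fun x => (RtoC (- (2 * a * INR (S k))) * (c x * raise k (b x) p))%C)) in E.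
  2:{ intros x Hx. rewrite (Zbarop_raise a) by auto. ring. }
  rewrite csum_scal in E.
  assert (Nz : RtoC (- (2 * a * INR (S k))) <> 0).
  { intros Z. apply RtoC_inj in Z. pose proof (lt_0_INR (S k) ltac:(lia)). nra. }
  destruct (Ceq_dec (csum l (fun x => (c x * raise k (b x) p)%C)) (RtoC 0)) as [|Z]; auto.
  exfalso. exact (Cmult_neq_0 _ _ Nz Z E).
Qed.

(** Zbar maps level k + 1 to level k, and f is recovered from g = Zbar f because Z g is a
    nonzero multiple of f. On level 0 the function Zbar f is annihilated by Z, hence zero. *)
Lemma level_spans a M k (l : list nat) b : 0 < a -> (0 < M)%nat -> a * s3 = PI * INR M ->
  NoDup l -> length l = M -> (forall q, In q l -> ground a (b q)) -> independent l b ->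
  spans l (fun q => raise k (b q)) (level a k).
Proof.
  intros Ha HM HaM N L Hb Ind. induction k as [|k IH]; intros f [Hs Hf].
  - apply (ground_spans a M l b); auto. split; auto.
    destruct (section_Zbarop a f Hs) as (S1 & S2 & S3 & S4).
    apply (Zop_kernel_zero a); auto. intros p. rewrite Hf, Rmult_0_r, RtoC_opp. ring.
  - set (g := Zbarop f). assert (Hg : section a g) by (apply section_Zbarop; auto).
    assert (Lg : level a k g).
    { split; auto. intros p.
      assert (K := freq_commutator a g p (proj1 Hg) (proj1 (proj2 Hg))). rewrite K.
      replace (Zop g) with (fun p => (RtoC (- (2 * a * INR (S k))) * f p)%C)
        by (apply functional_extensionality; intros; symmetry; apply Hf).
      rewrite Zbarop_scal by apply Hs. fold g. rewrite S_INR. rewrite !RtoC_opp, !RtoC_mult,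
        RtoC_plus. ring. }
    destruct (IH g Lg) as [c Hc].
    assert (Nz : RtoC (- (2 * a * INR (S k))) <> 0).
    { intros Z. apply RtoC_inj in Z. pose proof (lt_0_INR (S k) ltac:(lia)). nra. }
    exists (fun q => (/ RtoC (- (2 * a * INR (S k))) * c q)%C). intros p.
    transitivity (/ RtoC (- (2 * a * INR (S k))) * Zop g p)%C.
    + rewrite Hf. field. exact Nz.
    + replace g with (fun p => csum l (fun x => (c x * raise k (b x) p)%C))
        by (apply functional_extensionality; intros; symmetry; apply Hc).
      rewrite (csum_Zop l c (fun x => raise k (b x))) by (intros x Hx;
        apply (raise_section a k), Hb; auto).
      rewrite <- csum_scal. apply csum_ext. intros; simpl; ring.
Qed.

(** * Rotation covariance *)

Lemma chain_2d (f : R -> R -> R) (fx fy : R -> R -> R) (u v : R -> R) s lu lv :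
  (forall x y, is_derive (fun x => f x y) x (fx x y)) ->
  (forall x y, is_derive (fun y => f x y) y (fy x y)) ->
  (forall x y, continuity_2d_pt fx x y) ->
  is_derive u s lu -> is_derive v s lv ->
  is_derive (fun s => f (u s) (v s)) s (fx (u s) (v s) * lu + fy (u s) (v s) * lv).
Proof.
  intros Hx Hy Hc Hu Hv. apply is_derive_Reals. apply derivable_pt_lim_comp_2d.
  - apply filterdiff_differentiable_pt_lim.
    eapply filterdiff_ext_lin.
    + apply (is_derive_filterdiff f (u s) (v s) fx (fy (u s) (v s))).
      * exists (mkposreal 1 Rlt_0_1). intros [a b] _. apply Hx.
      * apply Hy.
      * apply continuity_2d_pt_filterlim, Hc.
    + intros [a b]. reflexivity.
  - apply is_derive_Reals; auto.
  - apply is_derive_Reals; auto.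
Qed.

Lemma chain_2d_C (f : Heis -> C) t (u v : R -> R) s lu lv : smooth f ->
  is_derive u s lu -> is_derive v s lv ->
  is_Cd (fun s => f ((u s, v s), t)) s
    (d_x f ((u s, v s), t) * lu + d_y f ((u s, v s), t) * lv)%C.
Proof.
  intros Hs Hu Hv.
  destruct (smooth_grad f Hs) as (_ & Hx & Hy & _ & G).
  assert (Cx := fun a b => contH_2d _ (Hx 0%nat) t a b).
  assert (Gx : forall a b, is_Cd (fun a => f ((a, b), t)) a (d_x f ((a, b), t)))
    by (intros a b; destruct (G ((a, b), t)) as (A & _ & _); exact A).
  assert (Gy : forall a b, is_Cd (fun b => f ((a, b), t)) b (d_y f ((a, b), t)))
    by (intros a b; destruct (G ((a, b), t)) as (_ & A & _); exact A).
  assert (R1 := chain_2d (fun a b => Re (f ((a, b), t))) (fun a b => Re (d_x f ((a, b), t)))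
    (fun a b => Re (d_y f ((a, b), t))) u v s lu lv (fun a b => proj1 (Gx a b))
      (fun a b => proj1 (Gy a b))
    (fun a b => proj1 (Cx a b)) Hu Hv).
  assert (R2 := chain_2d (fun a b => Im (f ((a, b), t))) (fun a b => Im (d_x f ((a, b), t)))
    (fun a b => Im (d_y f ((a, b), t))) u v s lu lv (fun a b => proj2 (Gx a b))
      (fun a b => proj2 (Gy a b))
    (fun a b => proj2 (Cx a b)) Hu Hv).
  split.
  - eapply is_derive_val; [exact R1|]. unfold Re; simpl; ring.
  - eapply is_derive_val; [exact R2|]. unfold Re, Im; simpl; ring.
Qed.

Definition rot (f : Heis -> C) (p : Heis) : C := f ((eta * fst p)%C, snd p).

Lemma rot_dx f p : smooth f -> d_x (rot f) p =
  (d_x f ((eta * fst p)%C, snd p)%R * RtoC (1 / 2) + d_y f ((eta * fst p)%C, snd p)%R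
    * RtoC (s3 / 2))%C.
Proof.
  intros Hs. destruct p as [[x y] t]. apply has_dx_eq. unfold has_dx. cbn [fst snd Re Im].
  assert (E : forall s, (eta * (s, y))%C = (1 / 2 * s - s3 / 2 * y, s3 / 2 * s + 1 / 2 * y))
    by (intros s; rewrite eta_eq; re_im).
  apply is_Cd_ext with (fun s => f ((1 / 2 * s - s3 / 2 * y, s3 / 2 * s + 1 / 2 * y), t)).
  { intros s. unfold slice_x, rot. cbn [fst snd Re Im]. unfold Im;
    cbn [snd]. rewrite E. reflexivity. }
  unfold Re; cbn [fst]. rewrite E.
  apply (chain_2d_C f t (fun s => 1 / 2 * s - s3 / 2 * y) (fun s => s3 / 2 * s + 1 / 2 * y)); auto.
  - auto_derive; auto. ring.
  - auto_derive; auto. ring.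
Qed.

Lemma rot_dy f p : smooth f -> d_y (rot f) p =
  (d_x f ((eta * fst p)%C, snd p)%R * RtoC (- (s3 / 2)) + d_y f ((eta * fst p)%C, snd p)%R
    * RtoC (1 / 2))%C.
Proof.
  intros Hs. destruct p as [[x y] t]. apply has_dy_eq. unfold has_dy. cbn [fst snd Re Im].
  assert (E : forall s, (eta * (x, s))%C = (1 / 2 * x - s3 / 2 * s, s3 / 2 * x + 1 / 2 * s))
    by (intros s; rewrite eta_eq; re_im).
  apply is_Cd_ext with (fun s => f ((1 / 2 * x - s3 / 2 * s, s3 / 2 * x + 1 / 2 * s), t)).
  { intros s. unfold slice_y, rot. cbn [fst snd Re Im]. unfold Re;
    cbn [fst]. rewrite E. reflexivity. }
  unfold Im; cbn [snd fst]. rewrite E.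
  apply (chain_2d_C f t (fun s => 1 / 2 * x - s3 / 2 * s) (fun s => s3 / 2 * x + 1 / 2 * s)); auto.
  - auto_derive; auto. ring.
  - auto_derive; auto. ring.
Qed.

Lemma eta_conj : (eta * Cconj eta)%C = 1.
Proof. rewrite <- Cmod2_conj, Cmod_eta. re_im. Qed.

Lemma eta_cis : eta = cis (PI / 3).
Proof. rewrite cis_cs. reflexivity. Qed.

Lemma eta_alg : eta = (RtoC (1 / 2) + Ci * RtoC (s3 / 2))%C.
Proof. rewrite eta_eq. re_im. Qed.

(** The rotation by eta takes the vector field Z to a multiple of itself. *)
Lemma Zop_rot a f p : smooth f -> freq a f -> freq a (rot f) ->
  Zop (rot f) p = (eta * Zop f ((eta * fst p)%C, snd p)%R)%C.
Proof.
  intros Hs Ht Ht'. rewrite (freq_Zop_eq a (rot f) p Ht'), (freq_Zop_eq a f _ Ht), rot_dx,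
    rot_dy by auto.
  unfold rot. cbn [fst snd]. rewrite Cmult_conj.
  set (q := ((eta * fst p)%C, snd p) : Heis).
  replace (eta * ((d_x f q - Ci * d_y f q) / 2 - a * (Cconj eta * Cconj (fst p)) * f q))%C with
   (eta * (d_x f q - Ci * d_y f q) / 2 - eta * Cconj eta * (a * Cconj (fst p)) * f q)%C by
     (unfold Cdiv; ring).
  rewrite eta_conj, Cmult_1_l. f_equal. f_equal.
  rewrite eta_alg, !RtoC_opp.
  pose proof CiCi as I2. ring [I2].
Qed.

Lemma freq_rot a f : freq a f -> freq a (rot f).
Proof. intros H z t. unfold rot; cbn [fst snd]. apply H. Qed.

(** By [Zop_rot] each application of Z contributes a factor eta^-1. *)
Lemma raise_rot a k f lam : section a f ->
  (forall p, rot f p = (lam * f p)%C) ->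
  forall p, rot (raise k f) p = (lam * cis (- (PI * INR k / 3)) * raise k f p)%C.
Proof.
  intros Hs H. induction k as [|k IH]; intros p.
  - cbn [raise Nat.iter nat_rect]. simpl INR. replace (- (PI * 0 / 3)) with 0 by field. rewrite
      cis_0.
    change (raise 0 f) with f. rewrite H. ring.
  - set (g := raise k f) in *. assert (Sg : section a g) by (apply raise_section; auto).
    change (raise (S k) f) with (Zop g).
    assert (E := Zop_rot a g p (proj1 Sg) (proj1 (proj2 Sg)) (freq_rot a g (proj1 (proj2 Sg)))).
    assert (E2 : Zop (rot g) p = (lam * cis (- (PI * INR k / 3)) * Zop g p)%C).
    { replace (rot g) with (fun p => (lam * cis (- (PI * INR k / 3)) * g p)%C)
        by (apply functional_extensionality; intros; symmetry; apply IH).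
      apply Zop_scal, Sg. }
    rewrite E2 in E. unfold rot at 1.
    rewrite S_INR. replace (- (PI * (INR k + 1) / 3)) with (- (PI * INR k / 3) + - (PI / 3)) by
      field.
    rewrite cis_add, Cmult_assoc.
    rewrite <- (Cmult_1_l (Zop g ((eta * fst p)%C, snd p))),
      <- (cis_inv (- (PI / 3)) (PI / 3)) by ring.
    rewrite <- eta_cis, <- Cmult_assoc, <- E. ring.
Qed.

(** * Ground states from entire functions *)

(** Entire functions whose product with the Gaussian exp (- a |z|^2) is quasi-periodic: the
    multiplier for w is exp (2 a conj(w) z + a |w|^2), and 1 and eta have modulus 1. *)
Definition theta_space (a : R) (h : C -> C) : Prop :=
  hol h /\
  (forall z, h (z + 1)%C = (Cexp (RtoC (2 * a) * z + a)%C * h z)%C) /\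
  (forall z, h (z + eta)%C = (Cexp (RtoC (2 * a) * (Cconj eta * z) + a)%C * h z)%C).

Definition gauss (a : R) (h : C -> C) (p : Heis) : C :=
  (cis (a * snd p) * (Cexp (RtoC (- a) * (fst p * Cconj (fst p)))%C * h (fst p)))%C.

Lemma gauss_freq a h : freq a (gauss a h).
Proof.
  intros z t. unfold gauss; cbn [fst snd]. rewrite Rmult_0_r, cis_0, Cmult_1_l. reflexivity.
Qed.

Lemma gauss_smooth a h : hol h -> smooth (gauss a h).
Proof.
  intros H. unfold gauss. apply smooth_mult; [|apply smooth_mult; [|apply smooth_hol; auto]].
  - unfold cis. apply smooth_Cexp, smooth_scal.
    replace (fun p : Heis => RtoC (a * snd p)) with (fun p : Heis => (a * RtoC (snd p))%C)
      by (apply functional_extensionality; intros; rewrite RtoC_mult; auto).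
    apply smooth_scal, smooth_t.
  - apply smooth_Cexp, smooth_scal, smooth_mult; [apply smooth_z|apply smooth_conj, smooth_z].
Qed.

Lemma gauss_Zbarop a h p : hol h -> Zbarop (gauss a h) p = 0.
Proof.
  intros H. rewrite (freq_Zbarop_eq a) by apply gauss_freq.
  destruct (hol_Cder h H) as [_ D].
  assert (G1 : grad (fun p : Heis => cis (a * snd p)) p 0 (RtoC 0) (Ci * a * cis (a * snd p))%C).
  { eapply grad_val; [apply (grad_cis (fun p => a * snd p) p 0 0 a)|..].
    - simpl. auto_derive; auto. - simpl; auto_derive; auto. - simpl; auto_derive; auto. ring.
    - cbv beta; ring. - cbv beta; ring. - reflexivity. }
  assert (G2 := grad_Cexp _ p _ _ _ (grad_mult _ _ p _ _ _ _ _ _ (grad_const (RtoC (- a)) p)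
     (grad_mult _ _ p _ _ _ _ _ _ (grad_z p) (grad_zbar p)))).
  assert (G := grad_mult _ _ p _ _ _ _ _ _ G1
    (grad_mult _ _ p _ _ _ _ _ _ G2 (grad_hol h p _ (D (fst p))))).
  cbv beta in G. apply grad_eq in G. destruct G as (E1 & E2 & _).
  change (d_x (gauss a h) p) with (d_x (fun p =>
    (cis (a * snd p) * (Cexp (RtoC (- a) * (fst p * Cconj (fst p)))%C * h (fst p)))%C) p).
  change (d_y (gauss a h) p) with (d_y (fun p =>
    (cis (a * snd p) * (Cexp (RtoC (- a) * (fst p * Cconj (fst p)))%C * h (fst p)))%C) p).
  rewrite E1, E2. unfold gauss.
  generalize (cis (a * snd p)) (Cexp (RtoC (- a) * (fst p * Cconj (fst p)))%C) (h (fst p))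
    (Cder h (fst p)).
  intros A B h0 h1. rewrite RtoC_opp. pose proof CiCi as I2.
  unfold Cdiv. field_simplify_eq. cbv beta. ring [I2].
Qed.

Lemma gauss_qp a h w : hol h ->
  (forall z, h (z + w)%C = (Cexp (RtoC (2 * a) * (Cconj w * z) + RtoC (a * Cmod w ^ 2))%C * h z)%C)
    ->
  qp a w (gauss a h).
Proof.
  intros Hh H z t. unfold gauss. cbn [fst snd]. rewrite H.
  replace (cis (2 * a * Im (Cconj w * z)%C) *
    (cis (a * t) * (Cexp (RtoC (- a) * (z * Cconj z))%C * h z)))%C
   with (cis (a * t) * (cis (2 * a * Im (Cconj w * z)%C) * Cexp (RtoC (- a) * (z * Cconj z))%C
     * h z))%C by ring.
  f_equal. rewrite Cmult_assoc. f_equal. unfold cis. rewrite <- !Cexp_add. f_equal.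
  rewrite Cmod2_alt. destruct w, z. re_im.
Qed.

Lemma theta_ground a h : theta_space a h -> ground a (gauss a h).
Proof.
  intros (H & H1 & H2). split; [split; [|split; [|split]]|].
  - apply gauss_smooth; auto.
  - apply gauss_freq.
  - apply gauss_qp; auto. intros z. rewrite H1, Cmod_1. f_equal. f_equal.
    f_equal; [f_equal|f_equal; ring]. re_im.
  - apply gauss_qp; auto. intros z. rewrite H2, Cmod_eta. f_equal. f_equal.
    f_equal. f_equal; ring.
  - intros p; apply gauss_Zbarop; auto.
Qed.

Lemma gauss_rot a h lam : (forall z, h (eta * z)%C = (lam * h z)%C) ->
  forall p, rot (gauss a h) p = (lam * gauss a h p)%C.
Proof.
  intros H p. unfold rot, gauss. cbn [fst snd]. rewrite H, Cmult_conj.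
  replace (eta * fst p * (Cconj eta * Cconj (fst p)))%C with
    (eta * Cconj eta * (fst p * Cconj (fst p)))%C by ring.
  rewrite eta_conj, Cmult_1_l. ring.
Qed.

Lemma theta_mult a b g h : theta_space a g -> theta_space b h ->
  theta_space (a + b) (fun z => (g z * h z)%C).
Proof.
  intros (G & G1 & G2) (H & H1 & H2).
  assert (E : forall x, Cexp (RtoC (2 * (a + b)) * x + RtoC (a + b))%C =
    (Cexp (RtoC (2 * a) * x + a)%C * Cexp (RtoC (2 * b) * x + b)%C)%C).
  { intros x. rewrite <- Cexp_add. f_equal. rewrite !RtoC_mult, !RtoC_plus; ring. }
  split; [apply hol_mult; auto|split]; intros z; rewrite E.
  - rewrite G1, H1. ring.
  - rewrite G2, H2. ring.
Qed.

Lemma theta_plus a g h : theta_space a g -> theta_space a h ->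
  theta_space a (fun z => (g z + h z)%C).
Proof.
  intros (G & G1 & G2) (H & H1 & H2). split; [apply hol_plus; auto|split]; intros z.
  - rewrite G1, H1; ring. - rewrite G2, H2; ring.
Qed.

Lemma theta_scal a c h : theta_space a h -> theta_space a (fun z => (c * h z)%C).
Proof.
  intros (H & H1 & H2). split; [apply hol_mult; auto; apply hol_const|split]; intros z.
  - rewrite H1; ring. - rewrite H2; ring.
Qed.

Lemma theta_one : theta_space 0 (fun _ => RtoC 1).
Proof.
  split; [apply hol_const|split]; intros z; rewrite Rmult_0_r, Cmult_0_l, Cplus_0_l, Cexp_0; ring.
Qed.

(** The rotation takes the periods 1 and eta to eta and eta - 1. The multiplier of eta - 1
    obtained from those of eta and 1 differs from the expected one by exp (i a sqrt 3),
    which is 1 because the degree 2M is even. *)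
Lemma theta_rot a M h : a * s3 = PI * INR (2 * M) -> theta_space a h ->
  theta_space a (fun z => h (eta * z)%C).
Proof.
  intros Ha (H & H1 & H2). split; [apply hol_scaled; auto|split]; intros z.
  - rewrite Cmult_plus_distr_l, Cmult_1_r, H2. f_equal. f_equal. f_equal. f_equal.
    rewrite Cmult_assoc, (Cmult_comm (Cconj eta)), eta_conj. ring.
  (* eta (z + eta) = w - 1 because eta^2 = eta - 1. *)
  - set (w := (eta * z + eta)%C).
    assert (E : (w - 1 + 1)%C = w) by ring.
    assert (K := H1 (w - 1)%C). rewrite E in K.
    unfold w at 1 in K. rewrite H2 in K.
    rewrite (Cmult_assoc (Cconj eta)), (Cmult_comm (Cconj eta)), eta_conj, Cmult_1_l in K.
    assert (E2 : (eta * (z + eta))%C = (w - 1)%C).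
    { unfold w. rewrite eta_eq. destruct z. re_im.
      - pose proof s3_sq; lra.
      - field. }
    rewrite E2.
    rewrite <- (Cmult_1_l (h (w - 1)%C)).
    replace (RtoC 1) with (Cexp (- (RtoC (2 * a) * (w - 1) + a))%C
      * Cexp (RtoC (2 * a) * (w - 1) + a)%C)%C at 1.
    2:{ rewrite <- Cexp_add, <- Cexp_0. f_equal. ring. }
    rewrite <- Cmult_assoc, <- K, Cmult_assoc, <- Cexp_add. f_equal.
    replace (Cexp (RtoC (2 * a) * (Cconj eta * z) + a)%C) with
      (cis (2 * PI * IZR (- Z.of_nat M)) * Cexp (RtoC (2 * a) * (Cconj eta * z) + a)%C)%C
      by (rewrite cis_2PI; ring).
    unfold cis. rewrite <- Cexp_add. f_equal.
    rewrite opp_IZR, <- INR_IZR_INZ. rewrite mult_INR in Ha. simpl (INR 2) in Ha.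
    replace (2 * PI * - INR M) with (- (a * s3)) by (rewrite Ha; ring).
    unfold w. rewrite eta_eq. destruct z. re_im; field.
Qed.

(** * Exponential series *)

Definition Cser (a : nat -> C) : C := (Series (fun n => Re (a n)), Series (fun n => Im (a n))).
Definition Cabs (a : nat -> C) : Prop := ex_series (fun n => Cmod (a n)).

Lemma ex_series_dom (a b : nat -> R) : (forall n, Rabs (a n) <= b n) -> ex_series b -> ex_series a.
Proof. intros H; apply (@ex_series_le R_AbsRing R_CompleteNormedModule); exact H. Qed.

Lemma Cabs_Re a : Cabs a -> ex_series (fun n => Re (a n)).
Proof. apply ex_series_dom. intros; apply re_le_Cmod. Qed.
Lemma Cabs_Im a : Cabs a -> ex_series (fun n => Im (a n)).
Proof. apply ex_series_dom. intros; apply im_le_Cmod. Qed.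

Lemma Cabs_dom a (b : nat -> R) : (forall n, Cmod (a n) <= b n) -> ex_series b -> Cabs a.
Proof. intros H; apply ex_series_dom. intros n. rewrite Rabs_pos_eq by apply Cmod_ge_0; auto. Qed.

Lemma Cser_ext a b : (forall n, a n = b n) -> Cser a = Cser b.
Proof. intros E. replace b with a; auto. apply functional_extensionality; auto. Qed.

Lemma Cser_plus a b : Cabs a -> Cabs b -> Cser (fun n => (a n + b n)%C) = (Cser a + Cser b)%C.
Proof.
  intros Ha Hb. apply C_ext.
  - exact (Series_plus _ _ (Cabs_Re a Ha) (Cabs_Re b Hb)).
  - exact (Series_plus _ _ (Cabs_Im a Ha) (Cabs_Im b Hb)).
Qed.

Lemma ex_series_Rscal c (a : nat -> R) : ex_series a -> ex_series (fun n => c * a n).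
Proof. intros [l H]. exists (c * l). exact (is_series_scal c a l H). Qed.

Lemma Cser_scal c a : Cabs a -> Cser (fun n => (c * a n)%C) = (c * Cser a)%C.
Proof.
  intros Ha. pose proof (Cabs_Re a Ha) as A1. pose proof (Cabs_Im a Ha) as A2.
  apply C_ext.
  - change (Series (fun n => Re c * Re (a n) - Im c * Im (a n)) =
      Re c * Series (fun n => Re (a n)) - Im c * Series (fun n => Im (a n))).
    rewrite Series_minus by (apply ex_series_Rscal; auto). rewrite !Series_scal_l. reflexivity.
  - change (Series (fun n => Re c * Im (a n) + Im c * Re (a n)) =
      Re c * Series (fun n => Im (a n)) + Im c * Series (fun n => Re (a n))).
    rewrite Series_plus by (apply ex_series_Rscal; auto). rewrite !Series_scal_l. reflexivity.
Qed.

Lemma Cser_incr_1 a : Cabs a -> Cser a = (a 0%nat + Cser (fun n => a (S n)))%C.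
Proof.
  intros Ha. apply C_ext.
  - exact (Series_incr_1 _ (Cabs_Re a Ha)).
  - exact (Series_incr_1 _ (Cabs_Im a Ha)).
Qed.

Lemma Cabs_S a : Cabs a -> Cabs (fun n => a (S n)).
Proof. intros H. apply (ex_series_incr_1 (fun n => Cmod (a n))). exact H. Qed.

Lemma Cser_Re_bound a : Cabs a -> Rabs (Re (Cser a)) <= Series (fun n => Cmod (a n)).
Proof.
  intros Ha. eapply Rle_trans; [apply Series_Rabs|].
  - eapply ex_series_dom; [|exact Ha]. intros n. rewrite Rabs_Rabsolu. apply re_le_Cmod.
  - apply Series_le; auto. intros n; split; [apply Rabs_pos|apply re_le_Cmod].
Qed.
Lemma Cser_Im_bound a : Cabs a -> Rabs (Im (Cser a)) <= Series (fun n => Cmod (a n)).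
Proof.
  intros Ha. eapply Rle_trans; [apply Series_Rabs|].
  - eapply ex_series_dom; [|exact Ha]. intros n. rewrite Rabs_Rabsolu. apply im_le_Cmod.
  - apply Series_le; auto. intros n; split; [apply Rabs_pos|apply im_le_Cmod].
Qed.
Lemma Cser_bound a : Cabs a -> Cmod (Cser a) <= 2 * Series (fun n => Cmod (a n)).
Proof.
  intros Ha. eapply Rle_trans; [apply Cmod_le_sum|].
  pose proof (Cser_Re_bound a Ha). pose proof (Cser_Im_bound a Ha). lra.
Qed.

(** Faster than any exponential in the rates k n, so that the series below converges
    together with all its derivatives. *)
Definition decays (k : nat -> C) (a : nat -> C) : Prop :=
  forall R0, 0 <= R0 -> ex_series (fun n => Cmod (a n) * exp (R0 * Cmod (k n))).
Definition expser (k a : nat -> C) (z : C) : C := Cser (fun n => (a n * Cexp (k n * z)%C)%C).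

Lemma Cmod_Cexp_le z : Cmod (Cexp z) <= exp (Cmod z).
Proof.
  rewrite Cmod_Cexp. apply exp_le_mono. eapply Rle_trans; [apply Rle_abs|apply re_le_Cmod].
Qed.

Lemma expser_abs k a z : decays k a -> Cabs (fun n => (a n * Cexp (k n * z)%C)%C).
Proof.
  intros H. eapply Cabs_dom; [|apply (H (Cmod z) (Cmod_ge_0 z))].
  intros n. cbv beta. rewrite Cmod_mult. apply Rmult_le_compat_l; [apply Cmod_ge_0|].
  eapply Rle_trans; [apply Cmod_Cexp_le|]. rewrite Cmod_mult, Rmult_comm. lra.
Qed.

Lemma exp_Rpow x n : exp x ^ n = exp (x * INR n).
Proof.
  induction n as [|n IH]; [simpl; rewrite Rmult_0_r, exp_0; auto|].
  rewrite S_INR, Rmult_plus_distr_l, Rmult_1_r, exp_plus, <- IH. simpl; ring.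
Qed.

Lemma le_exp x : x <= exp x.
Proof.
  destruct (Req_dec x 0) as [->|E]; [rewrite exp_0; lra|].
  pose proof (exp_ineq1 x E); lra.
Qed.

Lemma decays_deriv k a : decays k a -> decays k (fun n => (a n * k n)%C).
Proof.
  intros H R0 HR. eapply ex_series_dom; [|apply (H (R0 + 1)); lra].
  intros n. cbv beta. rewrite Cmod_mult, Rabs_pos_eq.
  - rewrite Rmult_assoc. apply Rmult_le_compat_l; [apply Cmod_ge_0|].
    rewrite Rmult_plus_distr_r, Rmult_1_l, exp_plus, Rmult_comm.
    apply Rmult_le_compat_l; [left; apply exp_pos|apply le_exp].
  - repeat apply Rmult_le_pos; try apply Cmod_ge_0. left; apply exp_pos.
Qed.

(** Termwise second order Taylor estimate by [Cexp_taylor]; the quadratic factor and the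
    exponential are absorbed by three more units of exponential growth, which the
    coefficients can afford. *)
Lemma expser_deriv k a z : decays k a -> is_CC (expser k a) z (expser k (fun n => (a n * k n)%C) z).
Proof.
  intros H.
  set (B := fun n => Cmod (a n) * exp ((Cmod z + 3) * Cmod (k n))).
  assert (HB : ex_series B) by (apply H; pose proof (Cmod_ge_0 z); lra).
  assert (Bpos : forall n, 0 <= B n).
  { intros n; apply Rmult_le_pos; [apply Cmod_ge_0|left; apply exp_pos]. }
  apply is_CC_quadratic with (4 * Series B).
  { apply Rmult_le_pos; [lra|]. rewrite <- (Rmult_0_l (Series B)), <- Series_scal_l.
    apply Series_le; auto. intros n; rewrite Rmult_0_l; split; [lra|auto]. }
  intros w Hw.
  assert (A1 := expser_abs k a (z + w)%C H). assert (A2 := expser_abs k a z H).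
  assert (A3 := expser_abs k _ z (decays_deriv k a H)). cbv beta in A3.
  assert (E : (expser k a (z + w)%C - expser k a z - expser k (fun n => (a n * k n)%C) z * w)%C =
    Cser (fun n => (a n * Cexp (k n * z)%C * (Cexp (k n * w)%C - 1 - k n * w))%C)).
  { transitivity (expser k a (z + w)%C + (- RtoC 1 * expser k a z + - w
    * expser k (fun n => (a n * k n)%C) z))%C; [ring|].
    unfold expser. rewrite <- !Cser_scal by auto.
    assert (S2 : Cabs (fun n => (- RtoC 1 * (a n * Cexp (k n * z)%C))%C)).
    { eapply Cabs_dom; [|exact A2]. intros n. rewrite (Cmod_mult (- RtoC 1)%C), Cmod_m1. lra. }
    assert (S3 : Cabs (fun n => (- w * (a n * k n * Cexp (k n * z)%C))%C)).
    { eapply Cabs_dom; [|apply ex_series_Rscal; exact A3]. intros n. rewrite (Cmod_mult (- w)%C).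
      apply Rle_refl. }
    rewrite <- (Cser_plus _ _ S2 S3).
    rewrite <- (Cser_plus (fun n => (a n * Cexp (k n * (z + w))%C)%C)); auto.
    - apply Cser_ext. intros n. rewrite Cmult_plus_distr_l, Cexp_add. ring.
    - eapply Cabs_dom; [intros n; apply Cmod_triangle|].
      destruct S2 as [l2 S2], S3 as [l3 S3]. exists (plus l2 l3). apply
        (is_series_plus _ _ _ _ S2 S3). }
  rewrite E.
  assert (Bd : forall n, Cmod (a n * Cexp (k n * z)%C * (Cexp (k n * w)%C - 1 - k n * w))%C <= 2
    * Cmod w ^ 2 * B n).
  { intros n. rewrite !Cmod_mult. unfold B.
    replace (2 * Cmod w ^ 2 * (Cmod (a n) * exp ((Cmod z + 3) * Cmod (k n)))) with
      (Cmod (a n) * (exp (Cmod z * Cmod (k n))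
        * (2 * Cmod w ^ 2 * (exp (2 * Cmod (k n)) * exp (Cmod (k n)))))).
    2:{ rewrite <- exp_plus. replace ((Cmod z + 3) * Cmod (k n)) with
      (Cmod z * Cmod (k n) + (2 * Cmod (k n) + Cmod (k n))) by ring.
        rewrite (exp_plus (Cmod z * Cmod (k n))). ring. }
    rewrite Rmult_assoc. apply Rmult_le_compat_l; [apply Cmod_ge_0|].
    apply Rmult_le_compat; try apply Cmod_ge_0.
    - eapply Rle_trans; [apply Cmod_Cexp_le|]. rewrite Cmod_mult, Rmult_comm. lra.
    - eapply Rle_trans; [apply Cexp_taylor|]. rewrite Cmod_mult, Rpow_mult_distr.
      replace (2 * Cmod w ^ 2 * (exp (2 * Cmod (k n)) * exp (Cmod (k n)))) with
        (2 * (exp (2 * Cmod (k n)) * Cmod w ^ 2 * exp (Cmod (k n)))) by ring.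
      apply Rmult_le_compat_l; [lra|].
      pose proof (Cmod_ge_0 (k n)). pose proof (Cmod_ge_0 w).
      apply Rmult_le_compat; [| |apply Rmult_le_compat_r|].
      + apply Rmult_le_pos; apply pow2_ge_0.
      + left; apply exp_pos.
      + apply pow2_ge_0.
      + replace (2 * Cmod (k n)) with (Cmod (k n) + Cmod (k n)) by ring. rewrite exp_plus.
        pose proof (le_exp (Cmod (k n))). simpl. nra.
      + apply exp_le_mono. nra. }
  eapply Rle_trans; [apply Cser_bound|].
  - eapply Cabs_dom; [exact Bd|]. apply ex_series_Rscal; auto.
  - replace (4 * Series B * Cmod w ^ 2) with (2 * Series (fun n => 2 * Cmod w ^ 2 * B n)) by
      (rewrite Series_scal_l; ring).
    apply Rmult_le_compat_l; [lra|]. apply Series_le.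
    + intros n; split; [apply Cmod_ge_0|apply Bd].
    + apply ex_series_Rscal; auto.
Qed.

Lemma geom_tail r K : 0 <= r < 1 -> ex_series (fun n => K * r ^ S n) /\
  Series (fun n => K * r ^ S n) = K * (r / (1 - r)).
Proof.
  intros Hr. assert (Ha : Rabs r < 1) by (rewrite Rabs_pos_eq; lra).
  split.
  - apply ex_series_Rscal. apply (ex_series_Rscal r (fun n => r ^ n)), ex_series_geom; auto.
  - rewrite Series_scal_l. f_equal.
    rewrite (Series_ext _ (fun n => r * r ^ n)) by reflexivity.
    rewrite Series_scal_l, Series_geom by auto. reflexivity.
Qed.

Lemma Cser_tail_Re a r K : 0 <= r < 1 -> (forall n, Cmod (a n) <= K * r ^ S n) ->
  Cabs a /\ - (K * (r / (1 - r))) <= Re (Cser a).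
Proof.
  intros Hr H. destruct (geom_tail r K Hr) as [G1 G2].
  assert (Ca : Cabs a) by (eapply Cabs_dom; [exact H|exact G1]).
  split; auto. rewrite <- G2.
  pose proof (Cser_Re_bound a Ca) as Hb. apply Rabs_le_between in Hb.
  assert (Series (fun n => Cmod (a n)) <= Series (fun n => K * r ^ S n)).
  { apply Series_le; auto. intros n; split; [apply Cmod_ge_0|auto]. }
  lra.
Qed.

(** * Theta series *)

(** The theta series with weight w is the sum of w(s) amp(s) exp (rate(s) z) over s in sg +
    Z. Differentiation multiplies the weight by the rate, so all derivatives have the same
    form. *)
Definition rate (M s : R) : C := (RtoC (2 * PI) * Ci * RtoC (M * s))%C.
Definition amp (M s : R) : C := Cexp (PI * Ci * eta * RtoC (M * s * s))%C.

(** The index set sg + Z is cut into sg + n and sg - 1 - n with n a natural number. *)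
Definition theta_pos (M sg : R) (w : R -> C) : C -> C :=
  expser (fun n => rate M (INR n + sg)) (fun n => (w (INR n + sg)%R * amp M (INR n + sg))%C).
Definition theta_neg (M sg : R) (w : R -> C) : C -> C :=
  expser (fun n => rate M (sg - 1 - INR n)) (fun n =>
    (w (sg - 1 - INR n)%R * amp M (sg - 1 - INR n))%C).
Definition theta M sg w (z : C) : C := (theta_pos M sg w z + theta_neg M sg w z)%C.

Definition tempered (w : R -> C) : Prop :=
  exists A D, 0 <= A /\ 0 <= D /\ forall s, Cmod (w s) <= A * exp (D * Rabs s).

Lemma Cmod_amp M s : Cmod (amp M s) = exp (- (PI * s3 / 2 * M * (s * s))).
Proof.
  unfold amp. rewrite Cmod_Cexp, eta_eq. f_equal. unfold Re; simpl. field.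
Qed.

Lemma Cmod_rate M s : 0 <= M -> Cmod (rate M s) = 2 * PI * M * Rabs s.
Proof.
  intros HM. unfold rate. pose proof PI_RGT_0.
  rewrite !Cmod_mult, Cmod_Ci, !Cmod_R, (Rabs_mult M s), (Rabs_pos_eq M),
    (Rabs_pos_eq (2 * PI)) by lra. ring.
Qed.

(** The amplitude is a Gaussian in s, and the other factors are at most exponential. *)
Lemma gaussian_decays M (s : nat -> R) w : 0 < M -> tempered w ->
  (forall n, INR n - 1 <= Rabs (s n)) ->
  decays (fun n => rate M (s n)) (fun n => (w (s n) * amp M (s n))%C).
Proof.
  intros HM (A & D & HA & HD & Hw) Hs R0 HR.
  pose proof PI_RGT_0 as HPI. pose proof s3_pos as HS.
  set (b := PI * s3 / 2 * M). assert (Hb : 0 < b).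
  { unfold b. assert (0 < PI * s3) by (apply Rmult_lt_0_compat; lra). apply Rmult_lt_0_compat;
    lra. }
  (* Complete the square in - b x^2 + Q x; the summand 1 in Q pays for the geometric factor. *)
  set (Q := D + R0 * (2 * PI * M) + 1).
  assert (HQ : 0 < Q). { unfold Q. assert (0 <= R0 * (2 * PI * M)) by (apply Rmult_le_pos;
    [auto|apply Rmult_le_pos; lra]). lra. }
  assert (G : ex_series (fun n => A * exp (Q * Q / (4 * b) + 1) * exp (- 1) ^ n)).
  { apply ex_series_Rscal, ex_series_geom. rewrite Rabs_pos_eq by (left; apply exp_pos).
    rewrite <- exp_0. apply exp_increasing; lra. }
  eapply ex_series_dom; [|exact G].
  intros n. rewrite Cmod_mult, Cmod_amp, Cmod_rate by lra.
  rewrite Rabs_pos_eq by (repeat apply Rmult_le_pos; try apply Cmod_ge_0; left; apply exp_pos).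
  fold b.
  set (x := Rabs (s n)). assert (Hx : 0 <= x) by apply Rabs_pos.
  assert (Hxx : s n * s n = x * x). { unfold x. rewrite <- Rabs_mult, Rabs_pos_eq; nra. }
  rewrite Hxx.
  apply Rle_trans with (A * exp (D * x) * exp (- (b * (x * x))) * exp (R0 * (2 * PI * M * x))).
  - repeat apply Rmult_le_compat_r; try (left; apply exp_pos). apply Hw.
  - rewrite !Rmult_assoc, <- !exp_plus. rewrite exp_Rpow. rewrite <- exp_plus.
    apply Rmult_le_compat_l; auto. apply exp_le_mono.
    assert (INR n - 1 <= x) by apply Hs.
    assert (Sq : 0 <= b * (x - Q / (2 * b)) * (x - Q / (2 * b))).
    { rewrite Rmult_assoc. apply Rmult_le_pos; [lra|]. apply Rle_0_sqr. }
    replace (b * (x - Q / (2 * b)) * (x - Q / (2 * b))) with (b * (x * x) - Q * x + Q * Q / (4 * b))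
      in Sq by (field; lra).
    unfold Q in *. nra.
Qed.

Lemma theta_pos_decays M sg w : 0 < M -> 0 <= sg <= 1 -> tempered w ->
  decays (fun n => rate M (INR n + sg)) (fun n => (w (INR n + sg)%R * amp M (INR n + sg))%C).
Proof.
  intros HM Hs Hw. apply (gaussian_decays M (fun n => INR n + sg) w); auto.
  intros n. pose proof (pos_INR n). rewrite Rabs_pos_eq; lra.
Qed.
Lemma theta_neg_decays M sg w : 0 < M -> 0 <= sg <= 1 -> tempered w ->
  decays (fun n => rate M (sg - 1 - INR n)) (fun n =>
    (w (sg - 1 - INR n)%R * amp M (sg - 1 - INR n))%C).
Proof.
  intros HM Hs Hw. apply (gaussian_decays M (fun n => sg - 1 - INR n) w); auto.
  intros n. pose proof (pos_INR n). rewrite Rabs_left1; lra.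
Qed.

Lemma tempered_const c : tempered (fun _ => c).
Proof.
  exists (Cmod c), 0. split; [apply Cmod_ge_0|split; [lra|]]. intros s. rewrite Rmult_0_l, exp_0;
    lra.
Qed.

Lemma tempered_rate M w : 0 < M -> tempered w -> tempered (fun s => (w s * rate M s)%C).
Proof.
  intros HM (A & D & HA & HD & H). pose proof PI_RGT_0.
  exists (A * (2 * PI * M)), (D + 1).
  assert (HPM : 0 <= 2 * PI * M) by (apply Rmult_le_pos; lra).
  split; [apply Rmult_le_pos; auto|split; [lra|]]. intros s. rewrite Cmod_mult, Cmod_rate by lra.
  rewrite Rmult_plus_distr_r, Rmult_1_l, exp_plus.
  replace (A * (2 * PI * M) * (exp (D * Rabs s) * exp (Rabs s))) with
    (A * exp (D * Rabs s) * (2 * PI * M * exp (Rabs s))) by ring.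
  apply Rmult_le_compat; auto.
  - apply Cmod_ge_0. - apply Rmult_le_pos; auto using Rabs_pos.
  - apply Rmult_le_compat_l; auto. apply le_exp.
Qed.

Lemma tempered_scal c w : tempered w -> tempered (fun s => (c * w s)%C).
Proof.
  intros (A & D & HA & HD & H). exists (Cmod c * A), D. pose proof (Cmod_ge_0 c).
  split; [apply Rmult_le_pos; auto|split; auto]. intros s. rewrite Cmod_mult, Rmult_assoc.
  apply Rmult_le_compat_l; auto.
Qed.

Lemma theta_deriv M sg w z : 0 < M -> 0 <= sg <= 1 -> tempered w ->
  is_CC (theta M sg w) z (theta M sg (fun s => (w s * rate M s)%C) z).
Proof.
  intros HM Hs Hw. apply is_CC_plus.
  - eapply is_CC_val; [apply expser_deriv, theta_pos_decays; auto|].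
    unfold theta_pos, expser. apply Cser_ext; intros n. ring.
  - eapply is_CC_val; [apply expser_deriv, theta_neg_decays; auto|].
    unfold theta_neg, expser. apply Cser_ext; intros n. ring.
Qed.

Lemma theta_hol M sg w : 0 < M -> 0 <= sg <= 1 -> tempered w -> hol (theta M sg w).
Proof.
  intros HM Hs Hw. exists (fun g => exists v, tempered v /\ g = theta M sg v). split; [eauto|].
  intros g (v & Hv & ->). exists (theta M sg (fun s => (v s * rate M s)%C)). split.
  - eexists; split; [|reflexivity]. apply tempered_rate; auto.
  - intros z; apply theta_deriv; auto.
Qed.

Lemma theta_lin M sg c v w z : 0 < M -> 0 <= sg <= 1 -> tempered v -> tempered w ->
  theta M sg (fun s => (c * v s + w s)%C) z = (c * theta M sg v z + theta M sg w z)%C.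
Proof.
  intros HM Hs Hv Hw. unfold theta.
  assert (L : forall k a b, decays k a -> decays k b ->
    Cser (fun n => ((c * a n + b n) * Cexp (k n * z)%C)%C) =
    (c * expser k a z + expser k b z)%C).
  { intros k a b Ha Hb. assert (A1 := expser_abs k a z Ha). assert (A2 := expser_abs k b z Hb).
    unfold expser. rewrite <- Cser_scal by auto. rewrite <- Cser_plus; auto.
    - apply Cser_ext; intros; ring.
    - eapply Cabs_dom; [|apply ex_series_Rscal; exact A1]. intros n. rewrite (Cmod_mult c). apply
        Rle_refl. }
  assert (E1 := L _ _ _ (theta_pos_decays M sg v HM Hs Hv) (theta_pos_decays M sg w HM Hs Hw)).
  assert (E2 := L _ _ _ (theta_neg_decays M sg v HM Hs Hv) (theta_neg_decays M sg w HM Hs Hw)).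
  fold (theta_pos M sg v z) (theta_pos M sg w z) in E1. fold (theta_neg M sg v z)
    (theta_neg M sg w z) in E2.
  replace (c * (theta_pos M sg v z + theta_neg M sg v z)
    + (theta_pos M sg w z + theta_neg M sg w z))%C with
   (c * theta_pos M sg v z + theta_pos M sg w z + (c * theta_neg M sg v z + theta_neg M sg w z))%C
     by ring.
  rewrite <- E1, <- E2. f_equal; apply Cser_ext; intros n; cbv beta; ring.
Qed.

Definition unit_weight : R -> C := fun _ => RtoC 1.

Lemma theta_period M sg (m j : nat) z : M = INR m -> M * sg = INR j ->
  theta M sg unit_weight (z + 1)%C = theta M sg unit_weight z.
Proof.
  intros Em Ej.
  assert (P : forall s (q : Z), M * s = IZR q -> Cexp (rate M s * (z + 1))%C
    = Cexp (rate M s * z)%C).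
  { intros s q E. rewrite Cmult_plus_distr_l, Cexp_add, Cmult_1_r.
    replace (Cexp (rate M s)) with (RtoC 1); [ring|]. rewrite <- (cis_2PI q).
    unfold rate, cis. f_equal. rewrite E, !RtoC_mult. ring. }
  unfold theta, theta_pos, theta_neg, expser. f_equal; apply Cser_ext; intros n; f_equal.
  - apply (P _ (Z.of_nat m * Z.of_nat n + Z.of_nat j)%Z).
    rewrite Rmult_plus_distr_l, Ej, Em, plus_IZR, mult_IZR, <- !INR_IZR_INZ. reflexivity.
  - apply (P _ (Z.of_nat j - Z.of_nat m - Z.of_nat m * Z.of_nat n)%Z).
    rewrite !minus_IZR, mult_IZR, <- !INR_IZR_INZ, <- Em, <- Ej. ring.
Qed.

(** Translating by eta amounts to replacing s by s + 1 in the general term. The shift of the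
    summation index moves the term s = sg from one half of the series to the other. *)
Lemma theta_quasi M sg z : 0 < M -> 0 <= sg <= 1 ->
  theta M sg unit_weight (z + eta)%C =
  (Cexp (RtoC (- PI * M) * Ci * (eta + 2 * z))%C * theta M sg unit_weight z)%C.
Proof.
  intros HM Hs.
  set (Cz := Cexp (RtoC (- PI * M) * Ci * (eta + 2 * z))%C).
  set (term := fun s => (unit_weight s * amp M s * Cexp (rate M s * z)%C)%C).
  assert (St : forall s, (unit_weight s * amp M s * Cexp (rate M s * (z + eta))%C)%C
    = (Cz * term (s + 1)%R)%C).
  { intros s. unfold term, unit_weight, Cz, amp, rate. rewrite !Cmult_1_l, <- !Cexp_add. f_equal.
    rewrite !RtoC_mult, !RtoC_plus, RtoC_opp. ring. }
  assert (A1 := expser_abs _ _ z (theta_pos_decays M sg unit_weight HM Hs (tempered_const _))).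
  assert (A2 := expser_abs _ _ z (theta_neg_decays M sg unit_weight HM Hs (tempered_const _))).
  cbv beta in A1, A2. fold unit_weight in A1, A2.
  assert (E1 : theta_pos M sg unit_weight z =
    (term sg + Cser (fun n => term (INR n + sg + 1)%R))%C).
  { unfold theta_pos, expser. rewrite (Cser_incr_1 _ A1). f_equal.
    - unfold term. simpl INR. rewrite Rplus_0_l. reflexivity.
    - apply Cser_ext; intros n. unfold term. rewrite S_INR.
      replace (INR n + 1 + sg) with (INR n + sg + 1) by ring. reflexivity. }
  assert (E2 : Cser (fun n => term (sg - 1 - INR n + 1))
    = (term sg + theta_neg M sg unit_weight z)%C).
  { rewrite Cser_incr_1.
    - f_equal. + simpl INR. f_equal. ring.
      + unfold theta_neg, expser. apply Cser_ext; intros n. unfold term. rewrite S_INR.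
        replace (sg - 1 - (INR n + 1) + 1) with (sg - 1 - INR n) by ring. reflexivity.
    - apply (ex_series_incr_1 (fun n => Cmod (term (sg - 1 - INR n + 1)))).
      eapply ex_series_ext; [|exact A2]. intros n. unfold term. rewrite S_INR.
      replace (sg - 1 - (INR n + 1) + 1) with (sg - 1 - INR n) by ring. reflexivity. }
  assert (T1 : theta_pos M sg unit_weight (z + eta)%C
    = (Cz * Cser (fun n => term (INR n + sg + 1)%R))%C).
  { unfold theta_pos, expser. rewrite <- Cser_scal.
    - apply Cser_ext; intros n; apply St.
    - apply Cabs_S in A1. eapply ex_series_ext; [|exact A1]. intros n. unfold term. rewrite S_INR.
      replace (INR n + 1 + sg) with (INR n + sg + 1) by ring. reflexivity. }
  assert (T2 : theta_neg M sg unit_weight (z + eta)%C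
    = (Cz * Cser (fun n => term (sg - 1 - INR n + 1)%R))%C).
  { unfold theta_neg, expser. rewrite <- Cser_scal.
    - apply Cser_ext; intros n; apply St.
    - apply (ex_series_incr_1 (fun n => Cmod (term (sg - 1 - INR n + 1)))).
      eapply ex_series_ext; [|exact A2]. intros n. unfold term. rewrite S_INR.
      replace (sg - 1 - (INR n + 1) + 1) with (sg - 1 - INR n) by ring. reflexivity. }
  unfold theta. rewrite T1, T2, E1, E2. ring.
Qed.

(** The factor exp (a z^2) converts the classical multipliers of the theta series, 1 for the
    period 1, into those of [theta_space]. *)
Definition gtheta (a M sg : R) (z : C) : C := (Cexp (a * (z * z))%C * theta M sg unit_weight z)%C.

Lemma hol_gaussian (a : R) : hol (fun z => Cexp (a * (z * z))%C).
Proof.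
  apply entire_expr_hol, (Hc_comp Cexp); [apply Hc_exp|]. apply Hc_mult; [apply Hc_const|].
  apply Hc_mult; apply Hc_id.
Qed.

Lemma gtheta_theta a M sg (m j : nat) : M = INR m -> 0 < M -> 0 <= sg <= 1 -> M * sg = INR j ->
  a * s3 = PI * M -> theta_space a (gtheta a M sg).
Proof.
  intros Em HM Hs Ej Ha. split; [|split].
  - apply hol_mult; [apply hol_gaussian|apply theta_hol; auto; apply tempered_const].
  - intros z. unfold gtheta. rewrite (theta_period M sg m j) by auto. rewrite
      (Cmult_assoc (Cexp (_ + _)%C)), <- Cexp_add.
    f_equal. f_equal. rewrite RtoC_mult. ring.
  - intros z. unfold gtheta. rewrite theta_quasi by auto. rewrite !(Cmult_assoc (Cexp _) (Cexp _)),
      <- !Cexp_add.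
    f_equal. f_equal. replace (- PI * M) with (- (a * s3)) by (rewrite Ha; ring).
    rewrite eta_eq. pose proof s3_sq as S3. destruct z as [x y]. re_im; field_simplify.
    + replace (s3 ^ 2) with 3 by (rewrite <- S3; ring). field.
    + try replace (s3 ^ 2) with 3 by (rewrite <- S3; ring). field.
Qed.

Lemma Cder_gtheta a M sg z : 0 < M -> 0 <= sg <= 1 -> Cder (gtheta a M sg) z =
  (RtoC (2 * a) * z * gtheta a M sg z + Cexp (a * (z * z))%C
    * theta M sg (fun s => (unit_weight s * rate M s)%C) z)%C.
Proof.
  intros HM Hs. apply is_CC_Cder.
  eapply is_CC_val.
  - apply is_CC_mult; [|apply theta_deriv; auto; apply tempered_const].
    apply (is_CC_comp Cexp); [apply is_CC_Cexp|].
    apply is_CC_mult; [apply is_CC_const|]. apply is_CC_mult; apply is_CC_id.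
  - unfold gtheta. fold unit_weight. rewrite RtoC_mult. ring.
Qed.

Lemma Cder_gtheta_0 a M sg : 0 < M -> 0 <= sg <= 1 ->
  Cder (gtheta a M sg) (RtoC 0) = theta M sg (fun s => (unit_weight s * rate M s)%C) (RtoC 0).
Proof.
  intros HM Hs. rewrite Cder_gtheta by auto. rewrite Cmult_0_r, !Cmult_0_l, Cmult_0_r, Cexp_0. ring.
Qed.

Lemma Cder2_gtheta_0 a M sg : 0 < M -> 0 <= sg <= 1 ->
  Cder (Cder (gtheta a M sg)) (RtoC 0) =
  theta M sg (fun s => (RtoC (2 * a) * unit_weight s + unit_weight s * rate M s * rate M s)%C)
    (RtoC 0).
Proof.
  intros HM Hs.
  assert (T1 : tempered unit_weight) by apply tempered_const.
  assert (T2 := tempered_rate M _ HM T1). assert (T3 := tempered_rate M _ HM T2).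
  rewrite theta_lin by auto.
  replace (Cder (gtheta a M sg)) with (fun z =>
    (RtoC (2 * a) * z * gtheta a M sg z + Cexp (a * (z * z))%C
    * theta M sg (fun s => (unit_weight s * rate M s)%C) z)%C)
    by (apply functional_extensionality; intros; symmetry; apply Cder_gtheta; auto).
  assert (Hh : hol (gtheta a M sg)).
  { apply hol_mult; [apply hol_gaussian|apply theta_hol; auto]. }
  destruct (hol_Cder _ Hh) as [_ D].
  apply is_CC_Cder. eapply is_CC_val.
  - apply is_CC_plus.
    + apply is_CC_mult; [|apply D]. apply is_CC_mult; [apply is_CC_const|apply is_CC_id].
    + apply is_CC_mult; [|apply theta_deriv; auto].
      apply (is_CC_comp Cexp); [apply is_CC_Cexp|].
      apply is_CC_mult; [apply is_CC_const|]. apply is_CC_mult; apply is_CC_id.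
  - unfold gtheta at 1. rewrite !Cmult_0_r, !Cmult_0_l, !Cplus_0_l, !Cexp_0. ring.
Qed.

(** * Numerical bounds for theta series at the origin *)

(** The term s = sg is compared with geometric bounds for the two remaining halves of the
    series. *)
Lemma theta_lower M sg w r K1 K2 : 0 <= r < 1 ->
  (forall n : nat, Cmod (w (INR n + 1 + sg)) * Cmod (amp M (INR n + 1 + sg)) <= K1 * r ^ S n) ->
  (forall n : nat, Cmod (w (sg - 1 - INR n)) * Cmod (amp M (sg - 1 - INR n)) <= K2 * r ^ S n) ->
  Re (w sg * amp M sg)%C - (K1 + K2) * (r / (1 - r)) <= Re (theta M sg w 0).
Proof.
  intros Hr H1 H2.
  set (a := fun n => (w (INR n + sg)%R * amp M (INR n + sg))%C).
  set (b := fun n => (w (sg - 1 - INR n)%R * amp M (sg - 1 - INR n))%C).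
  assert (E : theta M sg w 0 = (Cser a + Cser b)%C).
  { unfold theta, theta_pos, theta_neg, expser. f_equal; apply Cser_ext; intros n;
    rewrite Cmult_0_r, Cexp_0, Cmult_1_r; reflexivity. }
  destruct (Cser_tail_Re (fun n => a (S n)) r K1 Hr) as [A1 A2].
  { intros n. unfold a. rewrite Cmod_mult, S_INR. apply H1. }
  destruct (Cser_tail_Re b r K2 Hr) as [B1 B2].
  { intros n. unfold b. rewrite Cmod_mult. apply H2. }
  assert (Ca : Cabs a). { apply (ex_series_incr_1 (fun n => Cmod (a n))). exact A1. }
  rewrite E, (Cser_incr_1 a Ca).
  replace (a 0%nat) with (w sg * amp M sg)%C by (unfold a; simpl INR; rewrite Rplus_0_l; auto).
  assert (RP : forall x y, Re (x + y)%C = Re x + Re y) by reflexivity.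
  rewrite !RP. set (g := r / (1 - r)) in *. lra.
Qed.

Lemma pi_sqrt3_bound : 5.19 <= PI * s3.
Proof.
  assert (H1 : 3 < PI) by (pose proof PI2_3_2; unfold PI2 in *; lra).
  assert (H2 : 1.732 <= s3).
  { unfold s3. rewrite <- (sqrt_Rsqr 1.732) by lra. apply sqrt_le_1_alt. unfold Rsqr; lra. }
  nra.
Qed.

Lemma exp_lin x : 1 + x <= exp x.
Proof. destruct (Req_dec x 0) as [->|E]; [rewrite exp_0; lra|left; apply exp_ineq1; auto]. Qed.

(** 1 + 4 Y bounds the weight of the second derivative relative to its value at s = 0; three
    quarters of the Gaussian decay suffice to absorb it. *)
Lemma exp_quarter_bound Y : 5.19 <= Y -> (1 + 4 * Y) * exp (- Y) <= exp (- (Y / 4)).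
Proof.
  intros HY.
  assert (K : 1 + 4 * Y <= exp (3 * Y / 4)).
  (* The eighth power of 1 + x <= exp x, with x = 3 Y / 32, is sharp enough for Y >= 5.19. *)
  { replace (3 * Y / 4) with (3 * Y / 32 * INR 8) by (simpl; field). rewrite <- exp_Rpow.
    set (u := 1 + 3 * Y / 32).
    assert (Hu : 1.4865 <= u) by (unfold u; lra).
    apply Rle_trans with (u ^ 8).
    - replace Y with ((u - 1) * 32 / 3) by (unfold u; field).
      assert (W : 2.2 <= u * u) by nra.
      set (v := u * u) in *.
      assert (V : 4.84 <= v * v) by nra.
      replace (u ^ 8) with ((v * v) * (v * v)) by (unfold v; ring).
      assert (4.84 * (v * v) <= (v * v) * (v * v)) by nra.
      assert (u <= (v + 2.56) / 3.2) by (unfold v; pose proof (Rle_0_sqr (u - 1.6));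
        unfold Rsqr in *; lra).
      nra.
    - apply pow_incr. split; [lra|]. apply exp_lin. }
  replace (exp (- (Y / 4))) with (exp (3 * Y / 4) * exp (- Y)) by (rewrite <- exp_plus; f_equal;
    field).
  apply Rmult_le_compat_r; auto. left; apply exp_pos.
Qed.

Lemma exp_ratio_bound : 0 <= exp (- (PI * s3 / 4)) < 1 / 3.
Proof.
  split; [left; apply exp_pos|].
  pose proof pi_sqrt3_bound as HX.
  assert (3 < exp (PI * s3 / 4)).
  { replace (PI * s3 / 4) with (PI * s3 / 16 * INR 4) by (simpl; field). rewrite <- exp_Rpow.
    apply Rlt_le_trans with ((1 + PI * s3 / 16) ^ 4).
    - apply Rlt_le_trans with (1.324 ^ 4); [lra|]. apply pow_incr. lra.
    - apply pow_incr. split; [lra|]. apply exp_lin. }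
  rewrite exp_Ropp. unfold Rdiv at 2. rewrite Rmult_1_l. apply Rinv_lt_contravar; lra.
Qed.

(** The term s = 0 equals 2a, and the others add up to at most 4a r / (1 - r) with r = exp
    (- pi sqrt 3 / 4) < 1/3. *)
Lemma gtheta2_d2_nonzero a : a * s3 = PI * 2 -> 0 < Re (Cder (Cder (gtheta a 2 0)) (RtoC 0)).
Proof.
  intros Ha. rewrite Cder2_gtheta_0 by lra.
  pose proof exp_ratio_bound as Hr. pose proof pi_sqrt3_bound as HX. pose proof s3_pos as S3. pose
    proof PI_RGT_0 as HPI.
  set (r := exp (- (PI * s3 / 4))) in *.
  assert (Hapos : 0 < a) by nra.
  set (w := fun s => (RtoC (2 * a) * unit_weight s + unit_weight s * rate 2 s * rate 2 s)%C).
  assert (Bd : forall s (n : nat), s * s = INR (S n) * INR (S n) -> Cmod (w s) * Cmod (amp 2 s) <= 2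
    * a * r ^ S n).
  { intros s n Hs.
    set (Y := PI * s3 * (s * s)).
    assert (Hn : 1 <= INR (S n)) by (rewrite S_INR; pose proof (pos_INR n); lra).
    assert (HY : PI * s3 * INR (S n) <= Y).
    { unfold Y. rewrite Hs. apply Rmult_le_compat_l; [lra|]. nra. }
    assert (Cw : Cmod (w s) <= 2 * a * (1 + 4 * Y)).
    { unfold w. eapply Rle_trans; [apply Cmod_triangle|].
      rewrite !Cmod_mult, Cmod_rate, Cmod_R, Rabs_pos_eq by lra. unfold unit_weight. rewrite Cmod_1.
      unfold Y. replace (2 * PI * 2 * Rabs s) with ((PI * 2) * (2 * Rabs s)) by ring.
      rewrite <- Ha.
      assert (Rabs s * Rabs s = s * s) by (rewrite <- Rabs_mult, Rabs_pos_eq; nra).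
      replace (2 * a * 1 + 1 * (a * s3 * (2 * Rabs s)) * (a * s3 * (2 * Rabs s))) with
        (2 * a + 4 * a * s3 * (a * s3) * (Rabs s * Rabs s)) by ring.
      rewrite H, Ha. right. ring. }
    rewrite Cmod_amp. replace (PI * s3 / 2 * 2 * (s * s)) with Y by (unfold Y; field).
    apply Rle_trans with (2 * a * ((1 + 4 * Y) * exp (- Y))).
    - rewrite <- Rmult_assoc. apply Rmult_le_compat_r; auto. left; apply exp_pos.
    - apply Rmult_le_compat_l; [lra|].
      eapply Rle_trans; [apply exp_quarter_bound; nra|].
      unfold r. rewrite exp_Rpow. apply exp_le_mono. lra. }
  assert (L := theta_lower 2 0 w r (2 * a) (2 * a) ltac:(lra)).
  assert (L' : Re (w 0 * amp 2 0)%C - (2 * a + 2 * a) * (r / (1 - r)) <= Re (theta 2 0 w 0)).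
  { apply L.
    - intros n. apply Bd. rewrite S_INR. ring.
    - intros n. apply Bd. rewrite S_INR. ring. }
  eapply Rlt_le_trans; [|exact L'].
  assert (W0 : (w 0 * amp 2 0)%C = RtoC (2 * a)).
  { unfold w, amp, rate, unit_weight. rewrite !Rmult_0_r, !Cmult_0_r, Cexp_0. ring. }
  rewrite W0. cbn [Re fst RtoC].
  assert (r / (1 - r) < 1 / 2).
  { apply Rmult_lt_reg_r with (1 - r); [lra|]. unfold Rdiv at 1. rewrite Rmult_assoc, Rinv_l; lra. }
  unfold Re; simpl. nra.
Qed.

Lemma gtheta2_nonzero a : a * s3 = PI * 2 -> 0 < Re (gtheta a 2 0 (RtoC 0)).
Proof.
  intros Ha. unfold gtheta. rewrite !Cmult_0_r, Cexp_0, Cmult_1_l.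
  pose proof exp_ratio_bound as Hr. pose proof pi_sqrt3_bound as HX.
  set (r := exp (- (PI * s3 / 4))) in *.
  assert (Bd : forall s (n : nat), s * s = INR (S n) * INR (S n) -> Cmod (unit_weight s)
    * Cmod (amp 2 s) <= 1 * r ^ S n).
  { intros s n Hs. unfold unit_weight. rewrite Cmod_1, Cmod_amp, !Rmult_1_l.
    assert (Hn : 1 <= INR (S n)) by (rewrite S_INR; pose proof (pos_INR n); lra).
    unfold r. rewrite exp_Rpow. apply exp_le_mono. rewrite Hs.
    set (X := PI * s3) in *. set (m := INR (S n)) in *.
    assert (X * m <= X * (m * m)) by (apply Rmult_le_compat_l; nra). nra. }
  assert (L' : Re (unit_weight 0 * amp 2 0)%C - (1 + 1)
    * (r / (1 - r)) <= Re (theta 2 0 unit_weight 0)).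
  { apply (theta_lower 2 0 unit_weight r 1 1 ltac:(lra)).
    - intros n. apply Bd. rewrite S_INR. ring.
    - intros n. apply Bd. rewrite S_INR. ring. }
  eapply Rlt_le_trans; [|exact L'].
  assert (W0 : (unit_weight 0 * amp 2 0)%C = 1).
  { unfold amp, unit_weight. rewrite !Rmult_0_r, !Cmult_0_r, Cexp_0. ring. }
  rewrite W0.
  assert (r / (1 - r) < 1 / 2).
  { apply Rmult_lt_reg_r with (1 - r); [lra|]. unfold Rdiv at 1. rewrite Rmult_assoc, Rinv_l; lra. }
  unfold Re; simpl. lra.
Qed.

(** The term s = 1/4 dominates. Divided by it, the terms on the two sides are at most r^m
    and 3 r^m with m >= 1 and r = exp (- pi sqrt 3) < 1/5, and 4 r / (1 - r) < 1. *)
Lemma gtheta4_d1_nonzero a : Cder (gtheta a 4 (1 / 4)) (RtoC 0) <> 0.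
Proof.
  rewrite Cder_gtheta_0 by lra.
  pose proof pi_sqrt3_bound as HX. pose proof PI_RGT_0 as HPI.
  set (X := PI * s3) in *. set (r := exp (- X)).
  assert (Hr : 0 <= r < 1 / 5).
  { split; [left; apply exp_pos|]. unfold r. rewrite exp_Ropp. unfold Rdiv. rewrite Rmult_1_l.
    apply Rinv_lt_contravar; pose proof (exp_lin X); lra. }
  set (A := amp 4 (1 / 4)). assert (HA : A <> 0) by apply Cexp_neq_0.
  (* Normalised so that the term s = 1/4 becomes 1. *)
  set (v := fun s => (/ A * RtoC (4 * s))%C).
  assert (Tv : tempered v).
  { apply tempered_scal. exists 4, 1. split; [lra|split; [lra|]]. intros s.
    rewrite Cmod_R, Rabs_mult, (Rabs_pos_eq 4) by lra. apply Rmult_le_compat_l; [lra|].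
    rewrite Rmult_1_l. apply le_exp. }
  set (k := (A * (RtoC (2 * PI) * Ci))%C).
  assert (E : theta 4 (1 / 4) (fun s => (unit_weight s * rate 4 s)%C) (RtoC 0)
    = (k * theta 4 (1 / 4) v 0)%C).
  { assert (T0 : tempered (fun _ => RtoC 0)) by apply tempered_const.
    assert (Z0 : theta 4 (1 / 4) (fun _ => RtoC 0) (RtoC 0) = 0).
    { assert (L := theta_lin 4 (1 / 4) (- RtoC 1)%C (fun _ => RtoC 0) (fun _ => RtoC 0) (RtoC 0)
      ltac:(lra) ltac:(lra) T0 T0).
      cbv beta in L.
      replace (fun _ : R => (- RtoC 1 * 0 + 0)%C) with (fun _ : R => RtoC 0) in L
        by (apply functional_extensionality; intros; ring).
      rewrite L at 1. ring. }
    assert (L := theta_lin 4 (1 / 4) k v (fun _ => RtoC 0) (RtoC 0) ltac:(lra) ltac:(lra) Tv T0).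
    rewrite Z0, Cplus_0_r in L. rewrite <- L. f_equal. apply functional_extensionality; intros s.
    unfold unit_weight, rate, v, k. field. exact HA. }
  rewrite E. apply Cmult_neq_0.
  { unfold k. apply Cmult_neq_0; auto. apply Cmult_neq_0; [|apply Ci_nz].
    intros Z. apply RtoC_inj in Z. lra. }
  assert (Mv : forall s, Cmod (v s) * Cmod (amp 4 s) = 4 * Rabs s
    * exp (- (2 * X * (s * s - 1 / 16)))).
  { intros s. unfold v. rewrite Cmod_mult, Cmod_inv, Cmod_R, Rabs_mult,
    (Rabs_pos_eq 4) by (auto; lra).
    unfold A. rewrite !Cmod_amp.
    replace (exp (- (2 * X * (s * s - 1 / 16)))) with
      (/ exp (- (PI * s3 / 2 * 4 * (1 / 4 * (1 / 4)))) * exp (- (PI * s3 / 2 * 4 * (s * s)))).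
    - ring.
    - rewrite <- exp_Ropp, <- exp_plus. f_equal. unfold X. field. }
  assert (L' : Re (v (1 / 4)%R * amp 4 (1 / 4))%C - (1 + 3)
    * (r / (1 - r)) <= Re (theta 4 (1 / 4) v 0)).
  { apply (theta_lower 4 (1 / 4) v r 1 3 ltac:(lra)).
    - intros n. rewrite Mv. set (m := INR n + 1). pose proof (pos_INR n).
      assert (Hm : 1 <= m) by (unfold m; lra).
      rewrite Rabs_pos_eq by lra.
      replace (4 * (m + 1 / 4)) with (1 + 4 * m) by field.
      unfold r. rewrite exp_Rpow, S_INR. fold m. rewrite Rmult_1_l.
      apply Rle_trans with (exp (4 * m) * exp (- (2 * X * ((m + 1 / 4) * (m + 1 / 4) - 1 / 16)))).
      + apply Rmult_le_compat_r; [left; apply exp_pos|apply exp_lin].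
      + rewrite <- exp_plus. apply exp_le_mono. nra.
    - intros n. rewrite Mv. set (m := INR n). pose proof (pos_INR n) as Hm. fold m in Hm.
      rewrite Rabs_left1 by lra.
      replace (4 * - (1 / 4 - 1 - m)) with (3 * (1 + 4 / 3 * m)) by field.
      unfold r. rewrite exp_Rpow, S_INR. fold m. rewrite Rmult_assoc. apply Rmult_le_compat_l;
        [lra|].
      apply Rle_trans with (exp (4 / 3 * m) * exp
        (- (2 * X * ((1 / 4 - 1 - m) * (1 / 4 - 1 - m) - 1 / 16)))).
      + apply Rmult_le_compat_r; [left; apply exp_pos|apply exp_lin].
      + rewrite <- exp_plus. apply exp_le_mono. nra. }
  assert (W0 : (v (1 / 4)%R * amp 4 (1 / 4))%C = 1).
  { unfold v. fold A. replace (4 * (1 / 4)) with 1 by field. field. exact HA. }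
  rewrite W0 in L'. intros Z. rewrite Z in L'. unfold Re in L'; simpl in L'.
  assert (r / (1 - r) < 1 / 4).
  { apply Rmult_lt_reg_r with (1 - r); [lra|]. unfold Rdiv at 1. rewrite Rmult_assoc, Rinv_l; lra. }
  lra.
Qed.

(** * Projection onto rotation weights *)

(** For ze^6 = 1 this is six times the projection onto the functions that the rotation
    multiplies by ze^-1. *)
Definition proj (ze : C) (h : C -> C) (z : C) : C :=
  csum (seq 0 6) (fun j => (Cpow ze j * h (Cpow eta j * z)%C)%C).

Lemma cis_pow t n : Cpow (cis t) n = cis (INR n * t).
Proof.
  induction n as [|n IH]; [simpl; rewrite Rmult_0_l, cis_0; auto|].
  rewrite S_INR, Rmult_plus_distr_r, Rmult_1_l, cis_add, <- IH. simpl. ring.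
Qed.

Lemma eta6 : Cpow eta 6 = 1.
Proof.
  rewrite eta_cis, cis_pow. replace (INR 6 * (PI / 3)) with (2 * PI * IZR 1) by (simpl; field).
  apply cis_2PI.
Qed.

Lemma proj_rot ze la h z : Cpow ze 6 = 1 -> (ze * la)%C = 1 ->
  proj ze h (eta * z)%C = (la * proj ze h z)%C.
Proof.
  intros Z6 ZL.
  set (g := fun j => (Cpow ze j * h (Cpow eta j * z)%C)%C).
  assert (E : proj ze h (eta * z)%C = csum (seq 0 6) (fun j => (la * g (S j))%C)).
  { apply csum_ext. intros j _. unfold g.
    replace (la * (Cpow ze (S j) * h (Cpow eta (S j) * z)%C))%C with
      (ze * la * (Cpow ze j * h (Cpow eta (S j) * z)%C))%C by (simpl; ring).
    rewrite ZL, Cmult_1_l. f_equal. f_equal. simpl; ring. }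
  rewrite E, csum_scal. f_equal.
  change (proj ze h z) with (csum (seq 0 6) g).
  assert (G6 : g 6%nat = g 0%nat).
  { unfold g. rewrite Z6, eta6. reflexivity. }
  cbn [seq csum fold_right]. rewrite G6. ring.
Qed.

Lemma theta_zero a : theta_space a (fun _ => RtoC 0).
Proof.
  split; [apply hol_const|split]; intros z; ring.
Qed.

Lemma theta_rot_pow a m h j : a * s3 = PI * INR (2 * m) -> theta_space a h ->
  theta_space a (fun z => h (Cpow eta j * z)%C).
Proof.
  intros Ha Hh. induction j as [|j IH].
  - replace (fun z => h (Cpow eta 0 * z)%C) with h; auto.
    apply functional_extensionality; intros z. simpl. rewrite Cmult_1_l; auto.
  - replace (fun z => h (Cpow eta (S j) * z)%C) with (fun z => h (Cpow eta j * (eta * z))%C).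
    + exact (theta_rot a m _ Ha IH).
    + apply functional_extensionality; intros z. f_equal. simpl. ring.
Qed.

Lemma proj_theta a m ze h : a * s3 = PI * INR (2 * m) -> theta_space a h ->
  theta_space a (proj ze h).
Proof.
  intros Ha Hh. unfold proj. induction (seq 0 6) as [|j l IH]; simpl; [apply theta_zero|].
  apply (theta_plus a (fun z => (Cpow ze j * h (Cpow eta j * z)%C)%C)); auto.
  apply theta_scal. apply (theta_rot_pow a m); auto.
Qed.

Lemma proj_deriv ze h z : hol h -> is_CC (proj ze h) z (proj (ze * eta)%C (Cder h) z).
Proof.
  intros Hh. destruct (hol_Cder h Hh) as [_ D]. unfold proj.
  induction (seq 0 6) as [|j l IH]; simpl; [apply is_CC_const|].
  apply (is_CC_plus (fun z => (Cpow ze j * h (Cpow eta j * z)%C)%C)); auto.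
  eapply is_CC_val.
  - apply is_CC_mult; [apply is_CC_const|]. apply (is_CC_comp h); [apply D|].
    apply is_CC_mult; [apply is_CC_const|apply is_CC_id].
  - rewrite Cpow_mult_l. ring.
Qed.

Lemma proj_hol ze h : hol h -> hol (proj ze h).
Proof.
  intros Hh. unfold proj. induction (seq 0 6) as [|j l IH]; simpl; [apply hol_const|].
  apply (hol_plus (fun z => (Cpow ze j * h (Cpow eta j * z)%C)%C)); auto.
  apply hol_mult; [apply hol_const|apply hol_scaled; auto].
Qed.

(** Differentiation lowers the weight by one, so after q derivatives a projection of weight
    q becomes an untwisted orbit sum, whose value at the origin is seen by [proj_one_0]. *)
Lemma Cder_proj ze h : hol h -> Cder (proj ze h) = proj (ze * eta)%C (Cder h).
Proof.
  intros Hh. apply functional_extensionality; intros z. apply is_CC_Cder, proj_deriv; auto.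
Qed.

Lemma proj_one_0 h : proj 1 h 0 = (6 * h 0)%C.
Proof.
  unfold proj. rewrite (csum_ext _ _ (fun _ => h 0)).
  - cbn [seq csum fold_right]. ring.
  - intros j _. rewrite Cmult_0_r. rewrite Cpow_1_l. ring.
Qed.

(** The origin is fixed by the rotation, so an eigenvalue other than 1 forces the value 0
    there. *)
Lemma proj_vanish ze la h : Cpow ze 6 = 1 -> (ze * la)%C = 1 -> la <> 1 ->
  proj ze h 0 = 0.
Proof.
  intros Z6 ZL L1. assert (E := proj_rot ze la h 0 Z6 ZL). rewrite Cmult_0_r in E.
  destruct (Ceq_dec (proj ze h 0) (RtoC 0)) as [|N]; auto. exfalso. apply L1.
  rewrite <- (Cmult_1_r la), <- (Cinv_r _ N), Cmult_assoc, <- E. reflexivity.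
Qed.

(** * Order of vanishing at the origin *)

Definition Clim (u : nat -> C) (l : C) : Prop :=
  is_lim_seq (fun n => Re (u n)) (Re l) /\ is_lim_seq (fun n => Im (u n)) (Im l).

Lemma Clim_ext u v l : (forall n, u n = v n) -> Clim u l -> Clim v l.
Proof. intros E. replace v with u; auto. apply functional_extensionality; auto. Qed.
Lemma Clim_const c : Clim (fun _ => c) c.
Proof. split; apply is_lim_seq_const. Qed.
Lemma Clim_plus u v a b : Clim u a -> Clim v b -> Clim (fun n => (u n + v n)%C) (a + b)%C.
Proof. intros [A B] [A' B']; split; [exact (is_lim_seq_plus' _ _ _ _ A A')|exact
  (is_lim_seq_plus' _ _ _ _ B B')]. Qed.
Lemma Clim_mult u v a b : Clim u a -> Clim v b -> Clim (fun n => (u n * v n)%C) (a * b)%C.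
Proof.
  intros [A B] [A' B']; split.
  - exact (is_lim_seq_minus' _ _ _ _ (is_lim_seq_mult' _ _ _ _ A A')
      (is_lim_seq_mult' _ _ _ _ B B')).
  - exact (is_lim_seq_plus' _ _ _ _ (is_lim_seq_mult' _ _ _ _ A B')
      (is_lim_seq_mult' _ _ _ _ B A')).
Qed.
Lemma Clim_unique u a b : Clim u a -> Clim u b -> a = b.
Proof.
  intros [A B] [A' B'].
  pose proof (is_lim_seq_unique _ _ A) as E1. pose proof (is_lim_seq_unique _ _ A') as E2.
  pose proof (is_lim_seq_unique _ _ B) as E3. pose proof (is_lim_seq_unique _ _ B') as E4.
  apply C_ext; congruence.
Qed.
Lemma Clim_csum {A} (l : list A) (u : A -> nat -> C) c : (forall x, In x l -> Clim (u x) (c x)) ->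
  Clim (fun n => csum l (fun x => u x n)) (csum l c).
Proof.
  induction l as [|x l IH]; intros H; simpl; [apply Clim_const|].
  apply Clim_plus; [apply H; simpl; auto|apply IH; intros; apply H; simpl; auto].
Qed.

Definition recip (n : nat) : R := / (INR n + 1).
Lemma recip_pos n : 0 < recip n.
Proof. apply Rinv_0_lt_compat. pose proof (pos_INR n); lra. Qed.
Lemma recip_small d : 0 < d -> exists N, forall n, (N <= n)%nat -> recip n < d.
Proof.
  intros Hd. destruct (INR_unbounded (/ d)) as [N HN]. exists N. intros n Hn.
  unfold recip. rewrite <- (Rinv_inv d). apply Rinv_lt_contravar.
  - apply Rmult_lt_0_compat; [apply Rinv_0_lt_compat; auto|]. pose proof (pos_INR n); lra.
  - apply le_INR in Hn. lra.
Qed.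

(** h(x) is asymptotic to c x^q as x tends to 0 along the sequence 1 / (n + 1). For c <> 0
    this is the order of vanishing, and it is visibly additive under products. *)
Definition ord (h : C -> C) (q : nat) (c : C) : Prop :=
  Clim (fun n => (h (RtoC (recip n)) * RtoC (/ recip n ^ q))%C) c.

Lemma ord_mult f g p q a b : ord f p a -> ord g q b ->
  ord (fun z => (f z * g z)%C) (p + q) (a * b)%C.
Proof.
  intros H1 H2. eapply Clim_ext; [|apply (Clim_mult _ _ _ _ H1 H2)].
  intros n. cbv beta. rewrite pow_add, Rinv_mult, RtoC_mult. ring.
Qed.

Lemma ord_pow f q a n : ord f q a -> ord (fun z => Cpow (f z) n) (n * q) (Cpow a n).
Proof.
  intros H. induction n as [|n IH].
  - simpl. eapply Clim_ext; [|apply Clim_const]. intros n. simpl. rewrite Rinv_1. ring.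
  - simpl. apply (ord_mult f (fun z => Cpow (f z) n)); auto.
Qed.

Lemma recip_lim (g : R -> R) l :
  (forall eps, 0 < eps -> exists d, 0 < d /\ forall x, 0 < x < d -> Rabs (g x - l) <= eps) ->
  is_lim_seq (fun n => g (recip n)) l.
Proof.
  intros H. apply is_lim_seq_spec. intros eps.
  destruct (H (eps / 2)) as [d [Hd Hb]]. { pose proof (cond_pos eps); lra. }
  destruct (recip_small d Hd) as [N HN]. exists N. intros n Hn.
  eapply Rle_lt_trans; [apply Hb; split; [apply recip_pos|auto]|]. pose proof (cond_pos eps); lra.
Qed.

Lemma derive_quotient (g : R -> R) (l : R) : is_derive g 0 l -> forall eps, 0 < eps ->
  exists d, 0 < d /\ forall x, 0 < x < d -> Rabs (g x - g 0 - l * x) <= eps * x.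
Proof.
  intros H eps He. apply is_derive_Reals in H. destruct (H eps He) as [d Hd].
  exists d. split; [apply cond_pos|]. intros x [Hx Hxd].
  specialize (Hd x ltac:(lra)). rewrite Rplus_0_l in Hd. rewrite (Rabs_pos_eq x) in Hd by lra.
  specialize (Hd Hxd).
  replace (g x - g 0 - l * x) with (((g x - g 0) / x - l) * x) by (field; lra).
  rewrite Rabs_mult, (Rabs_pos_eq x) by lra. apply Rmult_le_compat_r; lra.
Qed.

Lemma real_ord0 (g : R -> R) l : is_derive g 0 l ->
  is_lim_seq (fun n => g (recip n) * / recip n ^ 0) (g 0).
Proof.
  intros H. apply (recip_lim (fun x => g x * / x ^ 0)). intros eps He.
  destruct (derive_quotient g l H 1 Rlt_0_1) as [d [Hd Hb]].
  exists (Rmin d (eps / (Rabs l + 1))). pose proof (Rabs_pos l).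
  split. { apply Rmin_glb_lt; auto. apply Rdiv_lt_0_compat; lra. }
  intros x [Hx Hxd].
  assert (x < d) by (eapply Rlt_le_trans; [exact Hxd|apply Rmin_l]).
  assert (Hx2 : x < eps / (Rabs l + 1)) by (eapply Rlt_le_trans; [exact Hxd|apply Rmin_r]).
  specialize (Hb x ltac:(lra)). simpl. rewrite Rinv_1, Rmult_1_r.
  replace (g x - g 0) with ((g x - g 0 - l * x) + l * x) by ring.
  eapply Rle_trans; [apply Rabs_triang|]. rewrite Rabs_mult, (Rabs_pos_eq x) by lra.
  apply Rle_trans with ((Rabs l + 1) * x); [lra|].
  apply Rmult_lt_compat_l with (r := Rabs l + 1) in Hx2; [|lra].
  replace ((Rabs l + 1) * (eps / (Rabs l + 1))) with eps in Hx2 by (field; lra). lra.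
Qed.

Lemma real_ord1 (g : R -> R) l : is_derive g 0 l -> g 0 = 0 ->
  is_lim_seq (fun n => g (recip n) * / recip n ^ 1) l.
Proof.
  intros H G0. apply (recip_lim (fun x => g x * / x ^ 1)). intros eps He.
  destruct (derive_quotient g l H eps He) as [d [Hd Hb]].
  exists d; split; auto. intros x Hx. specialize (Hb x Hx). rewrite G0 in Hb.
  replace (g x * / x ^ 1 - l) with ((g x - 0 - l * x) * / x) by (field; lra).
  rewrite Rabs_mult, (Rabs_pos_eq (/ x)) by (left; apply Rinv_0_lt_compat; lra).
  apply Rmult_le_reg_r with x; [lra|]. rewrite Rmult_assoc, Rinv_l; lra.
Qed.

(** Apply the mean value theorem to g minus its quadratic Taylor polynomial. *)
Lemma real_ord2 (g g' : R -> R) m : (forall x, is_derive g x (g' x)) -> is_derive g' 0 m ->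
  g 0 = 0 -> g' 0 = 0 -> is_lim_seq (fun n => g (recip n) * / recip n ^ 2) (m / 2).
Proof.
  intros H H' G0 G1. apply (recip_lim (fun x => g x * / x ^ 2)). intros eps He.
  destruct (derive_quotient g' m H' eps He) as [d [Hd Hb]].
  exists d; split; auto. intros x Hx.
  assert (D : forall s, is_derive (fun s => g s - m / 2 * (s * s)) s (g' s - m * s)).
  { intros s. apply (is_derive_minus g (fun s => m / 2 * (s * s)) s (g' s) (m * s)).
    - apply H. - auto_derive; auto. field. }
  destruct (MVT_gen (fun s => g s - m / 2 * (s * s)) 0 x (fun s => g' s - m * s)) as [y [Hy E]].
  - intros; apply D.
  - intros y _. apply continuity_pt_filterlim,
      (ex_derive_continuous (fun s => g s - m / 2 * (s * s))).
    eexists; apply D.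
  - rewrite Rmin_left, Rmax_right in Hy by lra. rewrite G0 in E.
    assert (B : Rabs (g' y - m * y) <= eps * x).
    { destruct (Req_dec y 0) as [->|Ny].
      - rewrite G1. replace (0 - m * 0) with 0 by ring. rewrite Rabs_R0. nra.
      - assert (Hy0 : 0 < y < d) by lra. specialize (Hb y Hy0). rewrite G1 in Hb.
        replace (g' y - 0 - m * y) with (g' y - m * y) in Hb by ring. nra. }
    replace (g x * / x ^ 2 - m / 2) with ((g' y - m * y) * x * / x ^ 2).
    + rewrite !Rabs_mult, (Rabs_pos_eq x), (Rabs_pos_eq (/ x ^ 2)) by (try lra; left;
        apply Rinv_0_lt_compat; nra).
      apply Rmult_le_reg_r with (x ^ 2); [nra|]. rewrite Rmult_assoc, Rinv_l by nra. nra.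
    + apply Rmult_eq_reg_r with (x ^ 2); [|nra]. rewrite Rmult_assoc, Rinv_l, Rmult_1_r by nra.
      replace ((g x * / x ^ 2 - m / 2) * x ^ 2) with (g x - m / 2 * (x * x)) by (field; nra). lra.
Qed.

Lemma is_CC_real_axis h x l : is_CC h (RtoC x) l -> is_Cd (fun s => h (RtoC s)) x l.
Proof. apply is_CC_x. Qed.

Lemma Clim_scaled u (v : nat -> R) l :
  is_lim_seq (fun n => Re (u n) * v n) (Re l) -> is_lim_seq (fun n => Im (u n) * v n) (Im l) ->
  Clim (fun n => (u n * RtoC (v n))%C) l.
Proof.
  intros H1 H2; split.
  - eapply is_lim_seq_ext; [|exact H1]. intros n. rewrite re_scal_r. reflexivity.
  - eapply is_lim_seq_ext; [|exact H2]. intros n. rewrite im_scal_r. reflexivity.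
Qed.

Lemma ord_0 h : hol h -> ord h 0 (h 0).
Proof.
  intros Hh. destruct (hol_Cder h Hh) as [_ D]. destruct (is_CC_real_axis h 0 _ (D 0)) as [D1 D2].
  apply Clim_scaled.
  - exact (real_ord0 (fun s => Re (h (RtoC s))) _ D1).
      - exact (real_ord0 (fun s => Im (h (RtoC s))) _ D2).
Qed.

Lemma ord_1 h : hol h -> h 0 = 0 -> ord h 1 (Cder h 0).
Proof.
  intros Hh H0. destruct (hol_Cder h Hh) as [_ D]. destruct (is_CC_real_axis h 0 _ (D 0)) as
    [D1 D2].
  apply Clim_scaled.
  - apply (real_ord1 (fun s => Re (h (RtoC s))) _ D1). rewrite H0; auto.
  - apply (real_ord1 (fun s => Im (h (RtoC s))) _ D2). rewrite H0; auto.
Qed.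

Lemma ord_2 h : hol h -> h 0 = 0 -> Cder h 0 = 0 ->
  ord h 2 (RtoC (/ 2) * Cder (Cder h) (RtoC 0))%C.
Proof.
  intros Hh H0 H1. destruct (hol_Cder h Hh) as [Hh' D]. destruct (hol_Cder _ Hh') as [_ D'].
  destruct (is_CC_real_axis _ 0 _ (D' 0)) as [D1 D2].
  apply Clim_scaled.
  - rewrite re_scal_l, Rmult_comm.
    apply (real_ord2 (fun s => Re (h (RtoC s))) (fun s => Re (Cder h (RtoC s))) _); auto.
    + intros x. exact (proj1 (is_CC_real_axis h x _ (D (RtoC x)))).
    + rewrite H0; auto. + rewrite H1; auto.
  - rewrite im_scal_l, Rmult_comm.
    apply (real_ord2 (fun s => Im (h (RtoC s))) (fun s => Im (Cder h (RtoC s))) _); auto.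
    + intros x. exact (proj2 (is_CC_real_axis h x _ (D (RtoC x)))).
    + rewrite H0; auto. + rewrite H1; auto.
Qed.

Lemma recip_pow_lim j : (0 < j)%nat -> Clim (fun n => RtoC (recip n ^ j)) (RtoC 0).
Proof.
  intros Hj. split; simpl; [|apply is_lim_seq_const].
  apply (recip_lim (fun x => x ^ j)). intros eps He. exists (Rmin 1 eps).
  split; [apply Rmin_glb_lt; lra|]. intros x [Hx Hxd].
  assert (x < 1) by (eapply Rlt_le_trans; [exact Hxd|apply Rmin_l]).
  assert (x < eps) by (eapply Rlt_le_trans; [exact Hxd|apply Rmin_r]).
  rewrite Rminus_0_r, Rabs_pos_eq by (apply pow_le; lra).
  destruct j as [|j]; [lia|]. simpl.
  assert (x ^ j <= 1) by (rewrite <- (pow1 j); apply pow_incr; lra).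
  assert (0 <= x ^ j) by (apply pow_le; lra). nra.
Qed.

(** By induction on q: once the smaller coefficients are zero, dividing the relation by x^q
    and letting x tend to 0 isolates a q * c q. *)
Lemma ord_independent (l : list nat) (b : nat -> C -> C) (c a : nat -> C) : NoDup l ->
  (forall q, In q l -> ord (b q) q (c q)) -> (forall q, In q l -> c q <> 0) ->
  (forall z, csum l (fun q => (a q * b q z)%C) = 0) -> forall q, In q l -> a q = 0.
Proof.
  intros N Ho Hc Hs q.
  induction q as [q IH] using (well_founded_induction Wf_nat.lt_wf). intros Iq.
  set (L := fun x => if Nat.eq_dec x q then (a q * c q)%C else RtoC 0).
  assert (K : Clim (fun n => csum l (fun x =>
    (a x * b x (RtoC (recip n)) * RtoC (/ recip n ^ q))%C)) (csum l L)).
  { apply (Clim_csum l (fun x n => (a x * b x (RtoC (recip n)) * RtoC (/ recip n ^ q))%C)).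
    intros x Ix. unfold L. destruct (Nat.eq_dec x q) as [->|Nx].
    - eapply Clim_ext; [|apply (Clim_mult _ _ _ _ (Clim_const (a q)) (Ho q Iq))]. intros; cbv beta;
        ring.
    - destruct (Nat.lt_ge_cases x q) as [Hlt|Hge].
      + rewrite (IH x Hlt Ix). eapply Clim_ext; [|apply Clim_const]. intros; cbv beta; ring.
      + assert (Hd : (0 < x - q)%nat) by lia.
        assert (T := Clim_mult _ _ _ _ (Clim_const (a x))
          (Clim_mult _ _ _ _ (Ho x Ix) (recip_pow_lim _ Hd))).
        rewrite !Cmult_0_r in T. eapply Clim_ext; [|exact T]. intros n; cbv beta.
        pose proof (recip_pos n).
        replace (/ recip n ^ q) with (/ recip n ^ x * recip n ^ (x - q)).
        * rewrite RtoC_mult. ring.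
        * replace x with (q + (x - q))%nat at 1 by lia. rewrite pow_add. field.
          split; apply pow_nonzero; lra. }
  assert (K0 : Clim (fun n => csum l (fun x =>
    (a x * b x (RtoC (recip n)) * RtoC (/ recip n ^ q))%C)) (RtoC 0)).
  { eapply Clim_ext; [|apply Clim_const]. intros n. cbv beta.
    rewrite (csum_ext _ _ (fun x => (RtoC (/ recip n ^ q) * (a x * b x (RtoC (recip n))))%C)) by
      (intros; ring).
    rewrite csum_scal, Hs. ring. }
  pose proof (Clim_unique _ _ _ K K0) as E.
  rewrite (csum_single l q L N Iq) in E.
  - unfold L in E. destruct (Nat.eq_dec q q) as [_|]; [|congruence].
    destruct (Ceq_dec (a q) (RtoC 0)) as [|Na]; auto.
    exfalso. exact (Cmult_neq_0 _ _ Na (Hc q Iq) E).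
  - intros y _ Ny. unfold L. destruct (Nat.eq_dec y q); [contradiction|auto].
Qed.

(** * A basis of the ground states *)

(** The frequency for which sections have degree 2. *)
Definition alpha1 : R := 2 * PI / s3.

Definition dual_weight (w : nat) : C := cis (- (PI * INR w / 3)).
Definition weight (w : nat) : C := cis (PI * INR w / 3).

Lemma dual_weight6 w : Cpow (dual_weight w) 6 = 1.
Proof.
  unfold dual_weight. rewrite cis_pow. replace (INR 6 * - (PI * INR w / 3)) with
    (2 * PI * IZR (- Z.of_nat w)).
  - apply cis_2PI. - rewrite opp_IZR, <- INR_IZR_INZ. simpl; field.
Qed.
Lemma dual_weight_weight w : (dual_weight w * weight w)%C = 1.
Proof. apply cis_inv. ring. Qed.

(** Generators of the theta functions of even degree, with weights 0 and 2 in degree 2 and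
    weight 1 in degree 4. In degree 2 only the weights 0 and 2 occur. *)
Definition F0 : C -> C := proj (dual_weight 0) (gtheta alpha1 2 0).
Definition F2 : C -> C := proj (dual_weight 2) (gtheta alpha1 2 0).
Definition F1 : C -> C := proj (dual_weight 1) (gtheta (2 * alpha1) 4 (1 / 4)).

Lemma alpha1_s3 : alpha1 * s3 = PI * 2.
Proof. unfold alpha1. field. pose proof s3_pos; lra. Qed.

Lemma base2 : theta_space alpha1 (gtheta alpha1 2 0).
Proof.
  apply (gtheta_theta alpha1 2 0 2 0); try (simpl; lra). apply alpha1_s3.
Qed.
Lemma base4 : theta_space (2 * alpha1) (gtheta (2 * alpha1) 4 (1 / 4)).
Proof.
  apply (gtheta_theta (2 * alpha1) 4 (1 / 4) 4 1); try (simpl; lra). pose proof alpha1_s3; lra.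
Qed.

Lemma dual_weight_0 : dual_weight 0 = 1.
Proof. unfold dual_weight. simpl INR. replace (- (PI * 0 / 3)) with 0 by field. apply cis_0. Qed.

Lemma weight1_ne : weight 1 <> 1.
Proof.
  unfold weight. rewrite cis_cs. intros H. apply (f_equal Re) in H. simpl in H.
  replace (PI * 1 / 3) with (PI / 3) in H by field. rewrite cos_PI3 in H. lra.
Qed.
Lemma weight2_ne : weight 2 <> 1.
Proof.
  unfold weight. rewrite cis_cs. intros H. apply (f_equal Re) in H. simpl in H.
  replace (PI * (1 + 1) / 3) with (2 * (PI / 3)) in H by field. rewrite cos_2PI3 in H. lra.
Qed.

Lemma dual_weight_eta w : (dual_weight (S w) * eta)%C = dual_weight w.
Proof.
  unfold dual_weight. rewrite eta_cis, <- cis_add. f_equal. rewrite S_INR. field.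
Qed.

Lemma F0_ord : exists c : C, c <> 0 /\ ord F0 0 c.
Proof.
  exists (F0 0). split.
  - unfold F0. rewrite dual_weight_0, proj_one_0. apply Cmult_neq_0.
    + intros H; apply RtoC_inj in H; lra.
    + intros H. pose proof (gtheta2_nonzero alpha1 alpha1_s3) as K. rewrite H in K. simpl in K. lra.
  - apply ord_0. apply proj_hol, base2.
Qed.

(** The value at the origin vanishes by the weight, and the derivative is six times that of
    the theta series. *)
Lemma F1_ord : exists c : C, c <> 0 /\ ord F1 1 c.
Proof.
  exists (Cder F1 0). split.
  - unfold F1. rewrite Cder_proj by apply base4. rewrite dual_weight_eta, dual_weight_0,
      proj_one_0. apply Cmult_neq_0.
    + intros H; apply RtoC_inj in H; lra.
    + apply gtheta4_d1_nonzero.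
  - apply ord_1; [apply proj_hol, base4|]. apply (proj_vanish _ (weight 1));
      [apply dual_weight6|apply dual_weight_weight|apply weight1_ne].
Qed.

Lemma F2_ord : exists c : C, c <> 0 /\ ord F2 2 c.
Proof.
  assert (H0 : hol (gtheta alpha1 2 0)) by apply base2.
  assert (H1 := proj1 (hol_Cder _ H0)).
  exists (RtoC (/ 2) * Cder (Cder F2) (RtoC 0))%C. split.
  - unfold F2. rewrite Cder_proj, dual_weight_eta, Cder_proj, dual_weight_eta, dual_weight_0,
      proj_one_0 by auto. apply Cmult_neq_0.
    + intros H; apply RtoC_inj in H; lra.
    + apply Cmult_neq_0.
      * intros H; apply RtoC_inj in H; lra.
      * intros H. pose proof (gtheta2_d2_nonzero alpha1 alpha1_s3) as K. rewrite H in K. simpl in K.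
          lra.
  - apply ord_2; [apply proj_hol; auto| |].
    + apply (proj_vanish _ (weight 2)); [apply dual_weight6|apply dual_weight_weight|apply
        weight2_ne].
    + unfold F2. rewrite Cder_proj, dual_weight_eta by auto.
      apply (proj_vanish _ (weight 1)); [apply dual_weight6|apply dual_weight_weight|apply
        weight1_ne].
Qed.

Lemma theta_pow a h n : theta_space a h -> theta_space (INR n * a) (fun z => Cpow (h z) n).
Proof.
  intros H. induction n as [|n IH].
  - simpl INR. rewrite Rmult_0_l. exact theta_one.
  - rewrite S_INR. replace ((INR n + 1) * a) with (a + INR n * a) by ring.
    exact (theta_mult a (INR n * a) h _ H IH).
Qed.

(** A product of degree 2m in which one factor F1 is used exactly when q is odd, so that
    weights and orders of vanishing both add up to q. *)
Definition monomial (m q : nat) (z : C) : C :=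
  if Nat.even q then (Cpow (F0 z) (m - Nat.div2 q) * Cpow (F2 z) (Nat.div2 q))%C
  else (Cpow (F0 z) (m - 2 - Nat.div2 q) * F1 z * Cpow (F2 z) (Nat.div2 q))%C.

(** A theta function of degree 2m has 2m zeros modulo the lattice with a prescribed sum. If
    2m - 1 of them are at the origin, so is the last one; this is why 2m - 1 is left out. *)
Definition orders (m : nat) : list nat := seq 0 (2 * m - 1) ++ (2 * m)%nat :: nil.

Lemma orders_NoDup m : NoDup (orders m).
Proof.
  apply NoDup_app; [apply seq_NoDup|constructor; [simpl; auto|constructor]|].
  intros x Hx [E|[]]. apply in_seq in Hx. lia.
Qed.
Lemma orders_length m : (0 < m)%nat -> length (orders m) = (2 * m)%nat.
Proof. intros Hm. unfold orders. rewrite length_app, length_seq. simpl. lia. Qed.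

Lemma orders_even m q : In q (orders m) -> Nat.even q = true -> q
  = (2 * Nat.div2 q)%nat /\ (Nat.div2 q <= m)%nat.
Proof.
  intros I E. apply Nat.even_spec in E. destruct E as [c ->]. rewrite Nat.div2_double. split; auto.
  apply in_app_or in I. destruct I as [I|[I|[]]]; [apply in_seq in I|]; lia.
Qed.
Lemma orders_odd m q : In q (orders m) -> Nat.even q = false -> q
  = (1 + 2 * Nat.div2 q)%nat /\ (2 + Nat.div2 q <= m)%nat.
Proof.
  intros I E. assert (O : Nat.odd q = true) by (unfold Nat.odd; rewrite E; auto).
  apply Nat.odd_spec in O. destruct O as [c ->].
  replace (2 * c + 1)%nat with (S (2 * c)) by lia. rewrite Nat.div2_succ_double. split; [lia|].
  apply in_app_or in I. destruct I as [I|[I|[]]]; [apply in_seq in I|]; lia.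
Qed.

Lemma monomial_theta m q : In q (orders m) -> theta_space (INR m * alpha1) (monomial m q).
Proof.
  intros I. unfold monomial.
  assert (E2 : alpha1 * s3 = PI * INR (2 * 1)) by (simpl; pose proof alpha1_s3; lra).
  assert (E4 : 2 * alpha1 * s3 = PI * INR (2 * 2)) by (simpl; pose proof alpha1_s3; lra).
  assert (T0 : theta_space alpha1 F0) by (apply (proj_theta alpha1 1); auto; apply base2).
  assert (T2 : theta_space alpha1 F2) by (apply (proj_theta alpha1 1); auto; apply base2).
  assert (T1 : theta_space (2 * alpha1) F1) by (apply (proj_theta (2 * alpha1) 2); auto;
    apply base4).
  destruct (Nat.even q) eqn:E.
  - destruct (orders_even m q I E) as [_ Hc].
    replace (INR m * alpha1) with (INR (m - Nat.div2 q) * alpha1 + INR (Nat.div2 q) * alpha1)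
      by (rewrite minus_INR by auto; ring).
    exact (theta_mult _ _ _ _ (theta_pow alpha1 F0 _ T0) (theta_pow alpha1 F2 _ T2)).
  - destruct (orders_odd m q I E) as [_ Hc].
    assert (Hc1 : (2 <= m)%nat) by (revert Hc; generalize (Nat.div2 q); lia).
    assert (Hc2 : (Nat.div2 q <= m - 2)%nat) by (revert Hc; generalize (Nat.div2 q); lia).
    replace (INR m * alpha1) with (INR (m - 2 - Nat.div2 q) * alpha1 + 2 * alpha1 + INR (Nat.div2 q)
      * alpha1)
      by (rewrite (minus_INR (m - 2) (Nat.div2 q) Hc2), (minus_INR m 2 Hc1); simpl (INR 2); ring).
    exact (theta_mult _ _ _ _ (theta_mult _ _ _ _ (theta_pow alpha1 F0 _ T0) T1)
      (theta_pow alpha1 F2 _ T2)).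
Qed.

Lemma weight_add u v : (weight u * weight v)%C = weight (u + v).
Proof. unfold weight. rewrite <- cis_add, plus_INR. f_equal. field. Qed.
Lemma weight_pow u n : Cpow (weight u) n = weight (n * u).
Proof. unfold weight. rewrite cis_pow, mult_INR. f_equal. field. Qed.

Lemma monomial_weight m q z : In q (orders m) -> monomial m q (eta * z)%C
  = (weight q * monomial m q z)%C.
Proof.
  intros I. unfold monomial.
  assert (R0 : F0 (eta * z)%C = F0 z).
  { unfold F0. rewrite (proj_rot _ (weight 0) _ z (dual_weight6 0) (dual_weight_weight 0)).
    replace (weight 0) with (RtoC 1); [ring|]. rewrite <- (dual_weight_weight 0),
      dual_weight_0. ring. }
  assert (R1 : F1 (eta * z)%C = (weight 1 * F1 z)%C) by (apply proj_rot;
    [apply dual_weight6|apply dual_weight_weight]).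
  assert (R2 : F2 (eta * z)%C = (weight 2 * F2 z)%C) by (apply proj_rot;
    [apply dual_weight6|apply dual_weight_weight]).
  destruct (Nat.even q) eqn:E; rewrite R0, R2, Cpow_mult_l, weight_pow.
  - destruct (orders_even m q I E) as [Hq _]. replace (Nat.div2 q * 2)%nat with q by lia. ring.
  - destruct (orders_odd m q I E) as [Hq _]. rewrite R1.
    replace (weight q) with (weight 1 * weight (Nat.div2 q * 2))%C by (rewrite weight_add; f_equal;
      lia). ring.
Qed.

Lemma monomial_ord m q : In q (orders m) -> exists c : C, c <> 0 /\ ord (monomial m q) q c.
Proof.
  intros I. destruct F0_ord as (c0 & N0 & O0). destruct F1_ord as (c1 & N1 & O1).
  destruct F2_ord as (c2 & N2 & O2). unfold monomial.
  destruct (Nat.even q) eqn:E.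
  - destruct (orders_even m q I E) as [Hq _].
    assert (O := ord_mult _ _ _ _ _ _ (ord_pow F0 0 c0 (m - Nat.div2 q) O0)
      (ord_pow F2 2 c2 (Nat.div2 q) O2)).
    replace ((m - Nat.div2 q) * 0 + Nat.div2 q * 2)%nat with q in O by lia.
    eexists; split; [|exact O]. apply Cmult_neq_0; apply Cpow_nz; auto.
  - destruct (orders_odd m q I E) as [Hq _].
    assert (O := ord_mult _ _ _ _ _ _ (ord_mult _ _ _ _ _ _
      (ord_pow F0 0 c0 (m - 2 - Nat.div2 q) O0) O1) (ord_pow F2 2 c2 (Nat.div2 q) O2)).
    replace ((m - 2 - Nat.div2 q) * 0 + 1 + Nat.div2 q * 2)%nat with q in O by lia.
    eexists; split; [|exact O]. apply Cmult_neq_0; [apply Cmult_neq_0; auto|]; apply Cpow_nz; auto.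
Qed.

Lemma finite_choice {A B} (l : list A) (P : A -> B -> Prop) (d : B) :
  (forall x y : A, {x = y} + {x <> y}) ->
  (forall x, In x l -> exists y, P x y) -> exists f : A -> B, forall x, In x l -> P x (f x).
Proof.
  intros eqd. induction l as [|x l IH]; intros H.
  - exists (fun _ => d). intros _ [].
  - destruct IH as [f Hf]. { intros; apply H; simpl; auto. }
    destruct (H x) as [y Hy]; [simpl; auto|].
    exists (fun z => if eqd z x then y else f z). intros z [->|Iz]; destruct (eqd z _) as [E|E];
      subst; auto.
    congruence.
Qed.

Definition wave (m q : nat) : Heis -> C := gauss (INR m * alpha1) (monomial m q).

Lemma wave_independent m : independent (orders m) (wave m).
Proof.
  intros a Ha.
  destruct (finite_choice (orders m) (fun q (c : C) => c <> 0 /\ ord (monomial m q) q c) (RtoC 0)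
    Nat.eq_dec)
    as [c Hc]. { apply monomial_ord. }
  apply (ord_independent (orders m) (monomial m) c a (orders_NoDup m)).
  - intros q Iq; apply Hc; auto.
  - intros q Iq; apply Hc; auto.
  - intros z. specialize (Ha (z, 0)). unfold wave, gauss in Ha. cbn [fst snd] in Ha.
    set (G := Cexp (RtoC (- (INR m * alpha1)) * (z * Cconj z))%C) in Ha.
    rewrite Rmult_0_r, cis_0 in Ha.
    rewrite (csum_ext _ _ (fun x => (G * (a x * monomial m x z))%C)) in Ha by (intros; ring).
    rewrite csum_scal in Ha.
    destruct (Ceq_dec (csum (orders m) (fun x => (a x * monomial m x z)%C)) (RtoC 0)) as [|N]; auto.
    exfalso. exact (Cmult_neq_0 _ _ (Cexp_neq_0 _) N Ha).
Qed.

Lemma wave_ground m q : In q (orders m) -> ground (INR m * alpha1) (wave m q).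
Proof. intros I; apply theta_ground, monomial_theta; auto. Qed.

Lemma wave_rot m q p : In q (orders m) -> rot (wave m q) p = (weight q * wave m q p)%C.
Proof. intros I. apply gauss_rot. intros z; apply monomial_weight; auto. Qed.

(** * Invariant eigenfunctions as rotation eigenfunctions in a Landau level *)

Lemma freq_shift a f z t s : freq a f -> f (z, t + s) = (cis (a * s) * f (z, t))%C.
Proof.
  intros H. rewrite (H z (t + s)), (H z t), Rmult_plus_distr_l, cis_add. ring.
Qed.

Lemma cis_mult_cancel t x y : (cis t * x)%C = y -> x = (cis (- t) * y)%C.
Proof.
  intros <-. rewrite Cmult_assoc, cis_inv by ring. ring.
Qed.

Definition rot_eigen (n : Z) (f : Heis -> C) : Prop :=
  forall p, rot f p = (cis (- (PI * IZR n / 3)) * f p)%C.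

Lemma Im_eta_conj z : Im (eta * Cconj z)%C = - Im (Cconj eta * z)%C.
Proof. rewrite eta_eq. destruct z; simpl; ring. Qed.

(** The central generator acts trivially because a c is a multiple of 2 pi, and the central
    part c / 6 of the rotation contributes exp (i a c / 6) = exp (i pi n / 3). *)
Lemma invariant_iff_qp a c n f : freq a f -> a * c = 2 * PI * IZR n ->
  invariant_fun (Gamma c) f <-> qp a 1 f /\ qp a eta f /\ rot_eigen n f.
Proof.
  intros Ht Hac. rewrite invariant_Gamma_iff. split.
  - intros (I1 & I2 & I3 & I4). split; [|split].
    + intros z t. specialize (I1 z t). unfold Rminus in I1. rewrite (freq_shift a) in I1 by auto.
      apply cis_mult_cancel in I1. rewrite I1. f_equal. f_equal.
      destruct z; simpl; ring.
    + intros z t. specialize (I2 z t). rewrite (freq_shift a) in I2 by auto.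
      apply cis_mult_cancel in I2. rewrite I2, Im_eta_conj. f_equal. f_equal. ring.
    + intros [z t]. specialize (I4 z t). rewrite (freq_shift a) in I4 by auto.
      apply cis_mult_cancel in I4. unfold rot. cbn [fst snd]. rewrite I4. f_equal. f_equal.
      replace (a * (c / 6)) with (a * c / 6) by field. rewrite Hac. field.
  - intros (Q1 & Q2 & HR). split; [|split; [|split]]; intros z t.
    + unfold Rminus. rewrite (freq_shift a), Q1, Cmult_assoc,
        cis_inv by (auto; destruct z; simpl; ring). ring.
    + rewrite (freq_shift a), Q2, Im_eta_conj, Cmult_assoc, cis_inv by (auto; ring). ring.
    + rewrite (freq_shift a), Hac, cis_2PI by auto. ring.
    + rewrite (freq_shift a) by auto. specialize (HR (z, t)). unfold rot in HR. cbn [fst snd] in HR.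
      rewrite HR, Cmult_assoc, cis_inv; [ring|].
      replace (a * (c / 6)) with (a * c / 6) by field. rewrite Hac. field.
Qed.

Lemma RtoC_div_r (a r : R) : r <> 0 -> RtoC (a / r) = (a * / r)%C.
Proof. intros Hr. unfold Rdiv. rewrite RtoC_mult, RtoC_inv; auto. Qed.

Lemma RtoC_nz (r : R) : r <> 0 -> RtoC r <> 0.
Proof. intros H E; apply H, RtoC_inj; auto. Qed.

Lemma reeb_iff_freq a r f : r <> 0 -> smooth f ->
  (forall p, (/ Ci * reeb r f p)%C = (RtoC (a / r) * f p)%C) <-> freq a f.
Proof.
  intros Hr Hs. pose proof (RtoC_nz r Hr) as Hrc. pose proof Ci_nz as HCi. unfold reeb.
  rewrite !RtoC_div_r by auto. split.
  - intros HT. apply freq_of_dt; auto. intros p. specialize (HT p).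
    transitivity (Ci * r * (/ Ci * (1 * / r * d_t f p)))%C.
    + field. split; auto.
    + rewrite HT. field. auto.
  - intros Ht p. rewrite (freq_d_t a) by auto. field. split; auto.
Qed.

(** The commutator turns Zbar Z into Z Zbar minus a constant. *)
Lemma sublaplacian_iff a b r f p : r <> 0 -> smooth f -> freq a f ->
  sublaplacian r f p = (RtoC ((b + a) / r) * f p)%C <->
  Zop (Zbarop f) p = (RtoC (- b) * f p)%C.
Proof.
  intros Hr Hs Ht. pose proof (RtoC_nz r Hr) as Hrc. unfold sublaplacian.
  assert (K := freq_commutator a f p Hs Ht).
  replace (Zbarop (Zop f) p) with (Zop (Zbarop f) p - RtoC (2 * a) * f p)%C by (rewrite K; ring).
  rewrite !RtoC_opp, !RtoC_div_r, RtoC_plus, !RtoC_mult by lra.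
  set (X := Zop (Zbarop f) p). set (F := f p).
  split; intros E.
  - transitivity (- r * (- (1 * / (2 * r)) * (X + (X - 2 * a * F))) + a * F)%C.
    + field. auto.
    + rewrite E. field. auto.
  - rewrite E. field. auto.
Qed.

Lemma joint_iff_level a c r k n f : r <> 0 -> a * c = 2 * PI * IZR n ->
  joint_eigenspace (Gamma c) r ((2 * INR k + 1) * a / r) (a / r) f <->
  level a k f /\ rot_eigen n f.
Proof.
  intros Hr Hac.
  replace ((2 * INR k + 1) * a / r) with ((2 * a * INR k + a) / r) by (field; auto).
  unfold joint_eigenspace, level, section. split.
  - intros (Hs & Hi & HL & HT). apply reeb_iff_freq in HT; auto.
    apply (invariant_iff_qp a c n f HT Hac) in Hi. destruct Hi as (Q1 & Q2 & HR).
    split; auto. split; auto. intros p. apply (sublaplacian_iff a (2 * a * INR k) r); auto.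
  - intros [[(Hs & Ht & Q1 & Q2) HL] HR]. split; [auto|split; [|split]].
    + apply (invariant_iff_qp a c n f Ht Hac); auto.
    + intros p. apply sublaplacian_iff; auto.
    + apply reeb_iff_freq; auto.
Qed.

(** * Cosines of multiples of pi/6 *)

Definition cos6 (i : Z) : R := cos (PI * IZR i / 6).

Lemma cos6_period i j : cos6 (i + 12 * j) = cos6 i.
Proof.
  unfold cos6. rewrite plus_IZR, mult_IZR.
  replace (PI * (IZR i + 12 * IZR j) / 6) with (PI * IZR i / 6 + 2 * PI * IZR j) by field.
  rewrite cos_plus, cos_2PI_IZR, sin_2PI_IZR. ring.
Qed.

Lemma cos6_table : cos6 0 = 1 /\ cos6 1 = s3 / 2 /\ cos6 2 = 1 / 2 /\ cos6 3 = 0 /\ cos6 4 =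
  - (1 / 2) /\ cos6 5 = - (s3 / 2) /\
  cos6 6 = -1 /\ cos6 7 = - (s3 / 2) /\ cos6 8 = - (1 / 2) /\ cos6 9 = 0 /\ cos6 10 = 1
    / 2 /\ cos6 11 = s3 / 2.
Proof.
  assert (T0 : cos6 0 = 1) by (unfold cos6; replace (PI * 0 / 6) with 0 by field; apply cos_0).
  assert (T1 : cos6 1 = s3 / 2) by (unfold cos6; replace (PI * 1 / 6) with (PI / 6) by field;
    apply cos_PI6).
  assert (T2 : cos6 2 = 1 / 2) by (unfold cos6; replace (PI * 2 / 6) with (PI / 3) by field;
    apply cos_PI3).
  assert (T3 : cos6 3 = 0) by (unfold cos6; replace (PI * 3 / 6) with (PI / 2) by field;
    apply cos_PI2).
  assert (Neg : forall i, cos6 (6 - i) = - cos6 i).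
  { intros i. unfold cos6. rewrite minus_IZR. replace (PI * (6 - IZR i) / 6) with
    (- (PI * IZR i / 6) + PI) by field.
    rewrite neg_cos, cos_neg. reflexivity. }
  assert (Sym : forall i, cos6 (12 - i) = cos6 i).
  { intros i. replace (12 - i)%Z with (- i + 12 * 1)%Z by ring. rewrite cos6_period. unfold cos6.
    rewrite opp_IZR. replace (PI * - IZR i / 6) with (- (PI * IZR i / 6)) by field. apply cos_neg. }
  assert (T4 := Neg 2%Z). assert (T5 := Neg 1%Z). assert (T6 := Neg 0%Z).
  assert (T7 := Sym 5%Z). assert (T8 := Sym 4%Z). assert (T9 := Sym 3%Z).
  assert (T10 := Sym 2%Z). assert (T11 := Sym 1%Z). simpl in *.
  repeat split; lra.
Qed.

Lemma cos6_values i : (0 <= i < 12)%Z -> cos6 i = 1 -> i = 0%Z.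
Proof.
  intros Hi H. destruct cos6_table as (T0 & T1 & T2 & T3 & T4 & T5 & T6 & T7 & T8 & T9 & T10 & T11).
  assert (S3 : s3 < 2).
  { pose proof s3_sq. pose proof s3_pos. nra. }
  pose proof s3_pos.
  assert (C : (i = 0 \/ i = 1 \/ i = 2 \/ i = 3 \/ i = 4 \/ i = 5 \/ i = 6 \/ i = 7 \/ i = 8 \/ i
    = 9 \/ i = 10 \/ i = 11)%Z) by lia.
  decompose [or] C; subst; auto; exfalso; lra.
Qed.

(** The real part alone detects 1 on the unit circle, and it is a value of [cos6]. *)
Lemma cis_third_one j : cis (PI * IZR j / 3) = 1 <-> (j mod 6 = 0)%Z.
Proof.
  assert (E : Re (cis (PI * IZR j / 3)) = cos6 (2 * (j mod 6))).
  { rewrite cis_cs. cbn [Re fst]. rewrite <- (cos6_period (2 * (j mod 6)) (j / 6)). unfold cos6.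
    f_equal.
    replace (2 * (j mod 6) + 12 * (j / 6))%Z with (2 * j)%Z by (pose proof (Z.div_mod j 6); lia).
    rewrite mult_IZR. field. }
  pose proof (Z.mod_pos_bound j 6 ltac:(lia)).
  split; intros H'.
  - rewrite H' in E. symmetry in E. apply cos6_values in E; lia.
  - replace j with (6 * (j / 6))%Z by (pose proof (Z.div_mod j 6); lia).
    rewrite mult_IZR. replace (PI * (6 * IZR (j / 6)) / 3) with (2 * PI * IZR (j / 6)) by field.
      apply cis_2PI.
Qed.

(** * Dimension of the rotation eigenspaces *)

(** With s = n - k: the rotation multiplies the wave of order q, raised k times, by exp (i
    pi (q - k) / 3), which has to be exp (- i pi n / 3). *)
Definition admissible (s : Z) (q : nat) : bool := ((s + Z.of_nat q) mod 6 =? 0)%Z.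

(** The raised waves are a basis of the level consisting of rotation eigenfunctions, so an
    eigenspace is spanned by the waves with the right eigenvalue. *)
Lemma level_rot_dim m n k : (0 < m)%nat ->
  has_dim (fun f => level (INR m * alpha1) k f /\ rot_eigen n f)
    (length (filter (admissible (n - Z.of_nat k)) (orders m))).
Proof.
  intros Hm. set (a := INR m * alpha1). set (s := (n - Z.of_nat k)%Z).
  assert (Ha2 : 0 < alpha1). { unfold alpha1. apply Rdiv_lt_0_compat;
    [pose proof PI_RGT_0; lra|apply s3_pos]. }
  assert (Ha : 0 < a). { unfold a. apply Rmult_lt_0_compat; auto. apply lt_0_INR; auto. }
  assert (HaM : a * s3 = PI * INR (2 * m)).
  { unfold a. rewrite Rmult_assoc, alpha1_s3, mult_INR. simpl (INR 2). ring. }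
  set (b := fun q => raise k (wave m q)).
  assert (Gr : forall q, In q (orders m) -> ground a (wave m q)) by (intros; apply wave_ground;
    auto).
  assert (Ind : independent (orders m) b).
  { apply (raise_independent a k (orders m) (wave m) Ha Gr). apply wave_independent. }
  assert (Rb : forall q p, In q (orders m) -> rot (b q) p
    = (cis (PI * IZR (Z.of_nat q - Z.of_nat k) / 3) * b q p)%C).
  { intros q p Iq. unfold b. rewrite (raise_rot a k (wave m q) (weight q)).
    - f_equal. unfold weight. rewrite <- cis_add. f_equal. rewrite minus_IZR,
        <- !INR_IZR_INZ. field.
    - apply Gr; auto.
    - intros; apply wave_rot; auto. }
  apply (has_dim_of_list Nat.eq_dec _ _ b).
  - apply NoDup_filter, orders_NoDup.
  - intros q Iq. apply filter_In in Iq. destruct Iq as [Iq Aq]. split.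
    + apply raise_level; auto.
    + intros p. rewrite Rb by auto. f_equal.
      unfold admissible in Aq. apply Z.eqb_eq in Aq. apply cis_third_one in Aq.
      rewrite <- (Cmult_1_r (cis (- _))), <- Aq, <- cis_add. f_equal.
      unfold s. rewrite plus_IZR, !minus_IZR. field.
  - intros c Hc q Iq.
    set (c' := fun x => if admissible s x then c x else RtoC 0).
    assert (E : c' q = 0).
    { apply (Ind c').
      - intros p. rewrite (csum_filter (admissible s)).
        + rewrite <- (Hc p). apply csum_ext. intros x Ix. apply filter_In in Ix. unfold c'. rewrite
            (proj2 Ix). reflexivity.
        + intros x _ Ax. unfold c'. rewrite Ax. ring.
      - apply filter_In in Iq; apply Iq. }
    unfold c' in E. apply filter_In in Iq. rewrite (proj2 Iq) in E. exact E.
  - intros f [Lf Rf].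
    destruct (level_spans a (2 * m) k (orders m) (wave m) Ha ltac:(lia) HaM (orders_NoDup m)
      (orders_length m Hm) Gr
      (wave_independent m) f Lf) as [c Hc].
    exists c. intros p. rewrite Hc. apply csum_filter. intros q Iq Aq.
    assert (Z0 : (c q * (cis (PI * IZR (Z.of_nat q - Z.of_nat k) / 3) - cis (- (PI * IZR n / 3))))%C
      = 0).
    { apply (Ind (fun q => (c q * (cis (PI * IZR (Z.of_nat q - Z.of_nat k) / 3)
      - cis (- (PI * IZR n / 3))))%C)); auto.
      intros p'.
      transitivity (rot f p' - cis (- (PI * IZR n / 3)) * f p')%C.
      - assert (E1 : rot f p' = csum (orders m) (fun q => (c q * rot (b q) p')%C)).
        { unfold rot. rewrite Hc. reflexivity. }
        rewrite E1, (Hc p').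
        transitivity (csum (orders m) (fun q => (c q * rot (b q) p')%C) + - cis (- (PI * IZR n / 3))
          * csum (orders m) (fun x => (c x * raise k (wave m x) p')%C))%C; [|ring].
        rewrite <- csum_scal, <- csum_plus. apply csum_ext. intros x Ix. rewrite Rb by auto. unfold
          b. ring.
      - rewrite Rf. ring. }
    destruct (Ceq_dec (c q) (RtoC 0)) as [->|Nc]; [ring|]. exfalso.
    apply (Cmult_neq_0 _ _ Nc) in Z0; auto. apply Cminus_eq_contra. intros E.
    unfold admissible in Aq. apply Z.eqb_neq in Aq. apply Aq. apply cis_third_one.
    replace (PI * IZR (s + Z.of_nat q) / 3) with
      (PI * IZR (Z.of_nat q - Z.of_nat k) / 3 + PI * IZR n / 3)
      by (unfold s; rewrite plus_IZR, !minus_IZR; field).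
    rewrite cis_add, E. apply cis_inv. ring.
Qed.

(** * Counting admissible weights *)

(** The multiplicity formula for M = 2m, with s = |n| - k. *)
Definition count_value (m : nat) (s : Z) : R :=
  1 / 6 * (2 * INR m + 2 * cos6 (6 * s) + 2 * cos6 (2 * s + 2) + 2 / s3 * cos6 (4 * s + 1)
     + 4 / s3 * cos6 (4 * (s + 2 * Z.of_nat m) + 1)).

Lemma filter_seq_shift (s : Z) a d L :
  length (filter (admissible s) (seq (a + d) L))
    = length (filter (admissible (s + Z.of_nat d)) (seq a L)).
Proof.
  revert a; induction L as [|L IH]; intros a; simpl; auto.
  assert (E : admissible s (a + d) = admissible (s + Z.of_nat d) a).
  { unfold admissible. f_equal. f_equal. lia. }
  rewrite E. specialize (IH (S a)). simpl in IH. destruct (admissible (s + Z.of_nat d) a); simpl;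
    congruence.
Qed.

Lemma admissible_mod s q : admissible s q = admissible (s mod 6) q.
Proof. unfold admissible. rewrite Zplus_mod_idemp_l. reflexivity. Qed.

Lemma admissible_period s q : admissible (s + 6) q = admissible s q.
Proof. rewrite admissible_mod, (admissible_mod s). f_equal. replace (s + 6)%Z with (s + 1 * 6)%Z by
  ring. apply Z_mod_plus_full. Qed.

Lemma residues (r : Z) : (0 <= r < 6)%Z -> (r = 0 \/ r = 1 \/ r = 2 \/ r = 3 \/ r = 4 \/ r = 5)%Z.
Proof. lia. Qed.

Lemma count_six s : length (filter (admissible s) (seq 0 6)) = 1%nat.
Proof.
  rewrite (filter_ext _ (admissible (s mod 6))) by (intros; apply admissible_mod).
  destruct (residues (s mod 6)) as [H|[H|[H|[H|[H|H]]]]]; try rewrite H; try reflexivity.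
  apply Z.mod_pos_bound; lia.
Qed.

(** Six more consecutive weights appear, one of which is admissible, and the isolated weight
    2m is replaced by 2m + 6. *)
Lemma count_step m s : (0 < m)%nat ->
  length (filter (admissible s) (orders (m + 3))) = S (length (filter (admissible s) (orders m))).
Proof.
  intros Hm. unfold orders. rewrite !filter_app, !length_app.
  replace (2 * (m + 3) - 1)%nat with (6 + (2 * m - 1))%nat by lia.
  rewrite seq_app, filter_app, length_app, count_six.
  rewrite filter_seq_shift.
  rewrite (filter_ext (admissible (s + Z.of_nat 6)) (admissible s)) by (intros;
    apply admissible_period).
  assert (E : admissible s (2 * (m + 3)) = admissible s (2 * m)).
  { rewrite <- (admissible_period s (2 * m)). unfold admissible. f_equal. f_equal. lia. }
  cbn [filter]. rewrite E. destruct (admissible s (2 * m)); simpl; lia.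
Qed.

Lemma count_value_mod m s : count_value m s = count_value m (s mod 6).
Proof.
  pose proof (Z.div_mod s 6 ltac:(lia)) as D. set (t := (s / 6)%Z) in *. set (q := (s mod 6)%Z) in
    *.
  unfold count_value. rewrite D.
  replace (6 * (6 * t + q))%Z with (6 * q + 12 * (3 * t))%Z by ring.
  replace (2 * (6 * t + q) + 2)%Z with (2 * q + 2 + 12 * t)%Z by ring.
  replace (4 * (6 * t + q) + 1)%Z with (4 * q + 1 + 12 * (2 * t))%Z by ring.
  replace (4 * (6 * t + q + 2 * Z.of_nat m) + 1)%Z with
    (4 * (q + 2 * Z.of_nat m) + 1 + 12 * (2 * t))%Z by ring.
  rewrite !cos6_period. reflexivity.
Qed.

Lemma count_value_step m s : count_value (m + 3) s = count_value m s + 1.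
Proof.
  unfold count_value.
  replace (4 * (s + 2 * Z.of_nat (m + 3)) + 1)%Z with (4 * (s + 2 * Z.of_nat m) + 1 + 12 * 2)%Z by
    lia.
  rewrite cos6_period, plus_INR. simpl (INR 3). field. pose proof s3_pos; lra.
Qed.

Lemma cos6_red i : cos6 i = cos6 (i mod 12).
Proof.
  rewrite (Z.div_mod i 12) at 1 by lia. rewrite Z.add_comm. apply cos6_period.
Qed.

Lemma count_base m s : (m = 1 \/ m = 2 \/ m = 3)%nat ->
  INR (length (filter (admissible s) (orders m))) = count_value m s.
Proof.
  intros Hm. rewrite count_value_mod.
  rewrite (filter_ext _ (admissible (s mod 6))) by (intros; apply admissible_mod).
  destruct cos6_table as (T0 & T1 & T2 & T3 & T4 & T5 & T6 & T7 & T8 & T9 & T10 & T11).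
  pose proof s3_pos as S3.
  destruct (residues (s mod 6)) as [H|[H|[H|[H|[H|H]]]]]; [apply Z.mod_pos_bound; lia|..];
    rewrite H; destruct Hm as [ -> |[ -> | -> ]];
    (* Evaluate the number of admissible weights, then reduce each cosine modulo 12. *)
    match goal with |- INR ?x = _ => let y := eval vm_compute in x in change x with y end;
    unfold count_value;
    repeat match goal with |- context [cos6 ?i] => rewrite (cos6_red i);
      let y := eval vm_compute in (i mod 12)%Z in change (i mod 12)%Z with y;
      first [rewrite T0|rewrite T1|rewrite T2|rewrite T3|rewrite T4|rewrite T5|rewrite T6|rewrite T7
        |rewrite T8|rewrite T9|rewrite T10|rewrite T11] end;
    simpl INR; field; lra.
Qed.

(** Induction in steps of 3; with the period 6 in s this reduces the formula to 18 cases. *)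
Lemma count_formula m s : (0 < m)%nat ->
  INR (length (filter (admissible s) (orders m))) = count_value m s.
Proof.
  induction m as [m IH] using (well_founded_induction Wf_nat.lt_wf). intros Hm.
  destruct (Nat.lt_ge_cases 3 m) as [H|H].
  - replace m with (m - 3 + 3)%nat by lia.
    rewrite count_step, count_value_step, S_INR, IH by lia. reflexivity.
  - apply count_base. lia.
Qed.

Lemma powerRZ_cos6 j : powerRZ (-1) j = cos6 (6 * j).
Proof.
  assert (H2 : forall t, cos6 (6 * (2 * t)) = 1).
  { intros t. replace (6 * (2 * t))%Z with (0 + 12 * t)%Z by ring. rewrite cos6_period. apply
    cos6_table. }
  assert (H3 : forall t, cos6 (6 * (2 * t + 1)) = -1).
  { intros t. replace (6 * (2 * t + 1))%Z with (6 + 12 * t)%Z by ring. rewrite cos6_period. apply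
    cos6_table. }
  assert (P2 : forall t, powerRZ (-1) (2 * t) = 1).
  { intros t. destruct t as [|p|p]; simpl; auto.
    - rewrite Pos2Nat.inj_xO, pow_1_even; auto.
    - rewrite Pos2Nat.inj_xO, pow_1_even. apply Rinv_1. }
  destruct (Z.Even_or_Odd j) as [[t ->]|[t ->]].
  - rewrite H2; apply P2.
  - rewrite H3, powerRZ_add, P2 by lra. simpl. ring.
Qed.

(** * Opposite frequencies *)

(** Conjugation exchanges Z and Zbar, so it preserves the sub-Laplacian, whereas i^-1 T
    changes sign. *)
Lemma joint_conj G r a b f : joint_eigenspace G r a b f ->
  joint_eigenspace G r a (- b) (fun p => Cconj (f p)).
Proof.
  intros (Hs & Hi & HL & HT). split; [apply smooth_conj; auto|split; [|split]].
  - intros x h Gx. rewrite (Hi x h Gx). reflexivity.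
  - intros p. unfold sublaplacian.
    assert (E1 : Zop (Zbarop (fun p => Cconj (f p))) p = Cconj (Zbarop (Zop f) p)).
    { replace (Zbarop (fun p => Cconj (f p))) with (fun p => Cconj (Zop f p))
        by (apply functional_extensionality; intros; symmetry; apply Zbarop_conj; auto).
      apply Zop_conj, smooth_Zop; auto. }
    assert (E2 : Zbarop (Zop (fun p => Cconj (f p))) p = Cconj (Zop (Zbarop f) p)).
    { replace (Zop (fun p => Cconj (f p))) with (fun p => Cconj (Zbarop f p))
        by (apply functional_extensionality; intros; symmetry; apply Zop_conj; auto).
      apply Zbarop_conj, smooth_Zbarop; auto. }
    assert (R : forall x, RtoC x = Cconj (RtoC x)) by (intros; re_im).
    rewrite E1, E2, (R (- (1 / (2 * r)))), (R a), <- Cplus_conj, <- !Cmult_conj.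
    f_equal. rewrite <- HL. unfold sublaplacian. ring.
  - intros p. unfold reeb.
    assert (E : d_t (fun p => Cconj (f p)) p = Cconj (d_t f p)).
    { apply (grad_eq _ _ _ _ _ (grad_conj _ _ _ _ _ (grad_smooth f Hs p))). }
    rewrite E. specialize (HT p). unfold reeb in HT.
    replace (/ Ci * (RtoC (1 / r) * Cconj (d_t f p)))%C with
      (- Cconj (/ Ci * (RtoC (1 / r) * d_t f p))%C)%C.
    + rewrite HT, RtoC_opp, Cmult_conj. replace (Cconj (RtoC b)) with (RtoC b) by re_im. ring.
    + rewrite !Cmult_conj, Cinv_conj by apply Ci_nz.
      replace (Cconj (RtoC (1 / r))) with (RtoC (1 / r)) by re_im.
      replace (Cconj Ci) with (- Ci)%C by re_im. field. apply Ci_nz.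
Qed.

Lemma lincomb_conj d a B p : Cconj (lincomb d a B p) =
  lincomb d (fun i => Cconj (a i)) (fun i p => Cconj (B i p)) p.
Proof.
  unfold lincomb.
  assert (E : forall (u : nat -> C) lo hi, Cconj (sum_n_m u lo hi)
    = sum_n_m (fun i => Cconj (u i)) lo hi).
  { intros u lo hi. destruct (Nat.le_gt_cases lo hi) as [H|H].
    - induction hi as [|hi IH].
      + replace lo with 0%nat by lia. rewrite !sum_n_n. reflexivity.
      + destruct (Nat.eq_dec lo (S hi)) as [->|N]; [rewrite !sum_n_n; reflexivity|].
        rewrite !sum_n_Sm by lia. rewrite <- IH by lia.
        change (Cconj (sum_n_m u lo hi + u (S hi))%C
          = (Cconj (sum_n_m u lo hi) + Cconj (u (S hi)))%C).
        apply Cplus_conj.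
    - rewrite !sum_n_m_zero by lia. change (Cconj 0 = 0). re_im. }
  rewrite E. apply sum_n_m_ext. intros i. apply Cmult_conj.
Qed.

Lemma has_dim_conj V W d : (forall f, V f -> W (fun p => Cconj (f p))) ->
  (forall f, W f -> V (fun p => Cconj (f p))) -> has_dim V d -> has_dim W d.
Proof.
  intros VW WV (B & H1 & H2 & H3).
  assert (CC : forall x : C, Cconj (Cconj x) = x) by (intros [x y]; re_im).
  assert (C0 : Cconj 0 = 0) by re_im.
  exists (fun i p => Cconj (B i p)). split; [|split].
  - intros i Hi; apply VW; auto.
  - intros a Ha i Hi.
    rewrite <- (CC (a i)), <- C0. f_equal.
    apply (H2 (fun i => Cconj (a i))); auto.
    intros p. rewrite <- (CC (lincomb _ _ _ p)), lincomb_conj.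
    rewrite <- C0. f_equal. rewrite <- (Ha p). f_equal.
    apply functional_extensionality; intros; apply CC.
  - intros f Hf. destruct (H3 _ (WV f Hf)) as [a Ha].
    exists (fun i => Cconj (a i)). intros p. rewrite <- lincomb_conj, <- Ha. symmetry; apply CC.
Qed.

Lemma has_dim_iff (V W : (Heis -> C) -> Prop) d : (forall f, V f <-> W f) -> has_dim V d ->
  has_dim W d.
Proof.
  intros E (B & H1 & H2 & H3). exists B. split; [intros i Hi; apply E, H1; auto|split; auto].
  intros f Hf. apply H3, E; auto.
Qed.

(** * Multiplicities at nonzero frequency *)

Lemma multiplicity_positive N c r n k : Nat.Even N -> (0 < N)%nat -> c = 4 * Im eta / INR N -> 0
  < r ->
  (0 < n)%Z -> exists m : nat,
  multiplicity (Gamma c) r ((4 * INR k + 2) * PI * IZR n / (c * r)) (2 * PI * IZR n / (c * r)) m /\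
  INR m = count_value (Z.to_nat n * Nat.div2 N) (n - Z.of_nat k).
Proof.
  intros HN HN0 Hc Hr Hn.
  destruct HN as [h Hh]. set (m := (Z.to_nat n * Nat.div2 N)%nat).
  assert (Hd : Nat.div2 N = h) by (rewrite Hh; apply Nat.div2_double).
  assert (Hm : (0 < m)%nat) by (unfold m; rewrite Hd; nia).
  pose proof s3_pos as S3. pose proof PI_RGT_0 as HPI.
  assert (HINR : INR N = 2 * INR h) by (rewrite Hh, mult_INR; simpl; ring).
  assert (Hh0 : 0 < INR h) by (apply lt_0_INR; lia).
  assert (Hc' : c = s3 / INR h).
  { rewrite Hc, HINR, eta_eq. simpl. field. lra. }
  assert (Hc0 : 0 < c) by (rewrite Hc'; apply Rdiv_lt_0_compat; auto).
  set (a := INR m * alpha1).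
  assert (Hac : a * c = 2 * PI * IZR n).
  { unfold a, m. rewrite Hd, mult_INR, INR_IZR_INZ,
    Z2Nat.id by lia. rewrite Hc'. unfold alpha1. field. split; lra. }
  exists (length (filter (admissible (n - Z.of_nat k)) (orders m))). split.
  - unfold multiplicity.
    assert (E1 : (4 * INR k + 2) * PI * IZR n / (c * r) = (2 * INR k + 1) * a / r).
    { replace a with (2 * PI * IZR n / c); [field; split; lra|]. rewrite <- Hac. field; lra. }
    assert (E2 : 2 * PI * IZR n / (c * r) = a / r).
    { rewrite <- Hac. field; split; lra. }
    rewrite E1, E2.
    eapply has_dim_iff; [|apply (level_rot_dim m n k Hm)].
    intros f. symmetry. apply joint_iff_level; auto; apply Rgt_not_eq; auto.
  - apply count_formula; auto.
Qed.

Lemma count_value_statement N n k : Nat.Even N ->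
  count_value (Z.to_nat (Z.abs n) * Nat.div2 N) (Z.abs n - Z.of_nat k) =
         1 / 6 *
           (IZR (Z.abs n) * INR N
            + 2 * powerRZ (-1) (n + Z.of_nat k)
            + 2 * cos (PI * (IZR (Z.abs n) - INR k + 1) / 3)
            + 2 / sqrt 3 *
                cos (2 * PI * (IZR (Z.abs n) - INR k) / 3 + PI / 6)
            + 4 / sqrt 3 *
                cos (2 * PI * (IZR (Z.abs n) - INR k + IZR (Z.abs n) * INR N) / 3
                     + PI / 6)).
Proof.
  intros [h Hh].
  assert (Hd : Nat.div2 N = h) by (rewrite Hh; apply Nat.div2_double).
  assert (HINR : INR N = 2 * INR h) by (rewrite Hh, mult_INR; simpl; ring).
  unfold count_value. fold s3. rewrite Hd, HINR, powerRZ_cos6.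
  assert (Ek : INR k = IZR (Z.of_nat k)) by apply INR_IZR_INZ.
  assert (Eh : INR h = IZR (Z.of_nat h)) by apply INR_IZR_INZ.
  assert (P1 : cos6 (6 * (n + Z.of_nat k)) = cos6 (6 * (Z.abs n - Z.of_nat k))).
  { destruct (Z.abs_eq_or_opp n) as [E|E]; rewrite E.
    - replace (6 * (n + Z.of_nat k))%Z with (6 * (n - Z.of_nat k) + 12 * Z.of_nat k)%Z by ring.
        apply cos6_period.
    - replace (6 * (n + Z.of_nat k))%Z with (6 * (- n - Z.of_nat k) + 12 * (n + Z.of_nat k))%Z by
        ring. apply cos6_period. }
  rewrite P1. f_equal. f_equal; [f_equal; [f_equal; [f_equal|]|]|].
  - rewrite mult_INR, INR_IZR_INZ, Z2Nat.id by lia. ring.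
  - f_equal. unfold cos6. f_equal. rewrite plus_IZR, mult_IZR, minus_IZR, Ek. field.
  - f_equal. unfold cos6. f_equal. rewrite plus_IZR, mult_IZR, minus_IZR, Ek. field.
  - f_equal. unfold cos6. f_equal. rewrite Nat2Z.inj_mul, Z2Nat.id by lia.
    rewrite !plus_IZR, !mult_IZR, plus_IZR, !mult_IZR, minus_IZR, Ek, Eh. field.
Qed.

Theorem nonzero_frequency N c r n k : Nat.Even N -> (0 < N)%nat -> c = 4 * Im eta / INR N -> 0
  < r ->
  n <> 0%Z -> exists m : nat,
         multiplicity (Gamma c) r
           ((4 * INR k + 2) * PI * IZR (Z.abs n) / (c * r))
           (2 * PI * IZR n / (c * r)) m /\
         INR m = count_value (Z.to_nat (Z.abs n) * Nat.div2 N) (Z.abs n - Z.of_nat k).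
Proof.
  intros HN HN0 Hc Hr Hn.
  destruct (multiplicity_positive N c r (Z.abs n) k HN HN0 Hc Hr ltac:(lia)) as (m & H1 & H2).
  exists m; split; auto.
  destruct (Z.abs_eq_or_opp n) as [E|E]; [rewrite E in *; auto|].
  revert H1. rewrite E, opp_IZR. apply has_dim_conj; intros f Hf.
  - apply joint_conj in Hf. replace (2 * PI * IZR n / (c * r)) with
      (- (2 * PI * - IZR n / (c * r))); auto.
    unfold Rdiv; ring.
  - apply joint_conj in Hf. replace (2 * PI * - IZR n / (c * r)) with
      (- (2 * PI * IZR n / (c * r))); auto.
    unfold Rdiv; ring.
Qed.

(** * Fourier coefficients on the torus *)

Definition fourier (m : Z) (g : R -> C) : C := CInt (fun x => (g x * ei (- (2 * PI * IZR m)) x)%C).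

Lemma fourier_scal m c g : Ccont g -> fourier m (fun x => (c * g x)%C) = (c * fourier m g)%C.
Proof.
  intros H. unfold fourier. rewrite <- CInt_scal.
  - apply CInt_ext; intros; ring.
  - apply Ccont_mult; auto. apply Ccont_ei.
Qed.

Lemma fourier_csum {A} m (l : list A) (a : A -> C) g : (forall x, In x l -> Ccont (g x)) ->
  fourier m (fun u => csum l (fun x => (a x * g x u)%C))
    = csum l (fun x => (a x * fourier m (g x))%C).
Proof.
  induction l as [|x l IH]; intros H; simpl.
  - unfold fourier. rewrite (CInt_ext _ (fun _ => RtoC 0)) by (intros; ring). apply CInt_const.
  - assert (Cx : Ccont (g x)) by (apply H; simpl; auto).
    assert (Cl : Ccont (fun u => csum l (fun x => (a x * g x u)%C))).
    { assert (Hl : forall y, In y l -> Ccont (g y)) by (intros; apply H; simpl; auto).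
      clear -Hl. induction l as [|y l IH]; simpl; [apply Ccont_const|].
      apply (Ccont_plus (fun u => (a y * g y u)%C)); [|apply IH; intros; apply Hl; simpl; auto].
      apply (Ccont_mult (fun _ => a y)); [apply Ccont_const|apply Hl; simpl; auto]. }
    rewrite <- IH by (intros; apply H; simpl; auto). rewrite <- fourier_scal by auto.
    unfold fourier. rewrite <- CInt_plus.
    + apply CInt_ext; intros; ring.
    + apply Ccont_mult; [|apply Ccont_ei]. apply (Ccont_mult (fun _ => a x));
        auto. apply Ccont_const.
    + apply Ccont_mult; auto. apply Ccont_ei.
Qed.

Lemma fourier_deriv m g g' : (forall x, is_Cd g x (g' x)) -> Ccont g' -> g 1 = g 0 ->
  fourier m g' = (Ci * RtoC (2 * PI * IZR m) * fourier m g)%C.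
Proof.
  intros D C' P.
  set (w := - (2 * PI * IZR m)).
  assert (Cg : Ccont g) by (eapply Ccont_is_Cd; eauto).
  assert (D2 : forall x, is_Cd (fun x => (g x * ei w x)%C) x
    (g' x * ei w x + Ci * w * (g x * ei w x))%C).
  { intros x. eapply is_Cd_val; [apply is_Cd_mult; [apply D|apply is_Cd_ei]|]. ring. }
  assert (C1 : Ccont (fun x => (g' x * ei w x)%C)) by (apply Ccont_mult; auto; apply Ccont_ei).
  assert (C2 : Ccont (fun x => (g x * ei w x)%C)) by (apply Ccont_mult; auto; apply Ccont_ei).
  assert (E := CInt_deriv _ _ D2 (Ccont_plus _ _ C1 (Ccont_mult _ _ (Ccont_const _) C2))).
  rewrite CInt_plus in E; auto; [|exact (Ccont_mult _ _ (Ccont_const _) C2)].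
  rewrite (CInt_scal (Ci * w)%C (fun x => (g x * ei w x)%C)) in E by auto.
  fold (fourier m g) in E. fold (fourier m g') in E.
  rewrite P, !ei_cis in E.
  assert (W1 : cis (w * 1) = 1).
  { rewrite <- (cis_2PI (- m)). f_equal. unfold w. rewrite opp_IZR. ring. }
  rewrite W1, Rmult_0_r, cis_0 in E.
  replace (fourier m g') with (fourier m g' + Ci * w * fourier m g + - (Ci * w) * fourier m g)%C by
    ring.
  change (fourier m g') with (CInt (fun x => (g' x * ei w x)%C)) at 1.
  change (fourier m g) with (CInt (fun x => (g x * ei w x)%C)) at 1.
  rewrite E. unfold w. rewrite RtoC_opp. ring.
Qed.

(** Translating the variable multiplies the coefficient of index m by exp (2 pi i m c). *)
Lemma fourier_shift m c g t : Ccont g -> (forall x, g (x + 1) = g x) ->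
  (forall x, g (x + c) = (t * g x)%C) -> ((cis (- (2 * PI * IZR m * c)) * t - 1) * fourier m g)%C
    = 0.
Proof.
  intros Cg P H. set (w := - (2 * PI * IZR m)).
  assert (C2 : Ccont (fun x => (g x * ei w x)%C)) by (apply Ccont_mult; auto; apply Ccont_ei).
  assert (E := CInt_period_shift (fun x => (g x * ei w x)%C) c C2).
  fold (fourier m g) in E. change (CInt (fun x => (g x * ei w x)%C)) with (fourier m g) in E.
  replace ((cis (- (2 * PI * IZR m * c)) * t - 1) * fourier m g)%C with
    (cis (- (2 * PI * IZR m * c)) * t * fourier m g - fourier m g)%C by ring.
  rewrite <- E at 2.
  - unfold fourier. rewrite <- CInt_scal by auto.
    rewrite (CInt_ext (fun x => (g (x + c)%R * ei w (x + c))%C)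
      (fun x => (cis (- (2 * PI * IZR m * c)) * t * (g x * ei w x))%C)).
    + fold w. ring.
    + intros x. rewrite H, !ei_cis. rewrite Rmult_plus_distr_l, cis_add.
      replace (w * c) with (- (2 * PI * IZR m * c)) by (unfold w; ring). ring.
  - intros x. rewrite P, !ei_cis. f_equal. rewrite Rmult_plus_distr_l, cis_add.
    replace (cis (w * 1)) with (RtoC 1); [ring|].
    rewrite <- (cis_2PI (- m)). f_equal. unfold w. rewrite opp_IZR. ring.
Qed.

Lemma fourier_ei m n : fourier m (ei (2 * PI * IZR n)) = if Z.eq_dec m n then RtoC 1 else RtoC 0.
Proof.
  destruct (Z.eq_dec m n) as [->|N].
  - unfold fourier. rewrite (CInt_ext _ (fun _ => RtoC 1)); [apply CInt_const|].
    intros x. rewrite !ei_cis. apply cis_inv. ring.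
  - assert (D := fourier_deriv m (ei (2 * PI * IZR n)) _ (is_Cd_ei _)
      (Ccont_mult _ _ (Ccont_const _) (Ccont_ei _))).
    rewrite (fourier_scal m _ (ei (2 * PI * IZR n)) (Ccont_ei _)) in D.
    assert (P : ei (2 * PI * IZR n) 1 = ei (2 * PI * IZR n) 0).
    { rewrite !ei_cis, Rmult_0_r, Rmult_1_r, cis_2PI, cis_0. reflexivity. }
    specialize (D P).
    destruct (Ceq_dec (fourier m (ei (2 * PI * IZR n))) (RtoC 0)) as [|Nz]; auto. exfalso.
    apply N, eq_IZR.
    assert (E : (Ci * RtoC (2 * PI * IZR n))%C = (Ci * RtoC (2 * PI * IZR m))%C).
    { rewrite <- (Cmult_1_r (Ci * RtoC (2 * PI * IZR n))%C), <- (Cinv_r _ Nz), Cmult_assoc,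
      D. field. auto. }
    apply (f_equal Im) in E. simpl in E. pose proof PI_RGT_0. nra.
Qed.

Definition periodic_y (f : Heis -> C) := forall x y t, f ((x, y + s3), t) = f ((x, y), t).

Lemma qp0 w f z t : qp 0 w f -> f ((z + w)%C, t) = f (z, t).
Proof. intros H. rewrite H. rewrite Rmult_0_r, Rmult_0_l, cis_0. ring. Qed.

Lemma lattice_periodic_y f : qp 0 (RtoC 1) f -> qp 0 eta f -> periodic_y f.
Proof.
  intros H1 H2 x y t.
  transitivity (f (((x, y + s3)%R + 1)%C, t)); [symmetry; apply qp0; auto|].
  assert (E : ((x, y + s3)%R + 1)%C = ((x, y) + eta + eta)%C) by (rewrite eta_eq; re_im; field).
  rewrite E, !qp0 by auto. reflexivity.
Qed.

Definition row_coef (m : Z) (f : Heis -> C) (y : R) : C := fourier m (hor f y).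

Lemma coef0_row_coef m f y : coef 0 m f y = row_coef m f y.
Proof.
  unfold coef, row_coef, fourier. apply CInt_ext;
    intros x. unfold hor, untwist, phase, ei. fold (cis (- (2 * PI * IZR m) * x)).
  cbn [fst snd Re Im]. unfold Re, Im; cbn [fst snd].
  replace (- (2 * 0 * y + 2 * PI * IZR m) * x) with (- (2 * PI * IZR m) * x) by ring. ring.
Qed.

Lemma d_y_untwist0 m f p : smooth f -> d_y (untwist 0 m f) p = untwist 0 m (d_y f) p.
Proof.
  intros Hs.
  assert (G := grad_mult _ _ p _ _ _ _ _ _ (grad_phase 0 (2 * PI * IZR m) p) (grad_smooth f Hs p)).
  apply grad_eq in G. destruct G as (_ & G2 & _).
  change (d_y (untwist 0 m f) p) with (d_y (fun p => (phase 0 (2 * PI * IZR m) p * f p)%C) p).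
  rewrite G2. unfold untwist. replace (- (2 * 0 * Re (fst p))) with 0 by ring. ring.
Qed.

Lemma row_coef_dy m f y : smooth f -> is_Cd (row_coef m f) y (row_coef m (d_y f) y).
Proof.
  intros Hs. apply is_Cd_ext with (coef 0 m f); [intros; apply coef0_row_coef|].
  rewrite <- coef0_row_coef. unfold coef.
  rewrite (CInt_ext (hor (untwist 0 m (d_y f)) y) (hor (d_y (untwist 0 m f)) y)).
  - apply hor_CInt_dy, smooth_untwist; auto.
  - intros x. unfold hor. symmetry; apply d_y_untwist0; auto.
Qed.

Lemma hor_periodic f y : qp 0 (RtoC 1) f -> hor f y 1 = hor f y 0.
Proof.
  intros H. unfold hor. transitivity (f (((0, y) + 1)%C, 0)); [|apply qp0; auto].
  f_equal. f_equal. re_im.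
Qed.

Lemma row_coef_dx m f y : smooth f -> qp 0 (RtoC 1) f ->
  row_coef m (d_x f) y = (Ci * RtoC (2 * PI * IZR m) * row_coef m f y)%C.
Proof.
  intros Hs H. apply fourier_deriv.
  - intros x; apply smooth_slice_x; auto.
  - apply hor_cont, smooth_grad; auto.
  - apply hor_periodic; auto.
Qed.

Lemma qp0_d w f : smooth f -> qp 0 w f -> qp 0 w (d_x f) /\ qp 0 w (d_y f).
Proof.
  intros Hs H. split; intros z t; destruct (qp_grad 0 w f z t Hs H) as [E1 E2].
  - rewrite E1. replace (- (2 * 0 * Im w)) with 0 by ring. ring.
  - rewrite E2. replace (2 * 0 * Re w) with 0 by ring. ring.
Qed.

Lemma periodic_y_d f : smooth f -> periodic_y f -> periodic_y (d_y f).
Proof.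
  intros Hs H x y t.
  assert (E : is_Cd (fun s => f ((x, s + s3), t)) y (d_y f ((x, y + s3), t))).
  { apply (is_Cd_shift (fun s => f ((x, s), t))).
    destruct (grad_smooth f Hs ((x, y + s3), t)) as (_ & G & _). exact G. }
  assert (E2 : is_Cd (fun s => f ((x, s + s3), t)) y (d_y f ((x, y), t))).
  { apply is_Cd_ext with (fun s => f ((x, s), t)); [intros; symmetry; apply H|].
    destruct (grad_smooth f Hs ((x, y), t)) as (_ & G & _). exact G. }
  exact (is_Cd_unique _ _ _ _ E E2).
Qed.

(** Coefficients with respect to the rectangular lattice spanned by 1 and i sqrt 3, which
    has index 2 in L_eta. *)
Definition torus_coef (m l : Z) (f : Heis -> C) : C := fourier l (fun u => row_coef m f (s3 * u)).

Lemma is_Cd_scale g s a (b : R) : is_Cd g (b * s) a -> is_Cd (fun u => g (b * u)) s (b * a)%C.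
Proof.
  assert (D : forall (h : R -> R) l, is_derive h (b * s) l ->
    is_derive (fun u => h (b * u)) s (b * l)).
  { intros h l H. apply (is_derive_Rcomp (fun u => b * u) h s b l); auto. auto_derive; auto. ring. }
  intros [H1 H2]; split.
  - rewrite re_scal_l. exact (D _ _ H1). - rewrite im_scal_l. exact (D _ _ H2).
Qed.

Lemma row_coef_scaled_d m f u : smooth f -> is_Cd (fun u => row_coef m f (s3 * u)) u
  (s3 * row_coef m (d_y f) (s3 * u))%C.
Proof. intros Hs. apply is_Cd_scale, row_coef_dy; auto. Qed.

Lemma row_coef_scaled_cont m f : smooth f -> Ccont (fun u => row_coef m f (s3 * u)).
Proof. intros Hs. eapply Ccont_is_Cd. intros u; apply row_coef_scaled_d; auto. Qed.

Lemma row_coef_periodic m f y : periodic_y f -> row_coef m f (y + s3) = row_coef m f y.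
Proof. intros H. unfold row_coef. f_equal. apply functional_extensionality; intros x. apply H. Qed.

Lemma torus_coef_dy m l f : smooth f -> periodic_y f ->
  (s3 * torus_coef m l (d_y f))%C = (Ci * RtoC (2 * PI * IZR l) * torus_coef m l f)%C.
Proof.
  intros Hs H. assert (Hy : smooth (d_y f)) by (apply smooth_grad; auto).
  unfold torus_coef. rewrite <- fourier_scal by (apply row_coef_scaled_cont; auto).
  apply (fourier_deriv l (fun u => row_coef m f (s3 * u))
    (fun u => (s3 * row_coef m (d_y f) (s3 * u))%C)).
  - intros u; apply row_coef_scaled_d; auto.
  - apply (Ccont_mult (fun _ => RtoC s3)); [apply Ccont_const|apply row_coef_scaled_cont; auto].
  - replace (s3 * 1) with (s3 * 0 + s3) by ring. apply row_coef_periodic; auto.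
Qed.

Lemma torus_coef_dx m l f : smooth f -> qp 0 (RtoC 1) f ->
  torus_coef m l (d_x f) = (Ci * RtoC (2 * PI * IZR m) * torus_coef m l f)%C.
Proof.
  intros Hs H. unfold torus_coef. rewrite <- fourier_scal by (apply row_coef_scaled_cont; auto).
  unfold fourier. apply CInt_ext; intros u. rewrite row_coef_dx by auto. reflexivity.
Qed.

Lemma torus_coef_csum {A} m l (L : list A) (a : A -> C) b : (forall x, In x L -> smooth (b x)) ->
  torus_coef m l (fun p => csum L (fun x => (a x * b x p)%C))
    = csum L (fun x => (a x * torus_coef m l (b x))%C).
Proof.
  intros H. unfold torus_coef. rewrite <- fourier_csum by (intros; apply row_coef_scaled_cont;
    auto).
  unfold fourier at 1 2. apply CInt_ext; intros u. f_equal. unfold row_coef.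
  apply (fourier_csum m L a (fun x => hor (b x) (s3 * u))). intros; apply hor_cont; auto.
Qed.

Lemma torus_coef_zero f : smooth f -> freq 0 f -> qp 0 (RtoC 1) f -> periodic_y f ->
  (forall m l, torus_coef m l f = 0) -> forall p, f p = 0.
Proof.
  intros Hs Ht H1 Hy H. apply (coef_all_zero 0 f); auto. intros m y. rewrite coef0_row_coef.
  assert (K : forall u, row_coef m f (s3 * u) = 0).
  { apply fourier_vanish_periodic.
    - apply row_coef_scaled_cont; auto.
    - intros u. f_equal. rewrite Rmult_plus_distr_l, Rmult_1_r. apply row_coef_periodic; auto.
    - intros l. exact (H m l). }
  rewrite <- (K (y / s3)). f_equal. field. pose proof s3_pos; lra.
Qed.

(** Sections of frequency 0, that is, functions on the torus C / L_eta. *)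
Definition flat (f : Heis -> C) : Prop := smooth f /\ freq 0 f /\ qp 0 (RtoC 1) f /\ qp 0 eta f.

Lemma flat_laplacian f p : smooth f -> freq 0 f ->
  (4 * Zop (Zbarop f) p)%C = (d_x (d_x f) p + d_y (d_y f) p)%C.
Proof.
  intros Hs Ht. destruct (smooth_grad f Hs) as (_ & Hx & Hy & _ & G).
  rewrite (freq_Zop_eq 0) by (apply freq_Zbarop; auto).
  assert (E1 : Zbarop f = fun p => (RtoC (/ 2) * (d_x f p + Ci * d_y f p))%C).
  { apply functional_extensionality; intros q. rewrite (freq_Zbarop_eq 0) by auto.
    unfold Cdiv. rewrite RtoC_inv by lra. ring. }
  assert (G1 := grad_mult _ _ p _ _ _ _ _ _ (grad_const (RtoC (/ 2)) p)
       (grad_plus _ _ p _ _ _ _ _ _ (grad_smooth _ Hx p)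
         (grad_mult _ _ p _ _ _ _ _ _ (grad_const Ci p) (grad_smooth _ Hy p)))).
  cbv beta in G1. rewrite <- E1 in G1. apply grad_eq in G1. destruct G1 as (X1 & X2 & _).
  rewrite X1, X2, (d_xy_comm f p Hs). pose proof CiCi as I2.
  rewrite RtoC_inv by lra.
  replace (RtoC 4) with (2 * 2)%C by (rewrite <- RtoC_mult; f_equal; ring).
  unfold Cdiv. field_simplify_eq. ring [I2].
Qed.

(** The second derivatives in x and y multiply the coefficient by -4 pi^2 m^2 and -4 pi^2
    l^2 / 3. *)
Lemma torus_coef_spectrum f b m l : flat f -> (forall p, Zop (Zbarop f) p = (RtoC (- b) * f p)%C) ->
  3 * b <> PI * PI * IZR (3 * m * m + l * l) -> torus_coef m l f = 0.
Proof.
  intros (Hs & Ht & H1 & H2) HL Hne.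
  assert (Hy := lattice_periodic_y f H1 H2).
  destruct (smooth_grad f Hs) as (_ & Sx & Sy & _ & _).
  assert (Lap : d_x (d_x f) = fun p => (RtoC (- (4 * b)) * f p + RtoC (- 1) * d_y (d_y f) p)%C).
  { apply functional_extensionality; intros p. assert (E := flat_laplacian f p Hs Ht). rewrite HL in
    E.
    replace (d_x (d_x f) p) with (d_x (d_x f) p + d_y (d_y f) p - d_y (d_y f) p)%C by ring.
    rewrite <- E. rewrite !RtoC_opp, !RtoC_mult. ring. }
  assert (E : torus_coef m l (d_x (d_x f)) = (RtoC (- (4 * b)) * torus_coef m l f + RtoC (- 1)
    * torus_coef m l (d_y (d_y f)))%C).
  { rewrite Lap.
    assert (K := torus_coef_csum m l (true :: false :: nil)
      (fun i : bool => if i then RtoC (- (4 * b)) else RtoC (- 1))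
      (fun i : bool => if i then f else d_y (d_y f))).
    cbn [csum fold_right] in K.
    rewrite <- (Cplus_0_r (RtoC (- 1) * torus_coef m l (d_y (d_y f)))%C), <- K.
    - f_equal. apply functional_extensionality; intros p. ring.
    - intros [|] _; auto. apply smooth_grad; auto. }
  rewrite (torus_coef_dx m l (d_x f)), (torus_coef_dx m l f) in E; auto; [|apply qp0_d; auto].
  assert (Y1 := torus_coef_dy m l f Hs Hy). assert
    (Y2 := torus_coef_dy m l (d_y f) Sy (periodic_y_d f Hs Hy)).
  assert (Y3 : (3 * torus_coef m l (d_y (d_y f)))%C
    = (Ci * RtoC (2 * PI * IZR l) * (Ci * RtoC (2 * PI * IZR l)) * torus_coef m l f)%C).
  { rewrite <- s3_sq, RtoC_mult, <- Cmult_assoc, Y2.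
    transitivity (Ci * RtoC (2 * PI * IZR l) * (s3 * torus_coef m l (d_y f)))%C; [ring|].
    rewrite Y1. ring. }
  set (d := torus_coef m l f) in *.
  destruct (Ceq_dec d 0) as [|Nd]; auto. exfalso. apply Hne.
  assert (F : (RtoC (4 * (PI * PI * IZR (3 * m * m + l * l)) - 12 * b) * d)%C = 0).
  { transitivity (- RtoC 3 * (Ci * RtoC (2 * PI * IZR m) * (Ci * RtoC (2 * PI * IZR m) * d)
    - (RtoC (- (4 * b)) * d + RtoC (- 1) * torus_coef m l (d_y (d_y f))))
    + (3 * torus_coef m l (d_y (d_y f)) - Ci * RtoC (2 * PI * IZR l) * (Ci * RtoC (2 * PI * IZR l))
    * d))%C.
    - rewrite plus_IZR, !mult_IZR.
      rewrite !RtoC_minus, !RtoC_opp, !RtoC_mult, RtoC_plus, !RtoC_mult.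
      replace (RtoC 12) with (3 * 4)%C by (rewrite <- RtoC_mult; f_equal; ring).
      replace (RtoC 4) with (2 * 2)%C by (rewrite <- RtoC_mult; f_equal; ring).
      pose proof CiCi as I2. ring [I2].
    - rewrite E, Y3. ring. }
  destruct (Ceq_dec (RtoC (4 * (PI * PI * IZR (3 * m * m + l * l)) - 12 * b)) (RtoC 0)) as [Z|Z].
  - apply RtoC_inj in Z. lra.
  - exfalso. exact (Cmult_neq_0 _ _ Z Nd F).
Qed.

(** The translation by eta = 1/2 + i sqrt 3 / 2 multiplies the coefficient by (-1)^(m + l).
    This selects the dual of L_eta inside the dual of the rectangular lattice. *)
Lemma torus_coef_parity f m l : flat f -> Z.odd (m + l) = true -> torus_coef m l f = 0.
Proof.
  intros (Hs & Ht & H1 & H2) Ho.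
  assert (Hy := lattice_periodic_y f H1 H2).
  assert (Half : forall y, row_coef m f (y + s3 / 2) = (cis (- (PI * IZR m)) * row_coef m f y)%C).
  { intros y. unfold row_coef, fourier.
    rewrite <- (CInt_period_shift (fun x => (hor f y x * ei (- (2 * PI * IZR m)) x)%C) (- (1 / 2))).
    - rewrite <- CInt_scal.
      + apply CInt_ext; intros x. rewrite !ei_cis.
        assert (E : hor f (y + s3 / 2) x = hor f y (x + - (1 / 2))).
        { unfold hor. transitivity (f (((x + - (1 / 2), y)%R + eta)%C, 0)); [|apply qp0; auto].
          f_equal. f_equal. rewrite eta_eq. re_im. }
        rewrite E. rewrite (Cmult_comm (hor f y _)), (Cmult_comm (hor f y _)), Cmult_assoc,
          <- cis_add. f_equal. f_equal. field.
      + assert (C0 : Ccont (fun x => (hor f y x * ei (- (2 * PI * IZR m)) x)%C))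
          by (apply Ccont_mult; [apply hor_cont; auto|apply Ccont_ei]).
        destruct C0 as [C1 C2].
        split; [exact (Rcont_comp _ _ C1 (Rcont_plus _ _ Rcont_id (Rcont_const _)))|
          exact (Rcont_comp _ _ C2 (Rcont_plus _ _ Rcont_id (Rcont_const _)))].
    - apply Ccont_mult; [apply hor_cont; auto|apply Ccont_ei].
    - intros x. rewrite !ei_cis, Rmult_plus_distr_l, cis_add.
      replace (cis (- (2 * PI * IZR m) * 1)) with (RtoC 1).
      + assert (Eh : hor f y (x + 1) = hor f y x).
        { unfold hor. transitivity (f (((x, y) + 1)%C, 0));
          [f_equal; f_equal; re_im|apply qp0; auto]. }
        rewrite Eh. ring.
      + rewrite <- (cis_2PI (- m)). f_equal. rewrite opp_IZR. ring. }
  assert (E := fourier_shift l (1 / 2) (fun u => row_coef m f (s3 * u)) (cis (- (PI * IZR m)))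
    (row_coef_scaled_cont m f Hs)).
  cbv beta in E. fold (torus_coef m l f) in E.
  assert (E2 : (cis (- (2 * PI * IZR l * (1 / 2))) * cis (- (PI * IZR m)) - 1)%C = RtoC (- 2)).
  { rewrite <- cis_add. apply Z.odd_spec in Ho. destruct Ho as [j Hj].
    replace (- (2 * PI * IZR l * (1 / 2)) + - (PI * IZR m)) with (- PI + 2 * PI * IZR (- j)).
    - rewrite cis_add, cis_2PI, cis_cs, cos_neg, sin_neg, cos_PI, sin_PI. re_im.
    - apply (f_equal IZR) in Hj. rewrite !plus_IZR, mult_IZR in Hj. rewrite opp_IZR.
      replace (IZR l) with (2 * IZR j + 1 - IZR m) by lra. field. }
  rewrite E2 in E.
  destruct (Ceq_dec (torus_coef m l f) (RtoC 0)) as [|Nz]; auto. exfalso.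
  assert (N2 : RtoC (- 2) <> 0) by (intros Z; apply RtoC_inj in Z; lra).
  apply (Cmult_neq_0 _ _ N2 Nz), E.
  - intros u. rewrite Rmult_plus_distr_l, Rmult_1_r. apply row_coef_periodic; auto.
  - intros u. rewrite Rmult_plus_distr_l. replace (s3 * (1 / 2)) with (s3 / 2) by field. apply Half.
Qed.

(** * Characters of the torus *)

(** A vector zeta of the dual lattice is recorded by its pairings v = (Re zeta, Re (zeta
    conj(eta))) with the basis of L_eta; its imaginary part is then y_freq v / sqrt 3. *)
Definition y_freq (v : Z * Z) : Z := (2 * snd v - fst v)%Z.
Definition chi (v : Z * Z) (p : Heis) : C :=
  cis (2 * PI * (IZR (fst v) * Re (fst p) + IZR (y_freq v) / s3 * Im (fst p))).
(** For the vector zeta recorded by v this is 3 |zeta|^2 / 4, an integer. *)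
Definition qform (v : Z * Z) : Z := (fst v * fst v - fst v * snd v + snd v * snd v)%Z.
Definition rot_index (v : Z * Z) : Z * Z := (snd v, snd v - fst v)%Z.

Lemma grad_chi v p : grad (chi v) p (Ci * RtoC (2 * PI * IZR (fst v)) * chi v p)%C
   (Ci * RtoC (2 * PI * (IZR (y_freq v) / s3)) * chi v p)%C (RtoC 0).
Proof.
  eapply grad_val; [apply (grad_cis (fun p => 2 * PI
    * (IZR (fst v) * Re (fst p) + IZR (y_freq v) / s3 * Im (fst p))) p
    (2 * PI * IZR (fst v)) (2 * PI * (IZR (y_freq v) / s3)) 0)|..]; try reflexivity.
  - cbn [Re Im fst snd]. auto_derive; auto. ring.
  - cbn [Re Im fst snd]. auto_derive; auto. ring.
  - cbn [Re Im fst snd]. auto_derive; auto.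
  - cbv beta. ring.
Qed.

Lemma chi_smooth v : smooth (chi v).
Proof.
  replace (chi v) with (fun p : Heis => Cexp (Ci * RtoC (2 * PI)
    * (RtoC (IZR (fst v)) * xh p + RtoC (IZR (y_freq v) / s3) * yh p))%C).
  - apply smooth_Cexp, smooth_scal, smooth_plus; apply smooth_scal;
      [apply smooth_xh|apply smooth_yh].
  - apply functional_extensionality; intros p. unfold chi, cis, xh, yh. f_equal.
    rewrite !RtoC_mult, RtoC_plus, !RtoC_mult. ring.
Qed.

Lemma chi_freq v : freq 0 (chi v).
Proof. intros z t. rewrite Rmult_0_l, cis_0, Cmult_1_l. reflexivity. Qed.

Lemma cis_shift_2PI x j : cis (x + 2 * PI * IZR j) = cis x.
Proof. rewrite cis_add, cis_2PI. ring. Qed.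

Lemma chi_flat v : flat (chi v).
Proof.
  pose proof s3_pos as S3.
  split; [apply chi_smooth|split; [apply chi_freq|split]]; intros [x y] t;
    rewrite Rmult_0_r, Rmult_0_l, cis_0, Cmult_1_l;
    unfold chi; cbn [fst snd]; unfold Re, Im; simpl fst; simpl snd.
  - rewrite <- (cis_shift_2PI (2 * PI * (IZR (fst v) * x + IZR (y_freq v) / s3 * y)) (fst v)).
      f_equal. field. lra.
  - rewrite <- (cis_shift_2PI (2 * PI * (IZR (fst v) * x + IZR (y_freq v) / s3 * y)) (snd v)).
      f_equal. rewrite cos_PI3, sin_PI3. fold s3.
    unfold y_freq. rewrite minus_IZR, mult_IZR. field. lra.
Qed.

Lemma chi_rot v p : rot (chi v) p = chi (rot_index v) p.
Proof.
  pose proof s3_pos as S3. destruct p as [[x y] t]. unfold rot, chi. rewrite eta_eq.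
  cbn [fst snd]. unfold Re, Im; simpl fst; simpl snd. f_equal. unfold y_freq,
    rot_index. cbn [fst snd].
  rewrite !minus_IZR, !mult_IZR, minus_IZR.
  apply Rmult_eq_reg_r with s3; [|lra]. pose proof s3_sq as SS.
  field_simplify; try lra. replace (s3 ^ 2) with 3 by (rewrite <- SS; ring). field.
Qed.

(** This is pi^2 |zeta|^2. *)
Definition energy (v : Z * Z) : R := 4 * (PI * PI) * IZR (qform v) / 3.

Lemma chi_level v p : Zop (Zbarop (chi v)) p = (RtoC (- energy v) * chi v p)%C.
Proof.
  pose proof s3_pos as S3. pose proof s3_sq as SS.
  assert (L := flat_laplacian (chi v) p (chi_smooth v) (chi_freq v)).
  assert (Ex : d_x (chi v) = fun p => (Ci * RtoC (2 * PI * IZR (fst v)) * chi v p)%C)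
    by (apply functional_extensionality; intros q; apply (grad_eq _ _ _ _ _ (grad_chi v q))).
  assert (Ey : d_y (chi v) = fun p => (Ci * RtoC (2 * PI * (IZR (y_freq v) / s3)) * chi v p)%C)
    by (apply functional_extensionality; intros q; apply (grad_eq _ _ _ _ _ (grad_chi v q))).
  rewrite Ex, Ey in L.
  assert (Sc : forall c, d_x (fun p => (c * chi v p)%C) p = (c * d_x (chi v) p)%C /\
      d_y (fun p => (c * chi v p)%C) p = (c * d_y (chi v) p)%C).
  { intros c. assert (G := grad_mult _ _ p _ _ _ _ _ _ (grad_const c p)
    (grad_smooth _ (chi_smooth v) p)).
    apply grad_eq in G. destruct G as (G1 & G2 & _). rewrite G1, G2. split; ring. }
  rewrite (proj1 (Sc _)), (proj2 (Sc _)), Ex, Ey in L.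
  assert (N4 : RtoC 4 <> 0) by (intros Z; apply RtoC_inj in Z; lra).
  assert (E : (4 * (RtoC (- energy v) * chi v p))%C = (4 * Zop (Zbarop (chi v)) p)%C).
  { rewrite L.
    transitivity (Ci * Ci * RtoC ((2 * PI * IZR (fst v)) * (2 * PI * IZR (fst v))
      + (2 * PI * (IZR (y_freq v) / s3)) * (2 * PI * (IZR (y_freq v) / s3))) * chi v p)%C.
    - rewrite CiCi, Cmult_assoc. f_equal. rewrite <- RtoC_mult.
      transitivity (RtoC (- ((2 * PI * IZR (fst v)) * (2 * PI * IZR (fst v))
        + (2 * PI * (IZR (y_freq v) / s3)) * (2 * PI * (IZR (y_freq v) / s3)))));
        [|rewrite !RtoC_opp; ring].
      f_equal. unfold energy, qform, y_freq.
      replace (2 * PI * (IZR (2 * snd v - fst v) / s3) * (2 * PI * (IZR (2 * snd v - fst v) / s3)))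
        with
        (4 * (PI * PI) * (IZR (2 * snd v - fst v) * IZR (2 * snd v - fst v)) / (s3 * s3)) by (field;
          lra).
      rewrite SS, plus_IZR, !minus_IZR, !mult_IZR. field.
    - rewrite RtoC_plus, !RtoC_mult. ring. }
  rewrite <- (Cmult_1_l (Zop _ p)), <- (Cinv_l _ N4), <- Cmult_assoc, <- E. field.
Qed.

Lemma torus_coef_chi m l v : torus_coef m l (chi v) =
  if Z.eq_dec m (fst v) then (if Z.eq_dec l (y_freq v) then RtoC 1 else RtoC 0) else RtoC 0.
Proof.
  pose proof s3_pos as S3.
  assert (E : forall u, row_coef m (chi v) (s3 * u)
    = (fourier m (ei (2 * PI * IZR (fst v))) * ei (2 * PI * IZR (y_freq v)) u)%C).
  { intros u. rewrite Cmult_comm, <- fourier_scal by apply Ccont_ei. unfold row_coef. f_equal.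
    apply functional_extensionality; intros x. unfold hor, chi. rewrite !ei_cis,
      <- cis_add. cbn [fst snd Re Im].
    f_equal. unfold Re, Im; cbn [fst snd]. field. lra. }
  unfold torus_coef. replace (fun u => row_coef m (chi v) (s3 * u)) with
    (fun u => (fourier m (ei (2 * PI * IZR (fst v))) * ei (2 * PI * IZR (y_freq v)) u)%C)
    by (apply functional_extensionality; intros; symmetry; apply E).
  rewrite fourier_scal, !fourier_ei by apply Ccont_ei.
  destruct (Z.eq_dec m (fst v)), (Z.eq_dec l (y_freq v)); ring.
Qed.

Definition char_coef (v : Z * Z) (f : Heis -> C) : C := torus_coef (fst v) (y_freq v) f.

Lemma zpair_dec (v w : Z * Z) : {v = w} + {v <> w}.
Proof. decide equality; apply Z.eq_dec. Qed.

Lemma char_coef_chi v w : char_coef v (chi w) = if zpair_dec v w then RtoC 1 else RtoC 0.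
Proof.
  unfold char_coef. rewrite torus_coef_chi. destruct v as [p q],
    w as [p' q']. unfold y_freq. cbn [fst snd].
  destruct (Z.eq_dec p p') as [->|N], (zpair_dec _ _) as [E|E]; auto.
  - inversion E; subst. destruct (Z.eq_dec _ _); [auto|congruence].
  - destruct (Z.eq_dec _ _) as [E2|E2]; auto. exfalso; apply E. f_equal. lia.
  - inversion E; congruence.
Qed.

Definition eigenfun (b : R) (f : Heis -> C) : Prop :=
  flat f /\ forall p, Zop (Zbarop f) p = (RtoC (- b) * f p)%C.

Lemma flat_csum {A} (l : list A) (a : A -> C) b : (forall x, In x l -> flat (b x)) ->
  flat (fun p => csum l (fun x => (a x * b x p)%C)).
Proof. exact (@section_csum A 0 l a b). Qed.

(** The difference of the two sides is an eigenfunction all of whose coefficients vanish: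
    off the energy b by [torus_coef_spectrum], off the dual lattice by [torus_coef_parity],
    and otherwise by orthogonality of characters. *)
Lemma eigenfun_expansion (P : list (Z * Z)) b f : NoDup P -> (forall v, In v P <-> energy v = b) ->
  eigenfun b f -> forall p, f p = csum P (fun v => (char_coef v f * chi v p)%C).
Proof.
  intros NP HP [Hf HL].
  set (g := fun p => csum P (fun v => (char_coef v f * chi v p)%C)).
  assert (Hg : flat g) by (apply flat_csum; intros; apply chi_flat).
  assert (HgL : forall p, Zop (Zbarop g) p = (RtoC (- b) * g p)%C).
  { intros p. unfold g.
    replace (Zbarop (fun p => csum P (fun v => (char_coef v f * chi v p)%C))) with
      (fun p => csum P (fun v => (char_coef v f * Zbarop (chi v) p)%C))
      by (apply functional_extensionality; intros q; symmetry; apply csum_Zbarop; intros;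
        apply chi_smooth).
    rewrite (csum_Zop P (fun v => char_coef v f) (fun v => Zbarop (chi v))) by (intros;
      apply smooth_Zbarop, chi_smooth).
    rewrite <- csum_scal. apply csum_ext. intros v Iv. rewrite chi_level, (proj1 (HP v) Iv). ring. }
  (* The difference f - g as a combination indexed by bool, to use linearity of the operators
     and coefficients. *)
  set (two := true :: false :: nil).
  set (pr := fun i : bool => if i then f else g).
  set (sg := fun i : bool => if i then RtoC 1 else RtoC (- 1)).
  set (h := fun p => csum two (fun i => (sg i * pr i p)%C)).
  assert (Hh : flat h) by (apply flat_csum; intros [|] _; auto).
  assert (HhL : forall p, Zop (Zbarop h) p = (RtoC (- b) * h p)%C).
  { intros p. unfold h.
    replace (Zbarop (fun p => csum two (fun i => (sg i * pr i p)%C))) with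
      (fun p => csum two (fun i => (sg i * Zbarop (pr i) p)%C)).
    - rewrite (csum_Zop two sg (fun i => Zbarop (pr i))).
      + rewrite <- csum_scal. apply csum_ext. intros [|] _; cbn [pr]; [rewrite HL|rewrite HgL];
          ring.
      + intros [|] _; apply smooth_Zbarop; [apply Hf|apply Hg].
    - apply functional_extensionality; intros q; symmetry; apply csum_Zbarop. intros [|] _;
        [apply Hf|apply Hg]. }
  assert (Hz : forall p, h p = 0).
  { destruct Hh as (S1 & S2 & S3 & S4). apply torus_coef_zero; auto;
    [apply lattice_periodic_y; auto|].
    intros m l.
    destruct (Req_EM_T (3 * b) (PI * PI * IZR (3 * m * m + l * l))) as [E|E].
    2:{ apply (torus_coef_spectrum h b); auto. split; [auto|split; auto]. }
    destruct (Z.odd (m + l)) eqn:Eo.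
    { apply torus_coef_parity; auto. split; [auto|split; auto]. }
    assert (Ev : Z.even (m + l) = true) by (rewrite <- Z.negb_odd, Eo; auto).
    apply Z.even_spec in Ev. destruct Ev as [q Hq].
    assert (Iv : In (m, q) P).
    { apply HP. unfold energy, qform. cbn [fst snd].
      replace (3 * m * m + l * l)%Z with (4 * (m * m - m * q + q * q))%Z in E by nia.
      rewrite mult_IZR in E. lra. }
    unfold h. rewrite torus_coef_csum by (intros [|] _; [apply Hf|apply Hg]).
    cbn [csum fold_right two pr sg].
    assert (Dg : torus_coef m l g = torus_coef m l f).
    { unfold g. rewrite torus_coef_csum by (intros; apply chi_smooth).
      rewrite (csum_single P (m, q)); auto.
      - replace (torus_coef m l (chi (m, q))) with (char_coef (m, q) (chi (m, q))) by
          (unfold char_coef, y_freq; cbn [fst snd]; f_equal; lia).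
        rewrite char_coef_chi. destruct (zpair_dec (m, q) (m, q)); [|congruence].
        unfold char_coef, y_freq; cbn [fst snd]. replace (2 * q - m)%Z with l by lia. ring.
      - intros w Iw Nw.
        replace (torus_coef m l (chi w)) with (char_coef (m, q) (chi w)) by
          (unfold char_coef, y_freq; cbn [fst snd]; f_equal; lia).
        rewrite char_coef_chi. destruct (zpair_dec (m, q) w); [congruence|ring]. }
    rewrite Dg. ring. }
  intros p. specialize (Hz p). unfold h in Hz. cbn [csum fold_right two pr sg] in Hz.
  change (csum P (fun v => (char_coef v f * chi v p)%C)) with (g p).
  replace (f p) with (g p + (1 * f p + (RtoC (- 1) * g p + 0)))%C by ring.
  rewrite Hz. ring.
Qed.

(** * Orbits of the rotation *)

(** The six powers of [rot_index] in closed form. *)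
Definition rots : list (Z * Z -> Z * Z) :=
  (fun v => v) :: (fun v => (snd v, snd v - fst v)%Z) :: (fun v => (snd v - fst v, - fst v)%Z) ::
  (fun v => (- fst v, - snd v)%Z) :: (fun v => (- snd v, fst v - snd v)%Z) ::
  (fun v => (fst v - snd v, fst v)%Z) :: nil.

(** A sector of angle pi/3 with one of its two boundary rays: a fundamental domain for the
    rotation on nonzero vectors. *)
Definition cone (v : Z * Z) : bool := andb (snd v <? fst v)%Z (0 <=? snd v)%Z.

Definition orbits (F : list (Z * Z)) : list (Z * Z) := flat_map (fun R => map R F) rots.

Definition orbit_sum (v : Z * Z) (p : Heis) : C := csum rots (fun R => chi (R v) p).

Lemma csum_flat_map {A B} (g : A -> list B) (l : list A) F :
  csum (flat_map g l) F = csum l (fun x => csum (g x) F).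
Proof. induction l as [|x l IH]; simpl; auto. rewrite csum_app, IH. reflexivity. Qed.

Lemma csum_orbits F G : csum (orbits F) G = csum rots (fun R => csum F (fun v => G (R v))).
Proof.
  unfold orbits. rewrite csum_flat_map. apply csum_ext. intros R _. apply csum_map.
Qed.

Ltac pair_eq := apply injective_projections; cbn [fst snd]; ring.

Lemma orbit_sum_rot_index v p : orbit_sum (rot_index v) p = orbit_sum v p.
Proof.
  unfold orbit_sum, rots, rot_index. cbn [csum fold_right fst snd].
  replace (snd v - fst v - snd v)%Z with (- fst v)%Z by ring.
  replace (- (snd v - fst v))%Z with (fst v - snd v)%Z by ring.
  replace (snd v - (snd v - fst v))%Z with (fst v) by ring.
  rewrite <- (surjective_pairing v). ring.
Qed.

Lemma In_rots R : In R rots <-> R = (fun v => v) \/ R = (fun v => (snd v, snd v - fst v)%Z) \/ R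
  = (fun v => (snd v - fst v, - fst v)%Z) \/
  R = (fun v => (- fst v, - snd v)%Z) \/ R = (fun v => (- snd v, fst v - snd v)%Z) \/
  R = (fun v => (fst v - snd v, fst v)%Z).
Proof. unfold rots. simpl. intuition auto. Qed.

Lemma orbit_sum_rots R v p : In R rots -> orbit_sum (R v) p = orbit_sum v p.
Proof.
  assert (S1 := fun v => orbit_sum_rot_index v p).
  assert (E2 : rot_index (rot_index v) = (snd v - fst v, - fst v)%Z) by (unfold rot_index; pair_eq).
  assert (E3 : rot_index (rot_index (rot_index v)) = (- fst v, - snd v)%Z) by (unfold rot_index;
    pair_eq).
  assert (E4 : rot_index (rot_index (rot_index (rot_index v))) = (- snd v, fst v - snd v)%Z) by
    (unfold rot_index; pair_eq).
  assert (E5 : rot_index (rot_index (rot_index (rot_index (rot_index v))))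
    = (fst v - snd v, fst v)%Z) by (unfold rot_index; pair_eq).
  rewrite In_rots. intros [-> |[-> |[-> |[-> |[-> | ->]]]]]; auto.
  - exact (S1 v).
  - rewrite <- E2, !S1; auto. - rewrite <- E3, !S1; auto. - rewrite <- E4, !S1;
      auto. - rewrite <- E5, !S1; auto.
Qed.

Lemma orbit_sum_rot v p : rot (orbit_sum v) p = orbit_sum v p.
Proof.
  rewrite <- (orbit_sum_rot_index v p). unfold orbit_sum, rot.
  unfold rots. cbn [csum fold_right].
  assert (K := fun w => chi_rot w p). unfold rot in K. rewrite !K. unfold rot_index; cbn [fst snd].
  repeat (f_equal; try ring).
  all: f_equal; apply injective_projections; cbn [fst snd]; ring.
Qed.

Lemma cone_spec v : cone v = true <-> (0 <= snd v < fst v)%Z.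
Proof.
  unfold cone. rewrite Bool.andb_true_iff, Z.ltb_lt, Z.leb_le. lia.
Qed.

Lemma rots_qform R v : In R rots -> qform (R v) = qform v.
Proof.
  rewrite In_rots. intros [-> |[-> |[-> |[-> |[-> | ->]]]]]; unfold qform; cbn [fst snd]; ring.
Qed.

Lemma In_orbits F w : In w (orbits F) <-> exists R v, In R rots /\ In v F /\ w = R v.
Proof.
  unfold orbits. rewrite in_flat_map. split.
  - intros (R & IR & Iw). apply in_map_iff in Iw. destruct Iw as (v & <- & Iv). eauto.
  - intros (R & v & IR & Iv & ->). exists R; split; auto. apply in_map; auto.
Qed.

(** The signs of x, y and x - y cut the plane into the six images of the cone. *)
Lemma cone_covers w : qform w <> 0%Z -> exists R v, In R rots /\ cone v = true /\ w = R v.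
Proof.
  intros Hw. destruct w as [x y].
  assert (N : ~ (x = 0 /\ y = 0)%Z) by (intros [-> ->]; apply Hw; reflexivity).
  assert (W : forall R v, In R rots -> cone v = true -> (x, y) = R v ->
    exists R v, In R rots /\ cone v = true /\ (x, y) = R v) by eauto.
  destruct (Z_lt_le_dec y 0) as [B|B].
  - destruct (Z_lt_le_dec x 0) as [D|D].
    + destruct (Z_lt_le_dec x y) as [A|A].
      * apply (W (fun v => (- fst v, - snd v)%Z) (- x, - y)%Z);
          [apply In_rots; tauto|apply cone_spec; cbn [fst snd]; lia|pair_eq].
      * apply (W (fun v => (snd v - fst v, - fst v)%Z) (- y, x - y)%Z);
          [apply In_rots; tauto|apply cone_spec; cbn [fst snd]; lia|pair_eq].
    + apply (W (fun v => (snd v, snd v - fst v)%Z) (x - y, x)%Z);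
        [apply In_rots; tauto|apply cone_spec; cbn [fst snd]; lia|pair_eq].
  - destruct (Z_lt_le_dec y x) as [A|A].
    + apply (W (fun v => v) (x, y)); [apply In_rots; tauto|apply cone_spec; cbn [fst snd];
        lia|auto].
    + destruct (Z_lt_le_dec 0 x) as [D|D].
      * apply (W (fun v => (fst v - snd v, fst v)%Z) (y, y - x)%Z);
          [apply In_rots; tauto|apply cone_spec; cbn [fst snd]; lia|pair_eq].
      * destruct (Z_lt_le_dec 0 y) as [G|G].
        -- apply (W (fun v => (- snd v, fst v - snd v)%Z) (y - x, - x)%Z);
             [apply In_rots; tauto|apply cone_spec; cbn [fst snd]; lia|pair_eq].
        -- apply (W (fun v => (- fst v, - snd v)%Z) (- x, - y)%Z);
             [apply In_rots; tauto|apply cone_spec; cbn [fst snd]; lia|pair_eq].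
Qed.

Lemma map_NoDup_rots R F : In R rots -> NoDup F -> NoDup (map R F).
Proof.
  intros IR NF. apply FinFun.Injective_map_NoDup; auto. intros [a b] [a' b'] E.
  apply In_rots in IR. destruct IR as [-> |[-> |[-> |[-> |[-> | ->]]]]]; cbn [fst snd] in E;
    inversion E; apply injective_projections; cbn [fst snd]; lia.
Qed.

Lemma orbits_NoDup F : NoDup F -> (forall v, In v F -> cone v = true) -> NoDup (orbits F).
Proof.
  intros NF HF.
  assert (HF' : forall v, In v F -> (0 <= snd v < fst v)%Z) by (intros; apply cone_spec, HF; auto).
  unfold orbits, rots. cbn [flat_map].
  repeat (apply NoDup_app; [apply map_NoDup_rots; [unfold rots; simpl; tauto|auto]| |]);
    try apply NoDup_nil; try (intros w _ []);
    intros w Iw Iw'; apply in_map_iff in Iw; destruct Iw as (v & Ev & Iv);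
    rewrite !in_app_iff in Iw'; rewrite !in_map_iff in Iw'; apply HF' in Iv;
    decompose [or] Iw'; try contradiction;
    match goal with H : exists x, _ |- _ => destruct H as (v' & Ev' & Iv') end; apply HF' in Iv';
    rewrite <- Ev in Ev'; destruct v, v'; cbn [fst snd] in *; inversion Ev'; lia.
Qed.

Lemma char_coef_orbit_sum v w : cone v = true -> cone w = true ->
  char_coef v (orbit_sum w) = if zpair_dec v w then RtoC 1 else RtoC 0.
Proof.
  intros Hv Hw. apply cone_spec in Hv, Hw.
  assert (E : orbit_sum w = fun p => csum rots (fun R => (1 * chi (R w) p)%C)).
  { apply functional_extensionality; intros p. apply csum_ext. intros; ring. }
  rewrite E. unfold char_coef. rewrite (torus_coef_csum _ _ rots (fun _ => RtoC 1)
    (fun R => chi (R w))) by (intros; apply chi_smooth).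
  assert (D := fun u => char_coef_chi v u). unfold char_coef in D.
  unfold rots. cbn [csum fold_right]. rewrite !D.
  destruct v as [a b], w as [a' b']. cbn [fst snd] in *.
  (* Of the six images of w only w itself lies in the cone. *)
  assert (N1 : (a, b) <> (b', b' - a')%Z) by (intros X; inversion X; lia).
  assert (N2 : (a, b) <> (b' - a', - a')%Z) by (intros X; inversion X; lia).
  assert (N3 : (a, b) <> (- a', - b')%Z) by (intros X; inversion X; lia).
  assert (N4 : (a, b) <> (- b', a' - b')%Z) by (intros X; inversion X; lia).
  assert (N5 : (a, b) <> (a' - b', a')%Z) by (intros X; inversion X; lia).
  destruct (zpair_dec (a, b) (b', b' - a')%Z); [contradiction|].
  destruct (zpair_dec (a, b) (b' - a', - a')%Z); [contradiction|].
  destruct (zpair_dec (a, b) (- a', - b')%Z); [contradiction|].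
  destruct (zpair_dec (a, b) (- b', a' - b')%Z); [contradiction|].
  destruct (zpair_dec (a, b) (a' - b', a')%Z); [contradiction|].
  destruct (zpair_dec (a, b) (a', b')); ring.
Qed.

Lemma orbit_sum_eigenfun b v : energy v = b -> eigenfun b (orbit_sum v).
Proof.
  intros Hb.
  assert (E : orbit_sum v = fun p => csum rots (fun R => (1 * chi (R v) p)%C)).
  { apply functional_extensionality; intros p. apply csum_ext. intros; ring. }
  rewrite E. split; [apply (flat_csum rots (fun _ => RtoC 1) (fun R => chi (R v))); intros;
    apply chi_flat|].
  intros p.
  replace (Zbarop (fun p => csum rots (fun R => (1 * chi (R v) p)%C))) with
    (fun p => csum rots (fun R => (1 * Zbarop (chi (R v)) p)%C))
    by (apply functional_extensionality; intros q; symmetry;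
        apply (csum_Zbarop rots (fun _ => RtoC 1) (fun R => chi (R v))); intros; apply chi_smooth).
  rewrite (csum_Zop rots (fun _ => RtoC 1) (fun R => Zbarop (chi (R v)))) by (intros;
    apply smooth_Zbarop, chi_smooth).
  rewrite <- csum_scal. apply csum_ext. intros R IR. rewrite chi_level.
  replace (energy (R v)) with b; [ring|]. rewrite <- Hb. unfold energy. rewrite rots_qform; auto.
Qed.

(** Nonzero vectors have orbits of six elements, each with one representative in the cone. A
    rotation-invariant eigenfunction is the mean of its six rotated expansions, and in this
    mean the characters are grouped into orbit sums. *)
Lemma invariant_eigen_dim b (P : list (Z * Z)) : 0 < b -> NoDup P ->
  (forall v, In v P <-> energy v = b) ->
  has_dim (fun f => eigenfun b f /\ forall p, rot f p = f p) (length (filter cone P)) /\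
  length P = (6 * length (filter cone P))%nat.
Proof.
  intros Hb NP HP. set (F := filter cone P).
  assert (NF : NoDup F) by (apply NoDup_filter; auto).
  assert (HF : forall v, In v F -> cone v = true) by (intros v Iv; apply filter_In in Iv; apply Iv).
  assert (HFP : forall v, In v F -> In v P) by (intros v Iv; apply filter_In in Iv; apply Iv).
  assert (Perm : Permutation P (orbits F)).
  { apply NoDup_Permutation; auto; [apply orbits_NoDup; auto|].
    intros w. rewrite In_orbits. split.
    - intros Iw. assert (Ew := proj1 (HP w) Iw).
      destruct (cone_covers w) as (R & v & IR & Cv & ->).
      { intros Z. unfold energy in Ew. rewrite Z in Ew. lra. }
      exists R, v. split; auto. split; auto. apply filter_In. split; auto. apply HP.
      rewrite <- Ew. unfold energy. rewrite rots_qform; auto.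
    - intros (R & v & IR & Iv & ->). apply HP. rewrite <- (proj1 (HP v) (HFP v Iv)).
      unfold energy. rewrite rots_qform; auto. }
  split.
  2:{ rewrite (Permutation_length Perm). unfold orbits, rots. cbn [flat_map].
      rewrite !length_app, !length_map. simpl. lia. }
  apply (has_dim_of_list zpair_dec _ F orbit_sum); auto.
  - intros v Iv. split; [apply orbit_sum_eigenfun, HP; auto|apply orbit_sum_rot].
  - intros a Ha v Iv.
    assert (E : char_coef v (fun p => csum F (fun x => (a x * orbit_sum x p)%C)) = 0).
    (* The zero function is an empty combination, so linearity gives its coefficient. *)
    { replace (fun p => csum F (fun x => (a x * orbit_sum x p)%C)) with
      (fun p : Heis => csum (@nil nat) (fun x => (0 * 0)%C))
        by (apply functional_extensionality; intros p; symmetry; apply Ha).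
      unfold char_coef. rewrite (torus_coef_csum _ _ (@nil nat) (fun _ => RtoC 0)
        (fun _ _ => RtoC 0)) by (intros x []). reflexivity. }
    unfold char_coef in E. rewrite torus_coef_csum in E.
    2:{ intros x Ix. apply (orbit_sum_eigenfun b x), HP; auto. }
    rewrite (csum_single F v) in E; auto.
    + change (torus_coef (fst v) (y_freq v) (orbit_sum v)) with (char_coef v (orbit_sum v)) in E.
      rewrite char_coef_orbit_sum in E by auto. destruct (zpair_dec v v); [|congruence].
      rewrite <- E. ring.
    + intros w Iw Nw. change (torus_coef (fst v) (y_freq v) (orbit_sum w)) with
        (char_coef v (orbit_sum w)).
      rewrite char_coef_orbit_sum by auto. destruct (zpair_dec v w); [congruence|ring].
  - intros f [Ef Rf].
    assert (X := eigenfun_expansion P b f NP HP Ef).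
    assert (XR : forall R p, In R rots -> f p = csum P (fun v => (char_coef v f * chi (R v) p)%C)).
    { assert (St : forall R, (forall p, f p = csum P (fun v => (char_coef v f * chi (R v) p)%C)) ->
        forall p, f p = csum P (fun v => (char_coef v f * chi (rot_index (R v)) p)%C)).
      { intros R HR p. rewrite <- Rf. unfold rot. rewrite HR. apply csum_ext. intros v _.
        rewrite <- chi_rot. reflexivity. }
      assert (X1 := St _ X). assert (X2 := St _ X1). assert (X3 := St _ X2).
      assert (X4 := St _ X3). assert (X5 := St _ X4).
      intros R p IR. apply In_rots in IR.
      destruct IR as [-> |[-> |[-> |[-> |[-> | ->]]]]];
        [rewrite X|rewrite X1|rewrite X2|rewrite X3|rewrite X4|rewrite X5];
        apply csum_ext; intros v _; f_equal; f_equal; unfold rot_index; cbn [fst snd];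
          try (rewrite <- surjective_pairing); auto; pair_eq. }
    (* The mean of the six coefficients over the orbit of v. *)
    exists (fun v => (RtoC (/ 6) * csum rots (fun R => char_coef (R v) f))%C). intros p.
    transitivity (RtoC (/ 6) * csum rots (fun _ => f p))%C.
    + cbn [rots csum fold_right]. rewrite RtoC_inv by lra. field.
    + rewrite (csum_ext rots _ (fun R => csum P (fun v => (char_coef v f * chi (R v) p)%C))) by
        (intros R IR; apply XR; auto).
      rewrite csum_swap, (csum_perm _ _ _ Perm), csum_orbits.
      rewrite csum_swap, <- csum_scal. apply csum_ext. intros v Iv.
      rewrite <- Cmult_assoc. f_equal.
      transitivity (csum rots (fun R => (orbit_sum v p * char_coef (R v) f)%C)).
      * apply csum_ext. intros R IR. rewrite csum_scal. fold (orbit_sum (R v) p). rewrite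
          orbit_sum_rots by auto. ring.
      * rewrite csum_scal. ring.
Qed.

(** * Enumeration of the dual lattice and multiplicities at zero frequency *)

Definition zrange (B : nat) : list Z := map (fun i => (Z.of_nat i - Z.of_nat B)%Z)
  (seq 0 (2 * B + 1)).

Lemma zrange_spec B z : In z (zrange B) <-> (- Z.of_nat B <= z <= Z.of_nat B)%Z.
Proof.
  unfold zrange. rewrite in_map_iff. split.
  - intros (i & <- & Hi). apply in_seq in Hi. lia.
  - intros H. exists (Z.to_nat (z + Z.of_nat B)). split; [lia|]. apply in_seq. lia.
Qed.

Lemma zrange_NoDup B : NoDup (zrange B).
Proof. apply FinFun.Injective_map_NoDup; [intros x y; lia|apply seq_NoDup]. Qed.

Lemma NoDup_pairs {A B} (l : list A) (l' : list B) : NoDup l -> NoDup l' -> NoDup (list_prod l l').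
Proof.
  intros N N'. induction N as [|x l Hx N IH]; simpl; [constructor|].
  apply NoDup_app; auto.
  - apply FinFun.Injective_map_NoDup; auto. intros y y' E; congruence.
  - intros [u v] I I'. apply in_map_iff in I. destruct I as (y & E & _). inversion E; subst.
    apply in_prod_iff in I'. tauto.
Qed.

Lemma energy_finite b : exists P : list (Z * Z), NoDup P /\ forall v, In v P <-> energy v = b.
Proof.
  destruct (INR_unbounded b) as [B HB].
  exists (filter (fun v => if Req_EM_T (energy v) b then true else false)
    (list_prod (zrange B) (zrange B))).
  split.
  - apply NoDup_filter. apply NoDup_pairs; apply zrange_NoDup.
  - intros [p q]. rewrite filter_In, in_prod_iff, !zrange_spec.
    destruct (Req_EM_T (energy (p, q)) b) as [E|E]; split; try tauto;
      try (intros [_ X]; discriminate).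
    intros _. split; auto.
    assert (PP : 9 < PI * PI) by (pose proof PI2_3_2; unfold PI2 in *; nra).
    assert (Q0 : (0 <= qform (p, q))%Z) by (unfold qform; cbn [fst snd]; nia).
    assert (HQ : IZR (qform (p, q)) < IZR (Z.of_nat B)).
    { rewrite <- INR_IZR_INZ. unfold energy in E. apply IZR_le in Q0. nra. }
    apply lt_IZR in HQ. unfold qform in HQ; cbn [fst snd] in HQ.
    pose proof (Z.square_nonneg (2 * q - p)) as S1. pose proof (Z.square_nonneg (2 * p - q)) as S2.
    (* 4 qform (p, q) is 3 p^2 + (2q - p)^2 and also 3 q^2 + (2p - q)^2. *)
    assert (Small : forall x B : Z, (0 <= B -> 3 * (x * x) < 4 * B -> - B <= x <= B)%Z) by (intros;
      nia).
    split; apply Small; lia.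
Qed.

Lemma dual_lattice_spec z : dual_lattice L_eta z <->
  exists v : Z * Z, z = (IZR (fst v), IZR (y_freq v) / s3).
Proof.
  pose proof s3_pos as S3. pose proof s3_sq as SS. split.
  - intros H. destruct (H 1) as [p Hp].
    { exists 1%Z, 0%Z. re_im. }
    destruct (H eta) as [q Hq].
    { exists 0%Z, 1%Z. re_im. }
    exists (p, q). unfold y_freq. cbn [fst snd].
    rewrite eta_eq in Hq. destruct z as [x y]. unfold Re in Hp, Hq; simpl in Hp, Hq.
    apply injective_projections; cbn [fst snd]; [lra|].
    rewrite minus_IZR, mult_IZR, <- Hp, <- Hq. field_simplify_eq; [|lra]. lra.
  - intros [[p q] ->] w (a & b & ->). exists (a * p + b * q)%Z.
    assert (El : IZR (y_freq (p, q)) = 2 * IZR q - IZR p)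
      by (unfold y_freq; cbn [fst snd]; rewrite minus_IZR, mult_IZR; reflexivity).
    rewrite eta_eq, El, plus_IZR, !mult_IZR. cbn [fst snd]. unfold Re; simpl. field. lra.
Qed.

Lemma E_set_spec r kappa z : 0 < r -> E_set r kappa z <->
  exists v : Z * Z, energy v = r * kappa /\ z = (IZR (fst v), IZR (y_freq v) / s3).
Proof.
  intros Hr. pose proof s3_pos as S3. pose proof s3_sq as SS.
  assert (K : forall v : Z * Z, PI ^ 2 * Cmod (IZR (fst v), IZR (y_freq v) / s3) ^ 2 = energy v).
  { intros [p q]. rewrite Cmod2_alt. unfold Re, Im, energy, qform, y_freq. cbn [fst snd].
    rewrite plus_IZR, !minus_IZR, !mult_IZR.
    replace (((2 * IZR q - IZR p) / s3) ^ 2) with ((2 * IZR q - IZR p) ^ 2 / (s3 * s3)) by (field;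
      lra).
    rewrite SS. field. }
  unfold E_set. rewrite dual_lattice_spec. split.
  - intros [[v ->] E]. exists v; split; auto. rewrite <- E, K. field. lra.
  - intros (v & E & ->). split; [eauto|]. rewrite K, E. field. lra.
Qed.

Theorem zero_frequency c r kappa : 0 < r -> 0 < kappa ->
  exists m e : nat, multiplicity (Gamma c) r kappa 0 m /\ has_card (E_set r kappa) e /\ INR m
    = INR e / 6.
Proof.
  intros Hr Hk.
  assert (Hb : 0 < r * kappa) by (apply Rmult_lt_0_compat; auto).
  destruct (energy_finite (r * kappa)) as (P & NP & HP).
  destruct (invariant_eigen_dim (r * kappa) P Hb NP HP) as [HD HL].
  exists (length (filter cone P)), (length P). split; [|split].
  - eapply has_dim_iff; [|exact HD]. intros f.
    assert (Hr0 : r <> 0) by lra.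
    unfold joint_eigenspace, eigenfun, flat.
    assert (Z0 : 0 * c = 2 * PI * IZR 0) by ring.
    assert (RR : rot_eigen 0 f <-> forall p, rot f p = f p).
    { unfold rot_eigen. replace (- (PI * 0 / 3)) with 0 by field. rewrite cis_0.
      split; intros H p; rewrite H; ring. }
    assert (TT := reeb_iff_freq 0 r f Hr0).
    assert (LL := fun p => sublaplacian_iff 0 (r * kappa) r f p Hr0).
    replace (0 / r) with 0 in TT by (field; auto).
    replace ((r * kappa + 0) / r) with kappa in LL by (field; auto).
    split.
    + intros [[(Hs & Ht & H1 & H2) HZ] HR]. split; [auto|split; [|split]].
      * apply (invariant_iff_qp 0 c 0 f Ht Z0). tauto.
      * intros p. apply LL; auto.
      * apply TT; auto.
    + intros (Hs & Hi & HS & HT). apply TT in HT; auto.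
      apply (invariant_iff_qp 0 c 0 f HT Z0) in Hi. destruct Hi as (H1 & H2 & HR).
      split; [split; [tauto|]|tauto]. intros p. apply LL; auto.
  - exists (map (fun v => (IZR (fst v), IZR (y_freq v) / s3) : C) P). split; [|split].
    + apply FinFun.Injective_map_NoDup; auto. intros [p q] [p' q'] E. unfold y_freq in E. cbn
        [fst snd] in E.
      pose proof s3_pos as S3. inversion E as [[E1 E2]]. apply eq_IZR in E1. subst p'.
      assert (E3 : IZR (2 * q - p) = IZR (2 * q' - p)).
      { apply (f_equal (fun x => x * s3)) in E2. unfold Rdiv in E2. rewrite !Rmult_assoc, Rinv_l,
        !Rmult_1_r in E2 by lra. auto. }
      apply eq_IZR in E3. f_equal. lia.
    + intros z. rewrite E_set_spec by auto. rewrite in_map_iff. split.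
      * intros (v & <- & Iv). exists v; split; auto. apply HP; auto.
      * intros (v & Ev & ->). exists v; split; auto. apply HP; auto.
    + apply length_map.
  - rewrite HL, mult_INR. simpl (INR 6). field.
Qed.

Theorem theorem8p2 :
  forall (N : nat) (c r : R),
    Nat.Even N -> (0 < N)%nat ->
    c = 4 * Im eta / INR N ->
    0 < r ->
    heisenberg_bieberbach (Gamma c) ->
    (forall (n : Z) (k : nat), n <> 0%Z ->
       exists m : nat,
         multiplicity (Gamma c) r
           ((4 * INR k + 2) * PI * IZR (Z.abs n) / (c * r))
           (2 * PI * IZR n / (c * r)) m /\
         INR m =
           1 / 6 *
           (IZR (Z.abs n) * INR N
            + 2 * powerRZ (-1) (n + Z.of_nat k)
            + 2 * cos (PI * (IZR (Z.abs n) - INR k + 1) / 3)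
            + 2 / sqrt 3 *
                cos (2 * PI * (IZR (Z.abs n) - INR k) / 3 + PI / 6)
            + 4 / sqrt 3 *
                cos (2 * PI * (IZR (Z.abs n) - INR k + IZR (Z.abs n) * INR N) / 3
                     + PI / 6)))
    /\
    (forall kappa : R, 0 < kappa ->
       exists m e : nat,
         multiplicity (Gamma c) r kappa 0 m /\
         has_card (E_set r kappa) e /\
         INR m = INR e / 6).
Proof.
  intros N c r HN HN0 Hc Hr _. split.
  - intros n k Hn.
    destruct (nonzero_frequency N c r n k HN HN0 Hc Hr Hn) as (m & H1 & H2).
    exists m; split; auto. rewrite H2. apply count_value_statement; auto.
  - intros kappa Hk. apply zero_frequency; auto.
Qed.
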